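(* Let $(X,d)$ be a CAT(0) space and let $Y_t$, $t\in[0,\infty)$, be a family of nonempty closed convex subsets of $X$ with $d_H(Y_t,Y_{t'})\le|t-t'|$ for all $t,t'\in[0,\infty)$, where $d_H$ is the Hausdorff metric. Let $F(t,p):=d_{Y_t}(p)=\min_{y\in Y_t}d(y,p)$. Then for any $x_0\in X$ there is a unique time-dependent gradient curve $\sigma_{x_0}$ of $F$ with $\sigma_{x_0}(0)=x_0$, which runs until the first time it meets the moving set: either there is $t_1\ge 0$ such that $\sigma_{x_0}$ is defined on $[0,t_1]$, $d_{Y_{t_1}}(\sigma_{x_0}(t_1))=0$ and $d_{Y_t}(\sigma_{x_0}(t))>0$ for $t<t_1$ (the curve stops at time $t_1$), or $\sigma_{x_0}$ is defined on $[0,\infty)$ and $d_{Y_t}(\sigma_{x_0}(t))>0$ for all $t$.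
   Context: CAT(0) space: a complete geodesic metric space $(X,d)$ (not necessarily locally compact) whose geodesic triangles are no fatter than their Euclidean comparison triangles. $[xy]$ is the unit-speed geodesic from $x$ to $y$. Tangent cone: the angle $\angle_x(\gamma_1,\gamma_2)$ of two geodesics starting at $x$ is the Alexandrov angle (limit of Euclidean comparison angles). $\Sigma_x$ is the completion, with respect to the intrinsic metric induced by $\angle_x$, of the set of geodesics starting at $x$ modulo $\angle_x=0$. $T_x$ is the Euclidean cone over $\Sigma_x$: elements are pairs $v=(\xi,r)$, $\xi\in\Sigma_x$, $r\ge0$, all $(\xi,0)$ being identified with the vertex $o_x$; $\|(\xi,r)\|=r$; $\langle v,w\rangle=\|v\|\|w\|\cos\theta$ with $\theta$ the angle between $v$ and $w$ (and $0$ if $v$ or $w$ is $o_x$). Right-side tangent vector: a rectifiable curve $\gamma$ has right-side tangent vector $\gamma'(t+)=(\xi,r)\in T_{\gamma(t)}$ if $r=\lim_{t'\to t+}d(\gamma(t'),\gamma(t))/(t'-t)$ exists and $\xi=\lim_{t'\to t+}\xi_{t'}$ exists, where $\xi_{t'}$ is the direction at $\gamma(t)$ of $[\gamma(t)\gamma(t')]$ (if $r=0$, it is the vertex). Gradient: for $G:X\to\mathbb{R}$ locally Lipschitz and convex (each $F_t:=F(t,\cdot)=d_{Y_t}$ is such), the differential $d_xG:T_x\to\mathbb{R}$ is the unique Lipschitz function with $d_xG(\gamma'(0+))=\lim_{t\to0+}(G(\gamma(t))-G(\gamma(0)))/t$ for every curve $\gamma$ with $\gamma(0)=x$ for which $\gamma'(0+)$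 is defined; the downward gradient vector $\nabla_x(-G)$ is the unique $v\in T_x$ with $d_xG(w)\ge-\langle v,w\rangle$ for all $w\in T_x$ and $d_xG(v)=-\langle v,v\rangle$. Time-dependent gradient curve of $F$ (starting at time $0$): a locally Lipschitz curve $\sigma$ on $[0,T]$ (or on $[0,\infty)$) such that for every $t\in[0,T)$ (resp. $t\ge0$) the right-side tangent vector $\sigma'(t+)$ exists and equals $\nabla_{\sigma(t)}(-F_t)$.
   Formalization: The differential of F_t is required to match difference quotients only along constant-speed geodesics, not along every curve with a right-side tangent vector, since with branching geodesics those quotients need not converge; where the original differential exists, the two agree. *)

(* Defs.v *)
From HB Require Import structures.
From mathcomp Require Import all_boot all_order all_algebra.
From mathcomp Require Import all_classical all_reals all_analysis.
From mathcomp Require Import ring lra.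

Set Implicit Arguments.
Unset Strict Implicit.
Unset Printing Implicit Defensive.

Import Order.TTheory GRing.Theory Num.Theory.
Import numFieldNormedType.Exports.

Local Open Scope classical_set_scope.
Local Open Scope ring_scope.

Section curve_length.
Context {R : realType} {A : Type}.

(* Length of [c] on [a, b] with respect to a real-valued (pseudo)distance. *)
Definition curve_length (D : A -> A -> R) (c : R -> A) (a b : R) : \bar R :=
  ereal_sup [set (let F := c \o nth b (a :: s) in
                  \sum_(0 <= i < size s) D (F i) (F i.+1))%:E
            | s in itv_partition a b].

End curve_length.

Section metric_completion.
Context {R : realType} {A : Type}.

(* [D] is an extended pseudodistance.  A point of the completion is a class of
   Cauchy sequences at mutual distance tending to 0, so that points of [A] at
   distance 0 are identified and equality in the completion is Leibniz
   equality. *)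
Implicit Type D : A -> A -> \bar R.

Definition cauchy_for D (u : nat -> A) : Prop :=
  forall e : R, 0 < e -> exists N : nat, forall m n : nat,
    (N <= m)%N -> (N <= n)%N -> (D (u m) (u n) < e%:E)%E.

Definition cauchy_class D (u : nat -> A) : set (nat -> A) :=
  [set v | cauchy_for D v /\ D (u n) (v n) @[n --> \oo] --> 0%E].

Definition completion D : Type :=
  {C : set (nat -> A) | exists2 u, cauchy_for D u & C = cauchy_class D u}.

Definition completion_rep D (xi : completion D) : nat -> A :=
  sval (cid2 (svalP xi)).

Definition completion_dist D (xi eta : completion D) : \bar R :=
  lim (D (completion_rep xi n) (completion_rep eta n) @[n --> \oo]).

Lemma cauchy_for_cst D (a : A) : (D a a <= 0)%E -> cauchy_for D (fun=> a).
Proof.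
by move=> Daa e e0; exists 0%N => m n _ _; rewrite (le_lt_trans Daa)// lte_fin.
Qed.

Definition to_completion D (D0 : forall a, (D a a <= 0)%E) (a : A) : completion D :=
  exist _ (cauchy_class D (fun=> a))
    (ex_intro2 _ _ _ (cauchy_for_cst (D0 a)) erefl).

End metric_completion.

Section CAT0.
Context {R : realType}.

Definition euclidean_dist (u v : R * R) : R :=
  Num.sqrt ((u.1 - v.1) ^+ 2 + (u.2 - v.2) ^+ 2).

Context (X : metricType R).

(* [g], restricted to [0, mdist p q], is the unit-speed geodesic [pq]. *)
Definition geodesic_between (p q : X) (g : R -> X) : Prop :=
  [/\ g 0 = p, g (mdist p q) = q
    & forall s t, 0 <= s <= mdist p q -> 0 <= t <= mdist p q ->
        mdist (g s) (g t) = `|s - t|].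

Definition on_geodesic (p q x : X) : Prop :=
  exists g s, [/\ geodesic_between p q g, 0 <= s <= mdist p q & x = g s].

Definition complete_metric : Prop :=
  forall F : set_system X, ProperFilter F -> cauchy F -> exists x : X, F --> x.

Definition geodesic_space : Prop := forall p q : X, exists g, geodesic_between p q g.

(* Two points of a geodesic triangle on different sides lie on sides sharing a
   vertex, called [p] below; in the Euclidean plane the two equations on [x']
   say that it is the point of the segment [p'q'] corresponding to [x]. *)
Definition thin_triangles : Prop :=
  forall (p q r x y : X) (p' q' r' x' y' : R * R),
    on_geodesic p q x -> on_geodesic p r y ->
    euclidean_dist p' q' = mdist p q ->
    euclidean_dist q' r' = mdist q r ->
    euclidean_dist p' r' = mdist p r ->
    euclidean_dist p' x' = mdist p x -> euclidean_dist x' q' = mdist x q ->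
    euclidean_dist p' y' = mdist p y -> euclidean_dist y' r' = mdist y r ->
    mdist x y <= euclidean_dist x' y'.

Definition CAT0_space : Prop :=
  [/\ complete_metric, geodesic_space & thin_triangles].

Definition geodesically_convex (C : set X) : Prop :=
  forall p q x, C p -> C q -> on_geodesic p q x -> C x.

Definition dist_to (C : set X) (p : X) : R := inf [set mdist y p | y in C].

Definition hausdorff_dist (A B : set X) : \bar R :=
  maxe (ereal_sup [set (dist_to B a)%:E | a in A])
       (ereal_sup [set (dist_to A b)%:E | b in B]).

End CAT0.

Section tangent_cone.
Context {R : realType} {X : metricType R}.

Record geodesic_from (x : X) := GeodesicFrom {
  geod_length : R ;
  geod_map :> R -> X ;
  geod_length_gt0 : 0 < geod_length ;
  geod_start : geod_map 0 = x ;
  geod_isometry : forall s t, 0 <= s <= geod_length -> 0 <= t <= geod_length ->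
    mdist (geod_map s) (geod_map t) = `|s - t| }.

Definition geod_end x (g : geodesic_from x) : X := g (geod_length g).

(* Angle at the vertex of the Euclidean triangle corresponding to [x] (law of
   cosines), for [p] and [q] different from [x]. *)
Definition comparison_angle (x p q : X) : R :=
  acos ((mdist x p ^+ 2 + mdist x q ^+ 2 - mdist p q ^+ 2)
        / (2 * mdist x p * mdist x q)).

Definition angle (x : X) (g h : geodesic_from x) : R :=
  lim (comparison_angle x (g st.1) (h st.2)
        @[st --> (filter_prod (0 : R)^'+ (0 : R)^'+)]).

Definition angle_continuous (x : X) (c : R -> geodesic_from x) : Prop :=
  forall (s e : R), 0 <= s <= 1 -> 0 < e ->
    \forall u \near s, 0 <= u <= 1 -> angle (c s) (c u) < e.

(* The intrinsic (length) metric induced by the angle; it is +oo between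
   directions that are not joined by a curve of finite length. *)
Definition intrinsic_angle (x : X) (g h : geodesic_from x) : \bar R :=
  ereal_inf [set curve_length (@angle x) c 0 1
            | c in [set c | [/\ angle_continuous c, c 0 = g & c 1 = h]]].

Lemma anglexx x (g : geodesic_from x) : angle g g = 0.
Proof.
rewrite /angle; apply: cvg_lim => //; apply: cvg_near_cst.
have l0 := geod_length_gt0 g.
exists ([set s | 0 < s < geod_length g], [set s | 0 < s < geod_length g]).
  by split => /=; near=> s; apply/andP; split.
move=> [s t] /= [/andP[s0 sl] /andP[t0 tl]].
have i a : 0 < a < geod_length g -> mdist x (g a) = a.
  move=> /andP[a0 al]; have := @geod_isometry x g 0 a.
  by rewrite geod_start sub0r normrN gtr0_norm//; apply; rewrite ?lexx ltW//= ltW.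
rewrite /comparison_angle !i ?s0 ?t0// geod_isometry ?(ltW s0) ?(ltW t0) ?ltW//.
rewrite real_normK ?num_real//.
have -> : s ^+ 2 + t ^+ 2 - (s - t) ^+ 2 = 2 * s * t by ring.
by rewrite divff ?acos1// !mulf_neq0// gt_eqF.
Unshelve. all: by end_near. Qed.

Lemma intrinsic_anglexx x (g : geodesic_from x) : (intrinsic_angle g g <= 0)%E.
Proof.
apply: (@le_trans _ _ (curve_length (@angle x) (fun=> g) 0 1)).
  apply: ereal_inf_lbound; exists (fun=> g) => //; split => // s e _ e0.
  by near=> u => _; rewrite anglexx.
apply: ge_ereal_sup => _ [s _ <-].
by rewrite /= lee_fin big1 // => i _; exact: anglexx.
Unshelve. all: by end_near. Qed.

(* The completed space of directions at [x]. *)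
Definition directions (x : X) : Type := completion (@intrinsic_angle x).

Definition direction (x : X) : geodesic_from x -> directions x :=
  to_completion (@intrinsic_anglexx x).

(* Continuous extension of the angle to the completion. *)
Definition dir_angle (x : X) (xi eta : directions x) : R :=
  lim (angle (completion_rep xi n) (completion_rep eta n) @[n --> \oo]).

(* Euclidean cone over the space of directions: all pairs [(xi, 0)] are
   represented by [Vertex], which is also the only element when there are no
   directions; [Vec xi r] is the pair [(xi, r)] with [r > 0]. *)
Inductive tangent_cone (x : X) : Type :=
| Vertex
| Vec of directions x & {posnum R}.
Arguments Vertex {x}.

Definition cone_norm (x : X) (v : tangent_cone x) : R :=
  if v is Vec _ r then r%:num else 0.

Definition cone_dot (x : X) (v w : tangent_cone x) : R :=
  match v, w with
  | Vec xi _, Vec eta _ => cone_norm v * cone_norm w * cos (dir_angle xi eta)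
  | _, _ => 0
  end.

Definition cone_dist (x : X) (v w : tangent_cone x) : R :=
  Num.sqrt (cone_norm v ^+ 2 + cone_norm w ^+ 2 - 2 * cone_dot v w).

Definition rectifiable_on (gamma : R -> X) (a b : R) : Prop :=
  {within `[a, b], continuous gamma} /\
  (curve_length (@mdist R X) gamma a b < +oo)%E.

(* [gamma] has right-side tangent vector [v] at time [t]; the base point
   [x = gamma t] is a separate argument because the type of [v] depends on it.
   Only the values of [gamma] on some [t, b] with [t < b] matter.  If [v] is
   not the vertex then [gamma s != x] for [s] close to [t^+], so that in a
   CAT(0) space there is exactly one [g] as below. *)
Definition right_tangent (gamma : R -> X) (t : R) (x : X) (v : tangent_cone x) :
    Prop :=
  [/\ gamma t = x,
      exists2 b, t < b & rectifiable_on gamma t b,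
      mdist (gamma s) x / (s - t) @[s --> t^'+] --> cone_norm v
    & if v is Vec xi _ then
        forall e : R, 0 < e -> \forall s \near t^'+,
          forall g : geodesic_from x, geod_end g = gamma s ->
            (completion_dist (direction g) xi < e%:E)%E
      else True].

Definition constant_speed_geodesic (gamma : R -> X) : Prop :=
  exists b r : R, [/\ 0 < b, 0 <= r
    & forall s t, 0 <= s <= b -> 0 <= t <= b ->
        mdist (gamma s) (gamma t) = r * `|s - t|].

(* The tangent vectors of geodesics are dense in the tangent cone, so these
   conditions determine [dG].  Curves other than geodesics are not
   considered: even in a CAT(0) space and for a convex Lipschitz [G], the
   difference quotients of [G] along a rectifiable curve that has a right-side
   tangent vector need not converge, because the geodesics from [x] to the
   points of the curve may branch off arbitrarily close to [x]. *)
Definition is_differential (G : X -> R) (x : X) (dG : tangent_cone x -> R) :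
    Prop :=
  (exists L : R, forall v w, `|dG v - dG w| <= L * cone_dist v w) /\
  (forall (gamma : R -> X) (v : tangent_cone x),
     constant_speed_geodesic gamma -> right_tangent gamma 0 v ->
     (G (gamma t) - G x) / t @[t --> 0^'+] --> dG v).

Definition is_downward_gradient (G : X -> R) (x : X) (v : tangent_cone x) :
    Prop :=
  exists dG : tangent_cone x -> R, [/\ is_differential G dG,
    forall w, - cone_dot v w <= dG w & dG v = - cone_dot v v].

End tangent_cone.

Section gradient_curve.
Context {R : realType} {X : metricType R}.

(* The domain of a curve is [0, T] if [T] is finite and [0, +oo[ if
   [T = +oo]; the values of [sigma] outside the domain are irrelevant. *)
Definition time_domain (T : \bar R) : set R := [set t | 0 <= t /\ (t%:E <= T)%E].

Definition locally_lipschitz_on (I : set R) (sigma : R -> X) : Prop :=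
  forall t, I t -> exists e L : R, 0 < e /\
    forall s s', I s -> I s' -> `|s - t| < e -> `|s' - t| < e ->
      mdist (sigma s) (sigma s') <= L * `|s - s'|.

Definition gradient_curve (F : R -> X -> R) (T : \bar R) (sigma : R -> X) :
    Prop :=
  [/\ (0 <= T)%E, locally_lipschitz_on (time_domain T) sigma
    & forall t, 0 <= t -> (t%:E < T)%E ->
        exists v : tangent_cone (sigma t),
          right_tangent sigma t v /\ is_downward_gradient (F t) v].

Definition runs_until_meeting (Y : R -> set X) (T : \bar R) (sigma : R -> X) :
    Prop :=
  (exists t1 : R, [/\ 0 <= t1, T = t1%:E, dist_to (Y t1) (sigma t1) = 0
     & forall t, 0 <= t < t1 -> 0 < dist_to (Y t) (sigma t)]) \/
  (T = +oo%E /\ forall t, 0 <= t -> 0 < dist_to (Y t) (sigma t)).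

End gradient_curve.

(* Main.v *)
Require Import Defs.
From mathcomp Require Import all_boot all_order all_algebra.
From mathcomp Require Import all_classical all_reals all_analysis.
From mathcomp Require Import ring lra.

Set Implicit Arguments.
Unset Strict Implicit.
Unset Printing Implicit Defensive.

Import Order.TTheory GRing.Theory Num.Theory.
Import numFieldNormedType.Exports.

Local Open Scope classical_set_scope.
Local Open Scope ring_scope.

(* Off [Y t] the downward gradient of [F t] is the unit direction to the nearest
   point.  Moving with unit speed toward nearest points along a dyadic time grid,
   Reshetnyak's quadrilateral inequality makes the discrete curves converge to a
   curve [s] with the evolution variational inequality
     d(s b, z)^2 <= d(s a, z)^2 + 2 (b - a) (F a z - F a (s a)) + 3 (b - a)^2,
   which forces the right tangent of [s] to be the gradient.  For uniqueness,
   the directions of a gradient curve at [p] determine its distances to other points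
   only when it stays close to a geodesic issuing from [p].  When the curve approaches
   some [q] at almost unit speed, it stays close to the geodesic from [p] to [q], which
   therefore leaves [p] almost in the gradient direction; with [q] a nearby later
   point of the curve itself, this happens outside a set of times of small measure.
   Hence every gradient curve satisfies an infinitesimal form of the inequality above,
   and its distance to [s] cannot grow. *)

(** * Comparison inequalities and projections *)

(** The obstacle in uniqueness is that an Alexandrov angle is a limit. A small angle between [g] and
    the geodesic from [p] to [c k] says nothing about the distance from [c k] to [g k]: that
    geodesic changes with [k] and may branch off from [g] on a scale much smaller than [k]. A second
    geodesic that does not depend on [k] restores the information, because the distance between two
    fixed geodesics grows linearly near their common origin. The bad times are handled without
    measure theory, by a penalty added to a function to which a one-step monotonicity principle
    applies. Two gradient curves are never compared with each other, only with [s]. The inequality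
    of [s] has an error term independent of [z], so it can be used with a [z] that moves with the
    step; the infinitesimal inequality of a gradient curve has a threshold depending on [z], so
    there [z] must stay fixed. Adding one of each kind makes the distance terms cancel. *)

Lemma euclidean_distE (R : realType) (u v : R * R) (c : R) : 0 <= c ->
  (u.1 - v.1) ^+ 2 + (u.2 - v.2) ^+ 2 = c ^+ 2 -> euclidean_dist u v = c.
Proof. by move=> c0 uv; rewrite /euclidean_dist uv sqrtr_sqr ger0_norm. Qed.

Section cat0_inequalities.
Context {R : realType} {X : metricType R} (hX : CAT0_space X).
Implicit Types (p q r x y z : X) (g h : R -> X).

Lemma geodesic_between_startdist p q g s : geodesic_between p q g ->
  0 <= s <= mdist p q -> mdist p (g s) = s.
Proof.
move=> [g0 g1 giso] s01; rewrite -g0 giso//; last by rewrite lexx mdist_ge0.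
by rewrite sub0r normrN ger0_norm//; case/andP: s01.
Qed.

Lemma geodesic_between_enddist p q g s : geodesic_between p q g ->
  0 <= s <= mdist p q -> mdist (g s) q = mdist p q - s.
Proof.
move=> [g0 g1 giso] s01; rewrite -[in LHS]g1 giso//; last by rewrite lexx mdist_ge0.
by rewrite distrC ger0_norm// subr_ge0; case/andP: s01.
Qed.

(** With [p'] at the origin, the right-hand side is the squared Euclidean distance of [l q'] and
    [m r']: by the law of cosines the last parenthesis is twice the inner product of [q'] and [r'].
    All later uses of curvature go through this polynomial form. *)
Lemma comparison_thin p q r g h (l m : R) :
  geodesic_between p q g -> geodesic_between p r h ->
  0 <= l <= 1 -> 0 <= m <= 1 ->
  mdist (g (l * mdist p q)) (h (m * mdist p r)) ^+ 2 <=
    l ^+ 2 * mdist p q ^+ 2 + m ^+ 2 * mdist p r ^+ 2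
    - l * m * (mdist p q ^+ 2 + mdist p r ^+ 2 - mdist q r ^+ 2).
Proof.
move=> gpq hpr /andP[l0 l1] /andP[m0 m1].
have := metric_triangle p q r; have := metric_triangle q p r.
have := metric_triangle p r q; rewrite (metric_sym q p) (metric_sym r q).
have := mdist_ge0 p q; have := mdist_ge0 p r; have := mdist_ge0 q r.
have lI : 0 <= l * mdist p q <= mdist p q.
  by rewrite mulr_ge0 ?mdist_ge0//= ler_piMl ?mdist_ge0.
have mI : 0 <= m * mdist p r <= mdist p r.
  by rewrite mulr_ge0 ?mdist_ge0//= ler_piMl ?mdist_ge0.
have gx := geodesic_between_startdist gpq lI.
have gy := geodesic_between_startdist hpr mI.
have gx' := geodesic_between_enddist gpq lI.
have gy' := geodesic_between_enddist hpr mI.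
have xg : on_geodesic p q (g (l * mdist p q)) by exists g, (l * mdist p q).
have yh : on_geodesic p r (h (m * mdist p r)) by exists h, (m * mdist p r).
case: hX => _ _ /(_ p q r _ _ _ _ _ _ _ xg yh) thin.
move: thin gx gy gx' gy' gpq lI mI.
set a := mdist p q; set b := mdist p r; set e := mdist q r.
move=> thin gx gy gx' gy' [g0 _ _] lI mI e0 b0 a0 ab1 ab2 ab3.
have [a_eq0|a_neq0] := eqVneq a 0.
  have pq : p = q by apply: mdist_positivity.
  have -> : e = b by rewrite /e -pq.
  by rewrite a_eq0 mulr0 g0 gy; lra.
have {}a0 : 0 < a by rewrite lt_neqAle eq_sym a_neq0.
pose u := (a ^+ 2 + b ^+ 2 - e ^+ 2) / (2 * a).
have ua : 2 * a * u = a ^+ 2 + b ^+ 2 - e ^+ 2 by rewrite /u; field.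
have u1 : 0 <= b - u.
  have : 0 <= 2 * a * (b - u) by rewrite mulrBr ua; nra.
  by rewrite pmulr_rge0 ?mulr_gt0.
have u2 : 0 <= b + u.
  have : 0 <= 2 * a * (b + u) by rewrite mulrDr ua; nra.
  by rewrite pmulr_rge0 ?mulr_gt0.
pose v := Num.sqrt (b ^+ 2 - u ^+ 2).
have vE : v ^+ 2 = b ^+ 2 - u ^+ 2 by rewrite sqr_sqrtr// subr_sqr mulr_ge0.
have al : 0 <= a - l * a by case/andP: lI; rewrite subr_ge0.
have bm : 0 <= b - m * b by case/andP: mI; rewrite subr_ge0.
case/andP: lI => lI _; case/andP: mI => mI _.
have := thin (0, 0) (a, 0) (u, v) (l * a, 0) (m * u, m * v).
have vm k : (k * v) ^+ 2 = k ^+ 2 * (b ^+ 2 - u ^+ 2) by rewrite exprMn vE.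
have D := @euclidean_distE R.
rewrite gx gx' gy gy' !(D (0, 0) (a, 0) a, D (a, 0) (u, v) e, D (0, 0) (u, v) b,
  D (0, 0) (l * a, 0) (l * a), D (l * a, 0) (a, 0) (a - l * a),
  D (0, 0) (m * u, m * v) (m * b), D (m * u, m * v) (u, v) (b - m * b)) //=.
- do 7 move=> /(_ erefl); rewrite -(@ler_pXn2r _ 2)// ?nnegrE ?mdist_ge0 ?sqrtr_ge0//.
  move=> /le_trans; apply; rewrite sqr_sqrtr/= ?addr_ge0 ?sqr_ge0//.
  rewrite sub0r sqrrN vm.
  have -> : l * m * (a ^+ 2 + b ^+ 2 - e ^+ 2) = 2 * l * m * a * u.
    by rewrite -ua; ring.
  lra.
- have -> : m * v - v = (m - 1) * v by ring.
  rewrite vm; ring.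
- rewrite !sub0r !sqrrN vm; ring.
- ring.
- ring.
- rewrite !sub0r !sqrrN vE; ring.
- rewrite sub0r sqrrN vE.
  have -> : e ^+ 2 = a ^+ 2 + b ^+ 2 - 2 * a * u by rewrite ua; ring.
  ring.
- by rewrite ltW.
- ring.
Qed.

(** Taking [m = 1] makes the second point [r] itself; the result is the strong convexity of the
    squared distance along geodesics. *)
Lemma stewart p q r g (l : R) : geodesic_between p q g -> 0 <= l <= 1 ->
  mdist (g (l * mdist p q)) r ^+ 2 <=
    (1 - l) * mdist p r ^+ 2 + l * mdist q r ^+ 2 - l * (1 - l) * mdist p q ^+ 2.
Proof.
move=> gpq l01; case: (hX) => _ /(_ p r)[h hpr] _.
have := comparison_thin gpq hpr l01 (m := 1); rewrite ler01 lexx => /(_ isT).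
by case: hpr => _ hr _; rewrite mul1r hr => /le_trans; apply; lra.
Qed.

(** Stewart's inequality bounds the distances from [a] and from [c] to a point of the diagonal
    [b e], and the triangle inequality through that point bounds the diagonal [a c]. *)
Lemma quadrilateral (a b c e : X) :
  mdist a c ^+ 2 + mdist b e ^+ 2 <=
    mdist a e ^+ 2 + mdist b c ^+ 2 + 2 * mdist a b * mdist c e.
Proof.
have [ab0|ab_neq0] := eqVneq (mdist a b) 0.
  by rewrite (mdist_positivity _ _ ab0) mdistxx; lra.
have [ce0|ce_neq0] := eqVneq (mdist c e) 0.
  by rewrite (mdist_positivity _ _ ce0) mdistxx; lra.
have ab0 : 0 < mdist a b by rewrite lt_neqAle eq_sym ab_neq0 mdist_ge0.
have ce0 : 0 < mdist c e by rewrite lt_neqAle eq_sym ce_neq0 mdist_ge0.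
(* This ratio gives [(1 - l) * mdist a b = l * mdist c e], so that the squares of these two sides
   combine into exactly the product of the sides. *)
pose l := mdist a b / (mdist a b + mdist c e).
have lE : l * (mdist a b + mdist c e) = mdist a b.
  by rewrite divfK// gt_eqF ?addr_gt0.
have l0 : 0 < l by rewrite divr_gt0 ?addr_gt0.
have l1 : 0 < 1 - l.
  by rewrite subr_gt0 ltr_pdivrMr ?addr_gt0// mul1r ltrDl.
have lI : 0 <= l <= 1 by rewrite ltW//= -subr_ge0 ltW.
case: (hX) => _ /(_ b e)[g gbe] _.
have ma := stewart a gbe lI; have mc := stewart c gbe lI.
set m := g _ in ma mc.
have acm := metric_triangle a m c; move: ma mc acm lE.
rewrite (metric_sym m a) (metric_sym b a) (metric_sym e a) (metric_sym e c).
have := mdist_ge0 a m; have := mdist_ge0 m c; have := mdist_ge0 a c.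
move: (mdist a m) (mdist m c) (mdist a c) (mdist a b) (mdist c e) (mdist b e)
  (mdist a e) (mdist b c) ab0 ce0 => am mc ac ab ce be ae bc ab0 ce0.
move=> ac0 mc0 am0 Ham Hmc tri lE.
have tri2 : ac ^+ 2 <= (am + mc) ^+ 2 by rewrite ler_pXn2r// nnegrE addr_ge0.
have young : l * (1 - l) * ac ^+ 2 <= (1 - l) * am ^+ 2 + l * mc ^+ 2.
  apply: (@le_trans _ _ (l * (1 - l) * (am + mc) ^+ 2)).
    by rewrite ler_wpM2l// mulr_ge0// ltW.
  rewrite -subr_ge0 (_ : _ - _ = ((1 - l) * am - l * mc) ^+ 2) ?sqr_ge0//; ring.
have ll0 : 0 < l * (1 - l) by rewrite mulr_gt0.
rewrite -(ler_pM2l ll0).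
have lE' : (1 - l) * ab = l * ce by rewrite mulrBl -{1}lE; ring.
have e1 : (1 - l) ^+ 2 * ab ^+ 2 = l * (1 - l) * (ab * ce).
  by rewrite -exprMn expr2 {1}lE'; ring.
have e2 : l ^+ 2 * ce ^+ 2 = l * (1 - l) * (ab * ce).
  by rewrite -exprMn expr2 -{1}lE'; ring.
have : (1 - l) * am ^+ 2 <= (1 - l) * ((1 - l) * ab ^+ 2 + l * ae ^+ 2 - l * (1 - l) * be ^+ 2).
  by rewrite ler_wpM2l// ltW.
have : l * mc ^+ 2 <= l * ((1 - l) * bc ^+ 2 + l * ce ^+ 2 - l * (1 - l) * be ^+ 2).
  by rewrite ler_wpM2l// ltW.
lra.
Qed.

End cat0_inequalities.

(** * Nearest points of closed convex sets *)

Section projections.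
Context {R : realType} {X : metricType R} (hX : CAT0_space X).
Implicit Types (p q x y z : X) (g h : R -> X) (C : set X).

Lemma cauchy_seq_limit (u : nat -> X) :
  (forall e : R, 0 < e -> exists N, forall m n,
     (N <= m)%N -> (N <= n)%N -> mdist (u m) (u n) <= e) ->
  exists x, u n @[n --> \oo] --> x.
Proof.
move=> uC; case: hX => /(_ (u n @[n --> \oo])) cX _ _; apply: cX.
apply: cauchy_exP => e e0.
have [N uN] := uC _ (divr_gt0 e0 (ltr0Sn R 1)).
exists (u N); exists N => // n /= Nn; rewrite ballEmdist /=.
by rewrite (le_lt_trans (uN _ _ _ _))// ltr_pdivrMr// ltr_pMr// ltr1n.
Qed.

Lemma cvg_mdist (u : nat -> X) x : u n @[n --> \oo] --> x <->
  mdist x (u n) @[n --> \oo] --> (0 : R).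
Proof.
split=> [/cvg_ballP ux|/cvgrPdist_lt ux].
  apply/cvgrPdist_lt => e e0; have := ux _ e0.
  by apply: filterS => n; rewrite ballEmdist /= sub0r normrN ger0_norm ?mdist_ge0.
apply/cvg_ballP => e e0; have := ux _ e0.
by apply: filterS => n; rewrite ballEmdist /= sub0r normrN ger0_norm ?mdist_ge0.
Qed.

Lemma dist_to_le C p y : C y -> dist_to C p <= mdist p y.
Proof.
move=> Cy; rewrite metric_sym; apply: ge_inf; last by exists y.
by exists 0 => _ [z _ <-]; exact: mdist_ge0.
Qed.

Lemma dist_to_ge0 C p : C !=set0 -> 0 <= dist_to C p.
Proof.
move=> [y Cy]; apply: lb_le_inf; first by exists (mdist y p), y.
by move=> _ [z _ <-]; exact: mdist_ge0.
Qed.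

Lemma dist_to_adherent C p (e : R) : C !=set0 -> 0 < e ->
  exists2 y, C y & mdist p y < dist_to C p + e.
Proof.
move=> [y Cy] e0; have [] := inf_adherent (E := [set mdist y p | y in C]) e0.
  split; first by exists (mdist y p), y.
  by exists 0 => _ [z _ <-]; exact: mdist_ge0.
by move=> _ [z Cz <-] zp; exists z => //; rewrite metric_sym.
Qed.

Lemma dist_to_lipschitz C p q : C !=set0 ->
  dist_to C p <= dist_to C q + mdist p q.
Proof.
move=> C0; apply/ler_addgt0Pr => e e0.
have [y Cy ye] := dist_to_adherent q C0 e0.
apply: (le_trans (dist_to_le p Cy)); have := metric_triangle p q y; lra.
Qed.

(** The midpoint of [y] and [y'] lies in [C], so it is no nearer to [p] than [dist_to C p];
    Stewart's inequality at [1/2] then bounds [mdist y y']. Minimizing sequences are therefore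
    Cauchy, which replaces compactness. *)
Lemma almost_nearest_close C p y y' (e : R) : geodesically_convex C ->
  C y -> C y' -> 0 <= e ->
  mdist p y <= dist_to C p + e -> mdist p y' <= dist_to C p + e ->
  mdist y y' ^+ 2 <= 4 * e * (2 * dist_to C p + e).
Proof.
move=> cC Cy Cy' e0 ye y'e; case: (hX) => _ /(_ y y')[g gyy'] _.
have h01 : 0 <= (2^-1 : R) <= 1 by apply/andP; split; lra.
have Cm : C (g (2^-1 * mdist y y')).
  apply: cC Cy Cy' _; exists g, (2^-1 * mdist y y'); split => //.
  by have := mdist_ge0 y y' => ?; apply/andP; split; lra.
have := stewart hX p gyy' h01; have := dist_to_le p Cm.
have D0 := dist_to_ge0 p (ex_intro _ _ Cy).
rewrite (metric_sym y p) (metric_sym y' p) (metric_sym _ p).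
move: (mdist p _) => m Dm.
have : dist_to C p ^+ 2 <= m ^+ 2.
  by rewrite ler_pXn2r// nnegrE// (le_trans D0).
have sq y'' : mdist p y'' <= dist_to C p + e ->
    mdist p y'' ^+ 2 <= (dist_to C p + e) ^+ 2.
  by move=> ?; rewrite ler_pXn2r// nnegrE ?mdist_ge0 ?addr_ge0.
have := sq _ ye; have := sq _ y'e; lra.
Qed.

Lemma nearest_point C p : C !=set0 -> closed C -> geodesically_convex C ->
  exists2 y, C y & mdist p y = dist_to C p.
Proof.
move=> C0 clC cC.
have e0 n : (0 : R) < n.+1%:R^-1 by rewrite invr_gt0 ltr0Sn.
have [u uP] : {u : nat -> X & forall n,
    C (u n) /\ mdist p (u n) < dist_to C p + n.+1%:R^-1}.
  apply: (@choice _ _ (fun n y => C y /\ mdist p y < dist_to C p + n.+1%:R^-1)).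
  by move=> n; have [y ? ?] := dist_to_adherent p C0 (e0 n); exists y.
have D0 := dist_to_ge0 p C0.
have [y uy] : exists y, u n @[n --> \oo] --> y.
  apply: cauchy_seq_limit => e e_gt0.
  (* Chosen so that [4 * d * (2 * dist_to C p + d) <= e ^+ 2], using [d <= 1] in the last factor. *)
  pose d := Num.min (1 : R) (e ^+ 2 / (4 * (2 * dist_to C p + 1))).
  have d0 : 0 < d.
    rewrite lt_min ltr01/= divr_gt0 ?exprn_gt0// mulr_gt0// ltr_wpDl// mulr_ge0//.
  have [N _ Nd] : \forall n \near \oo, n.+1%:R^-1 < d.
    exact: (near_infty_natSinv_lt (PosNum d0)).
  exists N => m n Nm Nn.
  have near_u k : (N <= k)%N -> mdist p (u k) <= dist_to C p + d.
    move=> Nk; have [_ /ltW/le_trans] := uP k; apply; rewrite lerD2l ltW//.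
    exact: Nd.
  rewrite -(@ler_pXn2r _ 2)// ?nnegrE ?mdist_ge0 ?(ltW e_gt0)//.
  have := almost_nearest_close cC (uP m).1 (uP n).1 (ltW d0) (near_u _ Nm) (near_u _ Nn).
  move=> /le_trans; apply.
  have d1 : d <= 1 by rewrite ge_min lexx.
  have : d <= e ^+ 2 / (4 * (2 * dist_to C p + 1)) by rewrite ge_min lexx orbT.
  rewrite ler_pdivlMr; last by rewrite mulr_gt0// ltr_wpDl// mulr_ge0.
  nra.
exists y; first by apply: (closed_cvg C clC _ _ uy); apply: nearW => n; exact: (uP n).1.
apply/eqP; rewrite eq_le dist_to_le ?andbT; last first.
  by apply: (closed_cvg C clC _ _ uy); apply: nearW => n; exact: (uP n).1.
apply/ler_addgt0Pr => e e_gt0.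
have e2 : 0 < e / 2 by rewrite divr_gt0.
have [N _ Nd] := near_infty_natSinv_lt (PosNum e2).
have /cvgrPdist_lt/(_ _ e2)[M _ Md] := (cvg_mdist u y).1 uy.
have := Nd (maxn N M) (leq_maxl _ _); have := Md (maxn N M) (leq_maxr _ _).
rewrite /= sub0r normrN ger0_norm ?mdist_ge0// (metric_sym y).
have := (uP (maxn N M)).2; have := metric_triangle p (u (maxn N M)) y.
by move: (_.+1%:R^-1) => k; lra.
Qed.

(** Points of the segment from [q] to [y] stay in [C], so they are no nearer to [p] than [q].
    Stewart's inequality divided by the parameter [l] then yields, as [l] tends to 0, an angle at
    [q] that is at least right. *)
Lemma nearest_obtuse C p q y : geodesically_convex C -> C q ->
  mdist p q = dist_to C p -> C y ->
  dist_to C p ^+ 2 + mdist q y ^+ 2 <= mdist p y ^+ 2.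
Proof.
move=> cC Cq pq Cy; apply/ler_addgt0Pr => e e0.
case: (hX) => _ /(_ q y)[g gqy] _.
pose l := Num.min 1 (e / (mdist q y ^+ 2 + 1)).
have s0 : 0 < mdist q y ^+ 2 + 1 by rewrite ltr_wpDl ?sqr_ge0.
have l0 : 0 < l by rewrite lt_min ltr01/= divr_gt0.
have l1 : l <= 1 by rewrite ge_min lexx.
have le : l * mdist q y ^+ 2 <= e.
  apply: (@le_trans _ _ (l * (mdist q y ^+ 2 + 1))).
    by rewrite ler_wpM2l ?(ltW l0)// lerDl.
  by rewrite -ler_pdivlMr// ge_min lexx orbT.
have Cm : C (g (l * mdist q y)).
  apply: cC Cq Cy _; exists g, (l * mdist q y); split => //.
  by rewrite mulr_ge0 ?mdist_ge0 ?(ltW l0)//= ler_piMl ?mdist_ge0.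
have := stewart hX p gqy (l := l); rewrite (ltW l0) l1 => /(_ isT).
have := dist_to_le p Cm.
rewrite (metric_sym q p) (metric_sym y p) (metric_sym _ p) pq.
have D0 := dist_to_ge0 p (ex_intro _ _ Cq).
move: (mdist p (g _)) => m Dm.
have : dist_to C p ^+ 2 <= m ^+ 2.
  by rewrite ler_pXn2r// nnegrE// (le_trans D0).
move=> h1 /(le_trans h1) h2; rewrite -(ler_pM2l l0); move: h2.
have : l * (l * mdist q y ^+ 2) <= l * e by rewrite ler_wpM2l ?(ltW l0).
lra.
Qed.

(** Reshetnyak's inequality for [p], [q], [z] and the nearest point [y] of [z], where the obtuse
    angle at [q] bounds [mdist p y] from below. It is the evolution inequality for a step all the
    way to [q]. *)
Lemma nearest_reshetnyak C p q z : C !=set0 -> closed C -> geodesically_convex C ->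
  C q -> mdist p q = dist_to C p ->
  mdist q z ^+ 2 + dist_to C p ^+ 2 <=
    mdist p z ^+ 2 + 2 * dist_to C p * dist_to C z.
Proof.
move=> C0 clC cC Cq pq; have [y Cy zy] := nearest_point z C0 clC cC.
have := nearest_obtuse cC Cq pq Cy; have := quadrilateral hX p q y z.
by rewrite pq (metric_sym y z) zy; lra.
Qed.

(** Stewart's inequality interpolates between no step and the full step to [q]. A step longer than
    the distance stops at [q]; the excess only enlarges the bound, by its square and twice its
    product with [dist_to C z]. *)
Lemma toward_nearest_step C p q g z (s : R) :
  C !=set0 -> closed C -> geodesically_convex C -> C q ->
  mdist p q = dist_to C p -> geodesic_between p q g -> 0 <= s ->
  mdist (g (Num.min s (dist_to C p))) z ^+ 2 <=
    mdist p z ^+ 2 + 2 * s * (dist_to C z - dist_to C p) + s ^+ 2.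
Proof.
move=> C0 clC cC Cq pq gpq s0.
have key := nearest_reshetnyak z C0 clC cC Cq pq.
have Fp0 := dist_to_ge0 p C0; have Fz0 := dist_to_ge0 z C0.
have [sF|Fs] := leP s (dist_to C p); last first.
  case: gpq => _ gq _; rewrite -pq gq pq.
  have : 0 <= (s - dist_to C p) * dist_to C z by rewrite mulr_ge0// subr_ge0 ltW.
  have := sqr_ge0 (s - dist_to C p); lra.
have [F0|F0] := eqVneq (dist_to C p) 0.
  have -> : s = 0 by apply/eqP; rewrite eq_le s0 andbT -F0.
  by case: gpq => -> _ _; lra.
have {}F0 : 0 < dist_to C p by rewrite lt_neqAle eq_sym F0.
have l01 : 0 <= s / dist_to C p <= 1.
  by rewrite divr_ge0//= ler_pdivrMr// mul1r.
have := stewart hX z gpq l01; rewrite pq divfK ?gt_eqF//.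
move=> /le_trans; apply; set l := s / _ in l01 *.
have sE : s = l * dist_to C p by rewrite divfK ?gt_eqF.
case/andP: l01 => l0 _.
have : l * (mdist q z ^+ 2 + dist_to C p ^+ 2) <= l * (mdist p z ^+ 2 + 2 * dist_to C p * dist_to C z).
  by rewrite ler_wpM2l.
rewrite {}sE; lra.
Qed.

End projections.

(** * Angles *)

Lemma le_cos (R : realType) (a b : R) : 0 <= a <= pi -> 0 <= b <= pi ->
  (cos a <= cos b) = (b <= a).
Proof. by move=> a0 b0; rewrite !leNgt ltr_cos ?in_itv. Qed.

Lemma le_acos (R : realType) (a b : R) : -1 <= a -> a <= b -> b <= 1 ->
  acos b <= acos a.
Proof.
move=> a1 ab b1; have aI : -1 <= a <= 1 by rewrite a1 (le_trans ab).
have bI : -1 <= b <= 1 by rewrite b1 (le_trans a1 ab).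
by rewrite -le_cos ?acos_ge0 ?acos_lepi// !acosK ?in_itv.
Qed.

Section alexandrov_angle.
Context {R : realType} {X : metricType R} (hX : CAT0_space X) {x : X}.
Implicit Types (g h k : geodesic_from x) (s t : R).

Lemma geodesic_from_dist g s : 0 <= s <= geod_length g -> mdist x (g s) = s.
Proof.
move=> /andP[s0 sl]; have := @geod_isometry _ _ _ g 0 s.
rewrite geod_start sub0r normrN ger0_norm// lexx s0 sl/= => -> //.
by rewrite ltW ?geod_length_gt0.
Qed.

Lemma geodesic_from_between g s : 0 <= s <= geod_length g ->
  geodesic_between x (g s) g.
Proof.
move=> sI; have xgs := geodesic_from_dist sI; case/andP: sI => s0 sl.
split; rewrite ?xgs//; first exact: geod_start.
move=> u v /andP[u0 us] /andP[v0 vs]; apply: geod_isometry.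
  by rewrite u0 (le_trans us).
by rewrite v0 (le_trans vs).
Qed.

(** The cosine of the comparison angle at [x]. Inequalities on it are polynomial in the distances;
    [acos] enters only where the angle itself is needed. *)
Definition comparison_cos g h s t : R :=
  (s ^+ 2 + t ^+ 2 - mdist (g s) (h t) ^+ 2) / (2 * s * t).

Lemma mdist_comparison_cos g h s t : 0 < s -> 0 < t ->
  mdist (g s) (h t) ^+ 2 = s ^+ 2 + t ^+ 2 - 2 * s * t * comparison_cos g h s t.
Proof. by move=> s0 t0; rewrite mulrC divfK ?mulf_neq0 ?gt_eqF//; ring. Qed.

Lemma comparison_cos_itv g h s t : 0 < s <= geod_length g ->
  0 < t <= geod_length h -> -1 <= comparison_cos g h s t <= 1.
Proof.
move=> /andP[s0 sl] /andP[t0 tl]; rewrite ler_pdivlMr ?mulr_gt0//.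
rewrite ler_pdivrMr ?mulr_gt0//.
have := metric_triangle (g s) x (h t); have := metric_triangle x (g s) (h t).
have := metric_triangle x (h t) (g s); have := mdist_ge0 (g s) (h t).
rewrite (metric_sym (g s) x) (metric_sym (h t) (g s)).
rewrite !geodesic_from_dist ?sl ?tl ?(ltW s0) ?(ltW t0)//.
move: (mdist _ _) => d d0 h1 h2 h3; apply/andP; split; nra.
Qed.

(** Shrinking the sides by [s' / s] and [t' / t] in [comparison_thin] keeps the angle of the
    comparison triangle, so comparison angles can only decrease. This monotonicity makes Alexandrov
    angles exist. *)
Lemma comparison_cos_mono g h s t s' t' :
  0 < s' <= s -> s <= geod_length g -> 0 < t' <= t -> t <= geod_length h ->
  comparison_cos g h s t <= comparison_cos g h s' t'.
Proof.
move=> /andP[s'0 ss] sl /andP[t'0 tt] tl.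
have s0 := lt_le_trans s'0 ss; have t0 := lt_le_trans t'0 tt.
have sI : 0 <= s <= geod_length g by rewrite (ltW s0).
have tI : 0 <= t <= geod_length h by rewrite (ltW t0).
have lI : 0 <= s' / s <= 1 by rewrite divr_ge0 ?(ltW s0) ?(ltW s'0)//= ler_pdivrMr// mul1r.
have mI : 0 <= t' / t <= 1 by rewrite divr_ge0 ?(ltW t0) ?(ltW t'0)//= ler_pdivrMr// mul1r.
have := comparison_thin hX (geodesic_from_between sI) (geodesic_from_between tI) lI mI.
rewrite !geodesic_from_dist// !divfK ?gt_eqF//.
rewrite !mdist_comparison_cos//.
have sE : s' = s' / s * s by rewrite divfK ?gt_eqF.
have tE : t' = t' / t * t by rewrite divfK ?gt_eqF.
move=> H; rewrite -(ler_pM2l (x := 2 * s' * t')) ?mulr_gt0//.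
move: (s' / s) (t' / t) sE tE H => l m -> ->; lra.
Qed.

Lemma comparison_angleE g h s t : 0 <= s <= geod_length g -> 0 <= t <= geod_length h ->
  comparison_angle x (g s) (h t) = acos (comparison_cos g h s t).
Proof. by move=> sI tI; rewrite /comparison_angle !geodesic_from_dist. Qed.

(** Monotonicity of comparison angles turns the limit defining the angle into an infimum; the second
    component allows sides with an almost minimal comparison angle to be picked. *)
Lemma angle_inf g h :
  let A := [set a | exists s t, [/\ 0 < s <= geod_length g,
    0 < t <= geod_length h & a = acos (comparison_cos g h s t)]] in
  angle g h = inf A /\ has_inf A.
Proof.
move=> A; have lg := geod_length_gt0 g; have lh := geod_length_gt0 h.
have hA : has_inf A.
  split; first by exists (acos (comparison_cos g h (geod_length g) (geod_length h))),
    (geod_length g), (geod_length h); rewrite lg lh !lexx.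
  by exists 0 => _ [s [t [sI tI ->]]]; rewrite acos_ge0// comparison_cos_itv.
split=> //; rewrite /angle; apply: cvg_lim => //.
apply/cvgrPdist_le => e e0.
have [a [s [t [/andP[s0 sl] /andP[t0 tl] ->]]] ae] := inf_adherent e0 hA.
exists ([set u | 0 < u <= s], [set u | 0 < u <= t]).
  by split => /=; near=> u; apply/andP; split => //; near: u; exact: nbhs_right_le.
move=> [u v] /= [/andP[u0 us] /andP[v0 vt]].
have ul := le_trans us sl; have vl := le_trans vt tl.
have Auv : A (acos (comparison_cos g h u v)).
  by exists u, v; rewrite u0 v0.
rewrite comparison_angleE ?(ltW u0) ?(ltW v0)// distrC ger0_norm.
  rewrite lerBlDl (le_trans _ (ltW ae))//.
  have /andP[? ?] : -1 <= comparison_cos g h s t <= 1 by rewrite comparison_cos_itv ?s0 ?t0.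
  have /andP[? ?] : -1 <= comparison_cos g h u v <= 1 by rewrite comparison_cos_itv ?u0 ?v0.
  by apply: le_acos => //; apply: comparison_cos_mono; rewrite ?u0 ?v0.
by rewrite subr_ge0; apply: ge_inf => //; case: hA.
Unshelve. all: by end_near. Qed.

Lemma angle_itv g h : 0 <= angle g h <= pi.
Proof.
have [-> hA] := angle_inf g h; have lg := geod_length_gt0 g; have lh := geod_length_gt0 h.
apply/andP; split.
  apply: lb_le_inf; first by case: hA.
  by move=> _ [s [t [sI tI ->]]]; rewrite acos_ge0// comparison_cos_itv.
apply: (@le_trans _ _ (acos (comparison_cos g h (geod_length g) (geod_length h)))).
  apply: ge_inf; first by case: hA.
  by exists (geod_length g), (geod_length h); rewrite lg lh !lexx.
by rewrite acos_lepi// comparison_cos_itv ?lg ?lh ?lexx.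
Qed.

Lemma angle_ge0 g h : 0 <= angle g h. Proof. by case/andP: (angle_itv g h). Qed.

Lemma angle_comparison g h s t : 0 <= s <= geod_length g ->
  0 <= t <= geod_length h ->
  s ^+ 2 + t ^+ 2 - 2 * s * t * cos (angle g h) <= mdist (g s) (h t) ^+ 2.
Proof.
move=> /andP[]; rewrite le_eqVlt => /predU1P[<- _ tI|s0 sl].
  by rewrite geod_start geodesic_from_dist//; lra.
move=> /andP[]; rewrite le_eqVlt => /predU1P[<- _|t0 tl].
  by rewrite geod_start metric_sym geodesic_from_dist ?(ltW s0)//; lra.
have cI : -1 <= comparison_cos g h s t <= 1 by rewrite comparison_cos_itv ?s0 ?t0.
rewrite mdist_comparison_cos// lerB// ler_pM2l ?mulr_gt0//.
rewrite -[leLHS]acosK ?in_itv// le_cos ?angle_itv ?acos_ge0 ?acos_lepi//.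
have [-> [_ hA]] := angle_inf g h; apply: ge_inf => //.
by exists s, t; rewrite s0 t0.
Qed.

(** One pair of sides with an almost minimal comparison angle controls all smaller pairs by
    monotonicity. The bound is uniform in [s] and [t], even very unequal ones, as the first
    variation formula requires. *)
Lemma angle_limit g h (e : R) : 0 < e -> exists2 d, 0 < d &
  [/\ d <= geod_length g, d <= geod_length h & forall s t, 0 <= s <= d -> 0 <= t <= d ->
  mdist (g s) (h t) ^+ 2 <= s ^+ 2 + t ^+ 2 - 2 * s * t * (cos (angle g h) - e)].
Proof.
move=> e0; have := @continuous_cos R (angle g h) => /cvgrPdist_lt/(_ _ e0).
move=> /nbhs_ballP[r /= r0 rP].
have [aE hA] := angle_inf g h.
have [a [s [t [/andP[s0 sl] /andP[t0 tl] ->]]]] := inf_adherent r0 hA.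
rewrite -aE => ae; exists (Num.min s t); first by rewrite lt_min s0.
split; [by rewrite ge_min sl|by rewrite ge_min tl orbT|move=> u v].
rewrite !le_min => /andP[u0 /andP[us _]] /andP[v0 /andP[_ vt]].
move: u0; rewrite le_eqVlt => /predU1P[<-|u0].
  by rewrite geod_start geodesic_from_dist ?v0 ?(le_trans vt)//; lra.
move: v0; rewrite le_eqVlt => /predU1P[<-|v0].
  by rewrite geod_start metric_sym geodesic_from_dist ?(ltW u0) ?(le_trans us)//; lra.
have cI : -1 <= comparison_cos g h u v <= 1.
  by rewrite comparison_cos_itv ?u0 ?v0 ?(le_trans us) ?(le_trans vt).
rewrite mdist_comparison_cos// lerB// ler_pM2l ?mulr_gt0//.
have ac : angle g h <= acos (comparison_cos g h u v).
  rewrite aE; apply: ge_inf; first by case: hA.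
  by exists u, v; rewrite u0 v0 (le_trans us)// (le_trans vt).
have /rP : ball (angle g h) r (acos (comparison_cos g h u v)).
  rewrite /ball/= distrC ger0_norm ?subr_ge0// ltrBlDl (le_lt_trans _ ae)//.
  apply: le_acos; last by case/andP: cI.
    by have /andP[] : -1 <= comparison_cos g h s t <= 1 by rewrite comparison_cos_itv ?s0 ?t0.
  by apply: comparison_cos_mono; rewrite ?u0 ?v0.
by rewrite /= acosK ?in_itv// => /ltr_normlW; lra.
Qed.

Lemma angle_sym g h : angle g h = angle h g.
Proof.
rewrite (angle_inf g h).1 (angle_inf h g).1; congr inf; apply/seteqP; split.
  move=> _ [s [t [sI tI ->]]]; exists t, s; split => //.
  by rewrite /comparison_cos (metric_sym (h t)); congr (acos (_ / _)); ring.
move=> _ [s [t [sI tI ->]]]; exists t, s; split => //.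
by rewrite /comparison_cos (metric_sym (g t)); congr (acos (_ / _)); ring.
Qed.

End alexandrov_angle.

Lemma sin_mean_value (R : realType) (x : R) : 0 <= x ->
  exists2 c, 0 <= c <= x & sin x = cos c * x.
Proof.
move=> x0; have [c cI] := @MVT_segment R sin cos 0 x x0 (fun y _ => is_derive_sin y)
  (continuous_subspaceT (@continuous_sin R)).
by rewrite sin0 !subr0 => ->; exists c => //; move: cI; rewrite in_itv.
Qed.

(** * Chords and the triangle inequality for angles *)

Section chords.
Context {R : realType} {X : metricType R} (hX : CAT0_space X) {x : X}.
Implicit Types (g h k : geodesic_from x) (s t : R).

(** The side opposite the angle in a Euclidean triangle with two unit legs. It inherits a triangle
    inequality directly from points at equal distance from [x], and it is comparable with the angle
    when small. *)
Definition chord g h : R := 2 * sin (angle g h / 2).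

Lemma half_angle_itv g h : 0 <= angle g h / 2 <= pi / 2.
Proof.
have /andP[a0 a1] := angle_itv hX g h.
by rewrite divr_ge0//= ler_pM2r// invr_gt0.
Qed.

Lemma chord_ge0 g h : 0 <= chord g h.
Proof.
have /andP[a0 a1] := half_angle_itv g h.
rewrite mulr_ge0// sin_ge0_pi// a0 (le_trans a1)//.
by rewrite ler_pdivrMr// ler_pMr ?pi_gt0// ler1n.
Qed.

Lemma chord_sqr g h : chord g h ^+ 2 = 2 - 2 * cos (angle g h).
Proof.
have E : angle g h = (angle g h / 2) *+ 2 by rewrite -mulr_natr divfK.
by rewrite [in RHS]E cos_mulr2n cos2sin2 /chord mulr2n; ring.
Qed.

Lemma chord_le_mdist g h s : 0 <= s <= geod_length g -> s <= geod_length h ->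
  s * chord g h <= mdist (g s) (h s).
Proof.
move=> /andP[s0 sg] sh; have := angle_comparison hX (g := g) (h := h) (s := s) (t := s).
rewrite s0 sg sh => /(_ isT isT) le2.
rewrite -(@ler_pXn2r _ 2)// ?nnegrE ?mdist_ge0 ?(mulr_ge0 s0 (chord_ge0 _ _))//.
by rewrite exprMn chord_sqr; lra.
Qed.

Lemma chord_limit g h (e : R) : 0 < e -> exists2 d, 0 < d &
  [/\ d <= geod_length g, d <= geod_length h & forall s, 0 <= s <= d ->
  mdist (g s) (h s) <= s * (chord g h + e)].
Proof.
move=> e0; have e1 : 0 < e ^+ 2 / 2 by rewrite divr_gt0// exprn_gt0.
have [d d0 [dg dh dP]] := angle_limit hX g h e1; exists d => //; split=> // s sI.
have := dP _ _ sI sI; case/andP: sI => s0 _ le2; have c0 := chord_ge0 g h.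
rewrite -(@ler_pXn2r _ 2)// ?nnegrE ?mdist_ge0 ?mulr_ge0 ?addr_ge0 ?(ltW e0)//.
apply: (le_trans le2); rewrite exprMn sqrrD chord_sqr.
have : 0 <= s ^+ 2 * (chord g h * e) by rewrite mulr_ge0 ?sqr_ge0// mulr_ge0 ?(ltW e0).
lra.
Qed.

Lemma chord_triangle g h k : chord g k <= chord g h + chord h k.
Proof.
apply/ler_addgt0Pr => e e0; have e2 : 0 < e / 2 by rewrite divr_gt0.
have [d d0 [dg dh dP]] := chord_limit g h e2.
have [d' d'0 [dh' dk' dP']] := chord_limit h k e2.
pose s := Num.min d d'; have s0 : 0 < s by rewrite lt_min d0.
have sd : s <= d by rewrite ge_min lexx.
have sd' : s <= d' by rewrite ge_min lexx orbT.
have := @chord_le_mdist g k s; rewrite (ltW s0) (le_trans sd)// (le_trans sd')//.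
move=> /(_ isT isT); have := dP s; rewrite (ltW s0) sd => /(_ isT).
have := dP' s; rewrite (ltW s0) sd' => /(_ isT) h1 h2 h3.
have := metric_triangle (g s) (h s) (k s) => h4.
rewrite -(ler_pM2l s0); lra.
Qed.

Lemma chord_le_angle g h : chord g h <= angle g h.
Proof.
have /andP[a0 a1] := half_angle_itv g h.
have [c _ E] := sin_mean_value a0; rewrite /chord E.
have : cos c * (angle g h / 2) <= 1 * (angle g h / 2) by rewrite ler_wpM2r// cos_le1.
lra.
Qed.

(** A chord of length at most 1 means an angle with cosine at least [1/2], so the derivative of the
    sine is at least [1/2] up to the half angle. *)
Lemma angle_le_chord g h : chord g h <= 1 -> angle g h <= 2 * chord g h.
Proof.
move=> c1; have /andP[a0 a1] := half_angle_itv g h.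
have /andP[b0 b1] := angle_itv hX g h.
have [c /andP[c0 ca] E] := sin_mean_value a0.
have cos2 : 1 / 2 <= cos (angle g h).
  have : chord g h ^+ 2 <= 1 by rewrite expr_le1// chord_ge0.
  by rewrite chord_sqr; lra.
have cosc : 1 / 2 <= cos c.
  apply: (le_trans cos2); rewrite le_cos// ?c0 ?b0 ?b1//; lra.
have : (1 / 2) * (angle g h / 2) <= cos c * (angle g h / 2) by rewrite ler_wpM2r.
by rewrite /chord E; lra.
Qed.

Lemma mdist_le_of_sqr (y z : X) (l a n : R) : 0 <= l -> 0 <= a -> 0 <= n ->
  mdist y z ^+ 2 <= l ^+ 2 * (a ^+ 2 + n ^+ 2) -> mdist y z <= l * (a + n).
Proof.
move=> l0 a0 n0 le2.
rewrite -(@ler_pXn2r _ 2)// ?nnegrE ?mdist_ge0 ?mulr_ge0 ?addr_ge0//.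
apply: (le_trans le2); rewrite exprMn ler_wpM2l ?sqr_ge0// sqrrD.
have : 0 <= a * n by rewrite mulr_ge0.
lra.
Qed.

(* In the comparison plane the segment joining the unit vectors at angles 0 and
   [2 A] crosses the ray at angle [A + B] at distance [cos A / cos B]. *)
Lemma angle_triangle g h k : angle g k <= angle g h + angle h k.
Proof.
have /andP[b0 b1] := angle_itv hX g h; have /andP[c0 c1] := angle_itv hX h k.
have /andP[a0 a1] := angle_itv hX g k.
have [|lt_pi] := leP pi (angle g h + angle h k); first exact: le_trans.
pose A := (angle g h + angle h k) / 2; pose B := (angle g h - angle h k) / 2.
have cA0 : 0 < cos A by apply: cos_gt0_pihalf; rewrite /A; apply/andP; split; lra.
have cB0 : 0 < cos B by apply: cos_gt0_pihalf; rewrite /B; apply/andP; split; lra.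
have ghE : angle g h = A + B by rewrite /A /B; lra.
have hkE : angle h k = A - B by rewrite /A /B; lra.
suff : sin (angle g k / 2) <= sin A.
  rewrite !leNgt; apply: contra => lt_a; rewrite ltr_sin// ?in_itv/=; first by rewrite /A; lra.
    by rewrite /A; apply/andP; split; lra.
  by apply/andP; split; lra.
rewrite -(ler_pM2r cB0); apply/ler_addgt0Pr => n n0.
have n2 : 0 < n ^+ 2 / 2 by rewrite divr_gt0// exprn_gt0.
have [d d0 [dg dh dP]] := angle_limit hX g h n2.
have [d' d'0 [dh' dk' dP']] := angle_limit hX h k n2.
pose l := Num.min d d'; have l0 : 0 < l by rewrite lt_min d0.
have ld : l <= d by rewrite ge_min lexx.
have ld' : l <= d' by rewrite ge_min lexx orbT.
have lE (u : R) : 0 < u -> u <= 1 -> 0 <= l * u <= l.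
  by move=> u0 u1; rewrite mulr_ge0 ?(ltW l0) ?(ltW u0)//= ler_piMr// ltW.
have /andP[r0 rl] := lE _ cA0 (cos_le1 _).
have /andP[s0 sl] := lE _ cB0 (cos_le1 _).
have cAB : cos A * cos B <= 1.
  by rewrite -[leRHS]mulr1 ler_pM ?cos_le1 ?(ltW cA0) ?(ltW cB0).
have := dP (l * cos B) (l * cos A).
rewrite r0 s0 (le_trans rl)// (le_trans sl)// => /(_ isT isT) gh2.
have := dP' (l * cos A) (l * cos B).
rewrite r0 s0 (le_trans rl)// (le_trans sl)// => /(_ isT isT) hk2.
have := @chord_le_mdist g k (l * cos B).
rewrite s0 (le_trans sl (le_trans ld _))// (le_trans sl (le_trans ld' _))//.
move=> /(_ isT isT) gk.
have tri := metric_triangle (g (l * cos B)) (h (l * cos A)) (k (l * cos B)).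
have err : l ^+ 2 * (cos A * cos B) * n ^+ 2 <= l ^+ 2 * n ^+ 2.
  by rewrite ler_wpM2r ?sqr_ge0// ler_piMr ?sqr_ge0.
have sA := sin2cos2 A; have sB := sin2cos2 B.
(* At scale [l * cos B] the two planar sides are [l * sin (A + B)] and [l * sin (A - B)], with sum
   [2 * l * sin A * cos B]; [n] is the error from [angle_limit]. *)
have gh1 : mdist (g (l * cos B)) (h (l * cos A)) <= l * (sin (angle g h) + n).
  apply: mdist_le_of_sqr; rewrite ?(ltW l0) ?(ltW n0) ?sin_ge0_pi ?b0//.
  apply: (le_trans gh2); rewrite ghE cosD sinD sqrrD !exprMn sA sB.
  have -> : sin A * cos B * (cos A * sin B) = sin A * sin B * (cos A * cos B) by ring.
  lra.
have hk1 : mdist (h (l * cos A)) (k (l * cos B)) <= l * (sin (angle h k) + n).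
  apply: mdist_le_of_sqr; rewrite ?(ltW l0) ?(ltW n0) ?sin_ge0_pi ?c0//.
  apply: (le_trans hk2); rewrite hkE cosB sinB sqrrB !exprMn sA sB.
  have -> : sin A * cos B * (cos A * sin B) = sin A * sin B * (cos A * cos B) by ring.
  lra.
rewrite -(ler_pM2l l0); move: gh1 hk1 gk; rewrite /chord ghE hkE sinD sinB; lra.
Qed.

End chords.

(** * Lengths of inscribed polygons *)

Section polygonal_length.
Context {R : realType} {A : Type}.
Implicit Types (D : A -> A -> R) (c : R -> A) (a b m : R) (s : seq R).

(** The sum in [curve_length] in recursive form, for induction on the subdivision with a varying
    starting point. *)
Fixpoint polygon_length D c a s : R :=
  if s is y :: s' then D (c a) (c y) + polygon_length D c y s' else 0.

Lemma curve_lengthE D c a b : curve_length D c a b =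
  ereal_sup [set (polygon_length D c a s)%:E | s in itv_partition a b].
Proof.
have E s : \sum_(0 <= i < size s)
    D ((c \o nth b (a :: s)) i) ((c \o nth b (a :: s)) i.+1) = polygon_length D c a s.
  elim: s a => [|y s IH] a /=; first by rewrite big_nil.
  rewrite big_nat_recl//=; congr (_ + _); rewrite -IH.
  exact: eq_bigr.
by congr ereal_sup; apply/seteqP; split => _ [s ps <-]; exists s => //=; rewrite -E.
Qed.

Lemma le_curve_length D c a b s : itv_partition a b s ->
  ((polygon_length D c a s)%:E <= curve_length D c a b)%E.
Proof. by move=> ps; rewrite curve_lengthE; apply: ereal_sup_ubound; exists s. Qed.

Lemma path_lt_bound a s : path <%O a s -> forall y, y \in a :: s -> a <= y <= last a s.
Proof.
elim: s a => [|z s IH] a /=; first by move=> _ y; rewrite inE => /eqP ->; rewrite !lexx.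
move=> /andP[az ps] y; rewrite inE => /predU1P[->|ys].
  by rewrite lexx (le_trans (ltW az))//; case/andP: (IH _ ps z (mem_head _ _)).
by have /andP[zy ->] := IH _ ps _ ys; rewrite (le_trans (ltW az)).
Qed.

Lemma curve_length_lipschitz D c a b (L : R) :
  (forall u v, a <= u <= b -> a <= v <= b -> u <= v -> D (c u) (c v) <= L * (v - u)) ->
  (curve_length D c a b <= (L * (b - a))%:E)%E.
Proof.
move=> cL; rewrite curve_lengthE; apply: ge_ereal_sup => _ [s [ps /eqP sb] <-].
have {}cL : forall u v, a <= u -> v <= last a s -> u <= v -> D (c u) (c v) <= L * (v - u).
  by move=> u v au; rewrite sb => vb uv; rewrite cL ?au ?vb// ?(le_trans au) ?(le_trans uv).
rewrite lee_fin -sb {sb b}.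
elim: s a ps cL => [|y s IH] a /=; first by rewrite subrr mulr0.
move=> /andP[ay ps] cL; have := IH _ ps; have := cL a y (lexx _) _ (ltW ay).
have /andP[_ yl] := path_lt_bound ps (mem_head _ _) => /(_ yl) h1.
have h2 : forall u v, y <= u -> v <= last y s -> u <= v -> D (c u) (c v) <= L * (v - u).
  by move=> u v yu; apply: cL; rewrite (le_trans (ltW ay)).
by move=> /(_ h2); lra.
Qed.

(** Inserting [m] into the subdivision cannot shorten the polygon; the two parts then subdivide the
    two halves of a concatenated curve. *)
Lemma polygon_length_split D c a m s :
  (forall x y z, D x z <= D x y + D y z) -> a <= m -> m <= last a s -> path <%O a s ->
  exists s1 s2, [/\ path <%O a s1, last a s1 = m, path <%O m s2, last m s2 = last a s
    & polygon_length D c a s <= polygon_length D c a s1 + polygon_length D c m s2].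
Proof.
move=> Dtri; elim: s a => [|y s IH] a /= am.
  move=> ma _; have -> : a = m by apply/eqP; rewrite eq_le am.
  by exists [::], [::]; rewrite addr0.
move=> ml /andP[ay ps]; have [my|ym] := ltP m y.
  move: am; rewrite le_eqVlt => /predU1P[->|am].
    by exists [::], (y :: s); rewrite /= my ps add0r.
  exists [:: m], (y :: s); rewrite /= am my ps; split => //.
  by have := Dtri (c a) (c m) (c y); rewrite addr0; lra.
have [s1 [s2 [p1 l1 p2 l2 le12]]] := IH _ ym ml ps.
by exists (y :: s1), s2; split; rewrite //= ?ay//; lra.
Qed.

Lemma polygon_length_comp D c (f : R -> R) a s :
  polygon_length D (c \o f) a s = polygon_length D c (f a) (map f s).
Proof. by elim: s a => //= y s IH a; rewrite IH. Qed.

Lemma eq_polygon_length D c c' a s : path <%O a s ->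
  (forall u, a <= u <= last a s -> c u = c' u) ->
  polygon_length D c a s = polygon_length D c' a s.
Proof.
elim: s a => //= y s IH a /andP[ay ps] cc.
have /andP[_ yl] := path_lt_bound ps (mem_head _ _).
rewrite !cc ?lexx ?(ltW ay) ?yl ?(le_trans (ltW ay))// IH// => u /andP[yu ul].
by rewrite cc// (le_trans (ltW ay)).
Qed.

Lemma itv_partition_affine (p q a b : R) s : 0 < p -> path <%O a s -> last a s = b ->
  itv_partition (p * a + q) (p * b + q) (map (fun u => p * u + q) s).
Proof.
move=> p0 ps <-; split; last by rewrite (last_map (fun u => p * u + q)).
rewrite -[p * a + q]/((fun u => p * u + q) a) path_map.
by apply: sub_path ps => u v /= uv; rewrite ltrD2r ltr_pM2l.
Qed.

End polygonal_length.

(** * The intrinsic metric on directions compared with the angle *)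

Section intrinsic_metric.
Context {R : realType} {X : metricType R} (hX : CAT0_space X) {x : X}.
Implicit Types (g h k : geodesic_from x) (s t : R).

Lemma angle_le_intrinsic g h : ((angle g h)%:E <= intrinsic_angle g h)%E.
Proof.
apply: le_ereal_inf_tmp => _ [c [_ c0 c1] <-].
have := @le_curve_length _ _ (@angle _ _ x) c 0 1 [:: 1].
by rewrite /= c0 c1 addr0; apply; split; rewrite //= ltr01.
Qed.

(** Concatenation of almost shortest curves. The strict real bounds provide such curves and avoid
    sums of infinite values. *)
Lemma intrinsic_angle_triangle g h k (a b : R) :
  (intrinsic_angle g h < a%:E)%E -> (intrinsic_angle h k < b%:E)%E ->
  (intrinsic_angle g k < (a + b)%:E)%E.
Proof.
move=> /ereal_inf_lt[_ [c1 [c1C c10 c11] <-] c1a].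
move=> /ereal_inf_lt[_ [c2 [c2C c20 c21] <-] c2b].
(* Both curves run at double speed; the two formulas agree at [2^-1] because [c1] ends where [c2]
   begins. *)
pose c u := if u <= 2^-1 then c1 (2 * u) else c2 (2 * u - 1).
have cL u : u <= 2^-1 -> c u = c1 (2 * u) by rewrite /c => ->.
have cR u : 2^-1 <= u -> c u = c2 (2 * u - 1).
  rewrite /c le_eqVlt => /predU1P[<-|lt]; last by rewrite leNgt lt.
  by rewrite lexx divff// subrr c11 c20.
have cC : angle_continuous c.
  move=> s e /andP[s0 s1] e0.
  have near2 (d : R) (P : R -> Prop) (q : R) :
      (\forall u \near (2 * s - q), P u) -> \forall u \near s, P (2 * u - q).
    move=> /nbhs_ballP[r /= r0 rP]; apply/nbhs_ballP; exists (r / 2) => /=.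
      by rewrite divr_gt0.
    move=> u; rewrite /ball/= => su; apply: rP; rewrite /ball/=.
    have -> : 2 * s - q - (2 * u - q) = 2 * (s - u) by ring.
    by rewrite normrM gtr0_norm// mulrC -ltr_pdivlMr.
  have nL : s <= 2^-1 -> \forall u \near s, 0 <= u -> u <= 2^-1 -> angle (c s) (c u) < e.
    move=> s2; have /(_ e) := c1C (2 * s - 0); rewrite subr0 mulr_ge0//=.
    have -> : 2 * s <= 1 by lra.
    move=> /(_ isT e0); rewrite -{1}[2 * s]subr0 => /(near2 1); apply: filterS => u ue u0 u2.
    rewrite (cL _ s2) (cL _ u2) -[2 * u]subr0; apply: ue; apply/andP; split; lra.
  have nR : 2^-1 <= s -> \forall u \near s, u <= 1 -> 2^-1 <= u -> angle (c s) (c u) < e.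
    move=> s2; have /(_ e) := c2C (2 * s - 1).
    have -> : 0 <= 2 * s - 1 <= 1 by apply/andP; split; lra.
    move=> /(_ isT e0) /(near2 1); apply: filterS => u ue u1 u2.
    rewrite (cR _ s2) (cR _ u2); apply: ue; apply/andP; split; lra.
  have [s2|s2|s2] := ltgtP s 2^-1.
  - by apply: filterS2 (nL (ltW s2)) (lt_le_nbhsl s2) => u H u2 /andP[u0 _]; exact: H.
  - by apply: filterS2 (nR (ltW s2)) (lt_le_nbhsr s2) => u H u2 /andP[_ u1]; exact: H.
  - have eqs : 2^-1 <= s <= 2^-1 by rewrite s2 lexx.
    case/andP: eqs => /nR {}nR /nL {}nL.
    apply: filterS2 nL nR => u HL HR /andP[u0 u1].
    by have [u2|/ltW u2] := leP u 2^-1; [exact: HL|exact: HR].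
have E : (intrinsic_angle g k <= curve_length (@angle _ _ x) c 0 1)%E.
  apply: ereal_inf_lbound; exists c => //; split => //.
    by rewrite cL ?mulr0// invr_ge0.
  by rewrite cR; [rewrite mulr1 -natr1 addrK|rewrite invf_le1// ler1n].
apply: (le_lt_trans E); rewrite EFinD; apply: le_lt_trans (lteD c1a c2b).
rewrite {1}curve_lengthE; apply: ge_ereal_sup => _ [s [ps /eqP s1] <-].
have h0 : 0 <= (2^-1 : R) by rewrite invr_ge0.
have h1 : (2^-1 : R) <= last 0 s by rewrite s1 invf_le1// ler1n.
have [sl [sr [psl ll psr lr le12]]] :=
  polygon_length_split c (@angle_triangle _ _ hX x) h0 h1 ps.
have two : (0 : R) < 2 by [].
have pl := itv_partition_affine 0 two psl ll.
have pr := itv_partition_affine (-1) two psr lr.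
have e21 : 2 - 1 = 1 :> R by ring.
rewrite mulr0 !addr0 divff// in pl; rewrite s1 divff// subrr mulr1 e21 in pr.
apply: (@le_trans _ _ (polygon_length (@angle _ _ x) c 0 sl +
  polygon_length (@angle _ _ x) c 2^-1 sr)%:E); first by rewrite lee_fin.
rewrite EFinD; apply: leeD.
  rewrite (@eq_polygon_length _ _ _ _ (c1 \o (fun u => 2 * u + 0)))//.
    by rewrite polygon_length_comp mulr0 addr0; exact: le_curve_length.
  by move=> u /andP[_]; rewrite ll => u2; rewrite /= addr0 cL.
rewrite (@eq_polygon_length _ _ _ _ (c2 \o (fun u => 2 * u + -1)))//.
  by rewrite polygon_length_comp divff// subrr; apply: le_curve_length.
by move=> u /andP[u2 _]; rewrite /= cR.
Qed.

(** Sliding the farther point down its ray to the smaller distance from [x] costs [|r - r'|], which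
    is at most the distance of the two points; hence the factor 2. *)
Lemma chord_between g h (r r' : R) : 0 <= r <= geod_length g -> 0 <= r' <= geod_length h ->
  Num.min r r' * chord g h <= 2 * mdist (g r) (h r').
Proof.
move=> /andP[r0 rg] /andP[r'0 r'h].
have dr := @geodesic_from_dist _ _ x g r; rewrite r0 rg in dr.
have dr' := @geodesic_from_dist _ _ x h r'; rewrite r'0 r'h in dr'.
have t1 := metric_triangle x (g r) (h r'); have t2 := metric_triangle x (h r') (g r).
move: t1 t2; rewrite dr// dr'// (metric_sym (h r')) => t1 t2.
have [rr'|/ltW r'r] := leP r r'.
  have := @chord_le_mdist _ _ hX x g h r (introT andP (conj r0 rg)) (le_trans rr' r'h).
  have := metric_triangle (g r) (h r') (h r).
  rewrite (@geod_isometry _ _ _ h) ?r'0 ?r0 ?(le_trans rr' r'h)// ger0_norm ?subr_ge0//; lra.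
have := @chord_le_mdist _ _ hX x g h r' (introT andP (conj r'0 (le_trans r'r rg))) r'h.
have := metric_triangle (g r') (g r) (h r').
by rewrite (@geod_isometry _ _ _ g) ?r'0 ?r0 ?(le_trans r'r rg)// ler0_norm ?subr_le0//; lra.
Qed.

Lemma geodesic_from_exists y : x != y ->
  exists g : geodesic_from x, geod_length g = mdist x y /\ geod_end g = y.
Proof.
rewrite -mdist_gt0 => xy; case: hX => _ /(_ x y)[g [g0 g1 giso]] _.
by exists (GeodesicFrom xy g0 giso).
Qed.

(** The geodesic of [X] from [g s] to [h s] is short compared with a small [s], so it keeps away
    from [x], and the geodesics from [x] to its points form a short curve of directions. By
    [chord_between] their chords are at most [4 * e * |u - v|], and angles are at most twice
    that. *)
Lemma intrinsic_angle_le g h (e : R) : chord g h < e -> e <= 4^-1 ->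
  (intrinsic_angle g h <= (8 * e)%:E)%E.
Proof.
move=> ghe e4; have c0 := chord_ge0 hX g h.
have [s s0 [sg sh sP]] := chord_limit hX g h (e := e - chord g h) ltac:(by rewrite subr_gt0).
have {sP} : mdist (g s) (h s) <= s * e.
  by rewrite (le_trans (sP s _)) ?lexx ?(ltW s0)// addrC subrK.
case: (hX) => _ /(_ (g s) (h s))[w wP] _; set D := mdist _ _ => De.
have D0 : 0 <= D := mdist_ge0 _ _.
have D4 : D <= s / 4.
  by apply: (le_trans De); rewrite ler_pM2l.
have wI u : 0 <= u <= 1 -> 0 <= u * D <= D.
  by move=> /andP[u0 u1]; rewrite mulr_ge0//= ler_piMl.
have w0 : w 0 = g s by case: wP.
have w1 : w D = h s by case: wP.
have wiso u v : 0 <= u <= 1 -> 0 <= v <= 1 -> mdist (w (u * D)) (w (v * D)) = `|u - v| * D.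
  case: wP => _ _ iso u01 v01; rewrite iso ?wI// -mulrBl normrM (ger0_norm D0)//.
have gs : mdist x (g s) = s by rewrite geodesic_from_dist ?(ltW s0).
have near_s u : 0 <= u <= 1 -> s / 2 <= mdist x (w (u * D)).
  move=> u01; have := metric_triangle x (w (u * D)) (g s).
  have w0' : w (0 * D) = g s by rewrite mul0r.
  rewrite gs -w0' wiso// ?lexx ?ler01// subr0.
  case/andP: u01 => u0 u1; rewrite ger0_norm//.
  have : u * D <= D by rewrite ler_piMl.
  lra.
(* The curve has to start at [g] and end at [h] themselves, not at shorter pieces of them; so some
   point [k r] with [s / 2 <= r] must equal [w (u * D)], but it need not be the end of [k]. *)
have cP u : {k : geodesic_from x | [/\ u <= 0 -> k = g, 1 <= u -> k = h &
    0 <= u <= 1 -> exists2 r, s / 2 <= r <= geod_length k & k r = w (u * D)]}.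
  apply: cid; have [u0|u0] := leP u 0.
    exists g; split => //; first by move=> u1; exfalso; lra.
    move=> /andP[u0' _]; exists s; first by apply/andP; split => //; lra.
    by have -> : u = 0 by [apply/eqP; rewrite eq_le u0]; rewrite mul0r w0.
  have [u1|u1] := leP 1 u.
    exists h; split => //.
    move=> /andP[_ u1']; exists s; first by apply/andP; split => //; lra.
    by have -> : u = 1 by [apply/eqP; rewrite eq_le u1 u1']; rewrite mul1r w1.
  have u01 : 0 <= u <= 1 by rewrite !ltW.
  have xw : x != w (u * D).
    by rewrite -mdist_gt0 (lt_le_trans _ (near_s _ u01))// divr_gt0.
  have [k [kl ke]] := geodesic_from_exists xw.
  exists k; split => // _.
  by exists (geod_length k) => //; rewrite lexx kl near_s.
pose c u := sval (cP u).
have cE u : 0 <= u <= 1 -> exists2 r, s / 2 <= r <= geod_length (c u) & c u r = w (u * D).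
  by rewrite /c; case: (cP u) => k [].
have cL u v : 0 <= u <= 1 -> 0 <= v <= 1 -> angle (c u) (c v) <= 8 * e * `|u - v|.
  move=> u01 v01; have [r /andP[r1 r2] cr] := cE _ u01.
  have [r' /andP[r'1 r'2] cr'] := cE _ v01.
  have := @chord_between (c u) (c v) r r'; rewrite r2 r'2 !andbT cr cr' wiso//.
  have s20 : 0 < s / 2 by rewrite divr_gt0.
  rewrite (le_trans _ r1) ?(ltW s20)// (le_trans _ r'1) ?(ltW s20)// => /(_ isT isT).
  have sr : s / 2 <= Num.min r r' by rewrite le_min r1.
  have k0 := chord_ge0 hX (c u) (c v) => H.
  have {}H : s * chord (c u) (c v) <= s * (4 * e * `|u - v|).
    have H1 : s / 2 * chord (c u) (c v) <= Num.min r r' * chord (c u) (c v).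
      by rewrite ler_wpM2r.
    have H2 : `|u - v| * D <= `|u - v| * (s * e) by rewrite ler_wpM2l.
    lra.
  rewrite ler_pM2l// in H.
  have uv1 : `|u - v| <= 1.
    by case/andP: u01 => ? ?; case/andP: v01 => ? ?; rewrite ler_norml; apply/andP; split; lra.
  have /(angle_le_chord hX) : chord (c u) (c v) <= 1.
    apply: (le_trans H); have : e * `|u - v| <= 4^-1 * 1.
      by rewrite ler_pM// (le_trans c0 (ltW ghe)).
    lra.
  lra.
have e0 : 0 < e by rewrite (le_lt_trans c0).
have cC : angle_continuous c.
  move=> u d u01 d0; apply/nbhs_ballP; exists (d / (8 * e)) => /=.
    by rewrite divr_gt0// mulr_gt0.
  move=> v; rewrite /ball/= ltr_pdivlMr ?mulr_gt0// => uv v01.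
  by rewrite (le_lt_trans (cL _ _ _ _))// mulrC.
apply: (@le_trans _ _ (curve_length (@angle _ _ x) c 0 1)).
  apply: ereal_inf_lbound; exists c => //; split => //; rewrite /c.
    by case: (cP 0) => k [] /= /(_ (lexx _)).
  by case: (cP 1) => k [] /= _ /(_ (lexx _)).
have := @curve_length_lipschitz _ _ (@angle _ _ x) c 0 1 (8 * e).
rewrite subr0 mulr1; apply => u v u01 v01 uv.
by have := cL u v u01 v01; rewrite ler0_norm ?subr_le0// opprB.
Qed.

End intrinsic_metric.

Lemma norm_cosB_le (R : realType) (a b c : R) : `|a - b| <= c -> c <= pi ->
  `|cos a - cos b| <= 2 * sin (c / 2).
Proof.
move=> abc cpi; have c0 : 0 <= c := le_trans (normr_ge0 _) abc.
have -> : cos a - cos b = - (2 * sin ((a + b) / 2) * sin ((a - b) / 2)).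
  have E1 : cos a = cos ((a + b) / 2 + (a - b) / 2) by congr cos; lra.
  have E2 : cos b = cos ((a + b) / 2 - (a - b) / 2) by congr cos; lra.
  by rewrite E1 E2 cosD cosB; lra.
rewrite normrN !normrM (gtr0_norm (x := 2))// -mulrA ler_pM2l//.
apply: (@le_trans _ _ (1 * `|sin ((a - b) / 2)|)); first by rewrite ler_wpM2r// sin_max.
rewrite mul1r; move: abc; rewrite !ler_norml => /andP[l1 l2].
have pih : (0 : R) < pi by exact: pi_gt0.
have sin_mono (u v : R) : u <= v -> - (pi / 2) <= u -> v <= pi / 2 -> sin u <= sin v.
  move=> uv u1 v1; rewrite !leNgt ltr_sin ?in_itv/= ?u1 ?v1 ?(le_trans uv)//.
    by rewrite -leNgt.
  by rewrite (le_trans u1).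
by apply/andP; split; rewrite -?sinN; apply: sin_mono; lra.
Qed.

(** * Tangent cone and gradients *)

Section cauchy_sequences_of_directions.
Context {R : realType} {X : metricType R} (hX : CAT0_space X) {x : X}.
Implicit Types (g h k : geodesic_from x) (xi eta zeta : directions x).
Let D := @intrinsic_angle R X x.

Lemma completion_rep_cauchy xi : cauchy_for D (completion_rep xi).
Proof. by rewrite /completion_rep; case: cid2. Qed.

(** The chosen representative of the class of a constant sequence need not be constant; only its
    intrinsic distance to [g] tends to 0. *)
Lemma completion_rep_direction g (e : R) : 0 < e ->
  \forall n \near \oo, angle g (completion_rep (direction g) n) < e.
Proof.
move=> e0; rewrite /completion_rep; case: cid2 => u uC /= uE.
have : cauchy_class D u u.
  split => //; have -> : (fun n => D (u n) (u n)) = (fun=> 0%E); last exact: cvg_cst.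
  apply/funext => n; apply/eqP; rewrite eq_le intrinsic_anglexx/=.
  by rewrite (le_trans _ (angle_le_intrinsic _ _))// lee_fin angle_ge0.
rewrite -uE => -[_ /fine_cvgP[fin /cvgrPdist_lt/(_ _ e0)]]; move: fin.
apply: filterS2 => n fin; rewrite sub0r normrN => /ltr_normlW lt.
rewrite -lte_fin (le_lt_trans (angle_le_intrinsic _ _))//.
by rewrite -(fineK fin) lte_fin.
Qed.

(** Far enough out, one finite value makes all the others finite by the triangle inequality, and
    they form a Cauchy sequence; otherwise the sequence is eventually infinite. So the limit in
    [completion_dist] always exists. *)
Lemma cvg_intrinsic_angle (u v : nat -> geodesic_from x) :
  cauchy_for D u -> cauchy_for D v -> cvg (D (u n) (v n) @[n --> \oo]).
Proof.
move=> uC vC.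
have step (e : R) : 0 < e -> exists N, forall m n, (N <= m)%N -> (N <= n)%N ->
    forall r : R, (D (u n) (v n) < r%:E)%E -> (D (u m) (v m) < (r + e)%:E)%E.
  move=> e0; have e2 : 0 < e / 2 by rewrite divr_gt0.
  have [N uN] := uC _ e2; have [M vM] := vC _ e2.
  exists (maxn N M) => m n; rewrite !geq_max => /andP[Nm Mm] /andP[Nn Mn] r lt.
  have := intrinsic_angle_triangle hX (uN _ _ Nm Nn) (intrinsic_angle_triangle hX lt (vM _ _ Mn Mm)).
  by congr (_ < _%:E)%E; lra.
have ge0 n : (0 <= D (u n) (v n))%E.
  by rewrite (le_trans _ (angle_le_intrinsic _ _))// lee_fin angle_ge0.
have [N1 stepN1] := step _ ltr01.
have [fin|inf] := pselect (exists2 n, (N1 <= n)%N & (D (u n) (v n) < +oo)%E); last first.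
  apply/cvg_ex; exists +oo%E; apply: cvg_near_cst; exists N1 => // n /= Nn.
  apply/eqP; rewrite -leye_eq leNgt; apply/negP => lt; apply: inf; by exists n.
case: fin => n0 N1n0 n0y.
have fin n : (N1 <= n)%N -> D (u n) (v n) \is a fin_num.
  move=> Nn; rewrite ge0_fin_numE// (lt_trans _ (ltry (fine (D (u n0) (v n0)) + 1 + 1)))//.
  apply: (stepN1 _ n0) => //; rewrite -[ltLHS]fineK ?ge0_fin_numE// lte_fin; lra.
apply/cvg_ex; have : cvg (fine (D (u n) (v n)) @[n --> \oo]).
  apply: cauchy_cvg; apply: cauchy_exP => e e0.
  have e2 : 0 < e / 2 by rewrite divr_gt0.
  have [N stepN] := step _ e2; pose M := maxn N N1.
  have NM : (N <= M)%N by rewrite leq_maxl.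
  have N1M : (N1 <= M)%N by rewrite leq_maxr.
  exists (fine (D (u M) (v M))); exists M => // n /= Mn.
  have Nn := leq_trans NM Mn; have N1n := leq_trans N1M Mn.
  have key m m' : (M <= m)%N -> (M <= m')%N ->
      fine (D (u m) (v m)) < fine (D (u m') (v m')) + e.
    move=> Mm Mm'; rewrite -lte_fin fineK ?fin ?(leq_trans N1M)//.
    have -> : e = e / 4 + e / 2 + e / 4 by lra.
    apply: (@lt_trans _ _ (fine (D (u m') (v m')) + e / 4 + e / 2)%:E); last first.
      by rewrite lte_fin; lra.
    apply: (stepN m m'); rewrite ?(leq_trans NM)//.
    rewrite -[ltLHS]fineK ?fin ?(leq_trans N1M)// lte_fin; lra.
  rewrite /ball/= ltr_norml; have := key n M Mn (leqnn _); have := key M n (leqnn _) Mn.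
  by move=> h1 h2; apply/andP; split; lra.
move=> /cvg_ex[l fl]; exists l%:E; apply/fine_cvgP; split => //.
by exists N1 => // n /= /fin.
Qed.

Lemma cauchy_angle xi (e : R) : 0 < e -> exists N, forall m n, (N <= m)%N -> (N <= n)%N ->
  angle (completion_rep xi m) (completion_rep xi n) < e.
Proof.
move=> /(@completion_rep_cauchy xi)[N NP]; exists N => m n Nm Nn.
by rewrite -lte_fin (le_lt_trans (angle_le_intrinsic _ _))// NP.
Qed.

Lemma cvg_dir_angle xi eta :
  angle (completion_rep xi n) (completion_rep eta n) @[n --> \oo] --> dir_angle xi eta.
Proof.
apply: cauchy_cvg; apply: cauchy_exP => e e0.
have e2 : 0 < e / 2 by rewrite divr_gt0.
have [N NP] := cauchy_angle xi e2; have [M MP] := cauchy_angle eta e2.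
pose u := completion_rep xi; pose v := completion_rep eta; pose K := maxn N M.
exists (angle (u K) (v K)); exists K => // n /= Kn.
have NK : (N <= K)%N by rewrite leq_maxl.
have MK : (M <= K)%N by rewrite leq_maxr.
have Nn := leq_trans NK Kn; have Mn := leq_trans MK Kn.
have h1 := angle_triangle hX (u K) (u n) (v K).
have h2 := angle_triangle hX (u n) (v n) (v K).
have h3 := angle_triangle hX (u n) (u K) (v n).
have h4 := angle_triangle hX (u K) (v K) (v n).
have := NP _ _ NK Nn; have := NP _ _ Nn NK; have := MP _ _ MK Mn; have := MP _ _ Mn MK.
by rewrite /ball/= ltr_norml -/u -/v => *; apply/andP; split; lra.
Qed.

Lemma dir_angle_itv xi eta : 0 <= dir_angle xi eta <= pi.
Proof.
apply/andP; split.
  apply: (cvgr_to_ge (@cvg_dir_angle xi eta)); apply: nearW => n; exact: angle_ge0.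
apply: (cvgr_to_le (@cvg_dir_angle xi eta)); apply: nearW => n.
by case/andP: (angle_itv hX (completion_rep xi n) (completion_rep eta n)).
Qed.

Lemma dir_angle_sym xi eta : dir_angle xi eta = dir_angle eta xi.
Proof.
rewrite /dir_angle; congr (lim _).
have -> // : (fun n => angle (completion_rep xi n) (completion_rep eta n)) =
  (fun n => angle (completion_rep eta n) (completion_rep xi n)).
by apply/funext => n; exact: angle_sym.
Qed.

Lemma dir_angle_triangle xi eta zeta :
  dir_angle xi zeta <= dir_angle xi eta + dir_angle eta zeta.
Proof.
apply: (ler_cvg_to (@cvg_dir_angle xi zeta)
  (cvgD (@cvg_dir_angle xi eta) (@cvg_dir_angle eta zeta))).
by apply: nearW => n; exact: angle_triangle.
Qed.

Lemma dir_angle_direction g h : dir_angle (direction g) (direction h) = angle g h.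
Proof.
apply: cvg_lim => //; apply/cvgrPdist_lt => e e0; have e2 : 0 < e / 2 by rewrite divr_gt0.
apply: filterS2 (completion_rep_direction g e2) (completion_rep_direction h e2) => n.
set u := completion_rep _ n; set v := completion_rep _ n => gu hv.
have h1 := angle_triangle hX g u h; have h2 := angle_triangle hX u v h.
have h3 := angle_triangle hX u g v; have h4 := angle_triangle hX g h v.
rewrite (angle_sym hX v h) in h2; rewrite (angle_sym hX u g) in h3.
move: gu hv h1 h2 h3 h4; move: (angle g h) (angle g u) (angle h v) (angle u v)
  (angle u h) (angle g v) => {u v} gh gu hv uv uh gv *.
by rewrite ltr_norml; apply/andP; split; lra.
Qed.

(** Tangent vectors are defined through [completion_dist], inner products through [dir_angle]; this
    passes from the first to the second. *)
Lemma dir_angle_le_completion_dist xi eta (e : R) :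
  (completion_dist xi eta < e%:E)%E -> dir_angle xi eta <= e.
Proof.
have := cvg_intrinsic_angle (@completion_rep_cauchy xi) (@completion_rep_cauchy eta).
rewrite /completion_dist; move=> cD lt.
apply: (cvgr_to_le (@cvg_dir_angle xi eta)).
have : \forall n \near \oo, (D (completion_rep xi n) (completion_rep eta n) < e%:E)%E.
  exact: (cD _ (open_ereal_lt' lt)).
apply: filterS => n lt'; rewrite -lee_fin (le_trans (angle_le_intrinsic _ _))//.
exact: ltW.
Qed.

(** The way back, for small angles between geodesics: [intrinsic_angle_le] in the limit, with half
    of the margin [e - angle g h] spent on each representative. *)
Lemma completion_dist_direction g h (e : R) : angle g h < e -> e <= 4^-1 ->
  (completion_dist (direction g) (direction h) <= (8 * e)%:E)%E.
Proof.
move=> ghe e4; have d0 : 0 < (e - angle g h) / 2 by rewrite divr_gt0// subr_gt0.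
apply: (cvge_to_le (cvg_intrinsic_angle (@completion_rep_cauchy _) (@completion_rep_cauchy _))).
apply: filterS2 (completion_rep_direction g d0) (completion_rep_direction h d0) => n.
set u := completion_rep _ n; set v := completion_rep _ n => gu hv.
apply: intrinsic_angle_le => //; rewrite (le_lt_trans (chord_le_angle hX _ _))//.
have h1 := angle_triangle hX u g v; have h2 := angle_triangle hX g h v.
rewrite (angle_sym hX u g) in h1; move: gu hv h1 h2 d0.
move: (angle u v) (angle u g) (angle g h) (angle g v) (angle h v) (angle g u) => *; lra.
Qed.

Lemma direction_dense xi (e : R) : 0 < e ->
  exists g, dir_angle (direction g) xi <= e.
Proof.
move=> e0; have e2 : 0 < e / 2 by rewrite divr_gt0.
have [N NP] := cauchy_angle xi e2; exists (completion_rep xi N).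
apply: (cvgr_to_le (@cvg_dir_angle _ _)).
have := completion_rep_direction (completion_rep xi N) e2; have : \forall n \near \oo, (N <= n)%N.
  by exists N.
apply: filterS2 => n Nn; set u := completion_rep (direction _) n => gu.
have := angle_triangle hX u (completion_rep xi N) (completion_rep xi n).
have := NP _ _ (leqnn N) Nn; rewrite (angle_sym hX u (completion_rep xi N)).
move: gu; generalize (angle (completion_rep xi N) u) (angle u (completion_rep xi n))
  (angle (completion_rep xi N) (completion_rep xi n)) => *; lra.
Qed.

End cauchy_sequences_of_directions.

(** * Distance and inner product in the tangent cone *)

Section cone_geometry.
Context {R : realType} {X : metricType R} (hX : CAT0_space X) {x : X}.
Implicit Types (xi eta : directions x) (v w : tangent_cone x).

Lemma cone_norm_ge0 v : 0 <= cone_norm v. Proof. by case: v => //= _ r; exact: ltW. Qed.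

Lemma dir_cos_lipschitz xi eta zeta :
  `|cos (dir_angle xi eta) - cos (dir_angle xi zeta)| <= 2 * sin (dir_angle eta zeta / 2).
Proof.
apply: norm_cosB_le; last by case/andP: (dir_angle_itv hX eta zeta).
have := dir_angle_triangle hX xi eta zeta; have := dir_angle_triangle hX xi zeta eta.
by rewrite (dir_angle_sym hX zeta eta) ler_norml => *; apply/andP; split; lra.
Qed.

(** The law of cosines as a radial part plus a chord part; both are nonnegative, so the distance
    dominates each. *)
Lemma cone_dist_Vec xi eta (r s : {posnum R}) :
  cone_dist (Vec xi r) (Vec eta s) ^+ 2 =
  (r%:num - s%:num) ^+ 2 + r%:num * s%:num * (2 * sin (dir_angle xi eta / 2)) ^+ 2.
Proof.
have E : dir_angle xi eta = (dir_angle xi eta / 2) *+ 2 by rewrite -mulr_natr divfK.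
have F : r%:num ^+ 2 + s%:num ^+ 2 - 2 * (r%:num * s%:num * cos (dir_angle xi eta)) =
  (r%:num - s%:num) ^+ 2 + r%:num * s%:num * (2 * sin (dir_angle xi eta / 2)) ^+ 2.
  by rewrite {1}E cos_mulr2n cos2sin2 mulr2n; ring.
by rewrite sqr_sqrtr//= F addr_ge0 ?sqr_ge0// mulr_ge0 ?sqr_ge0.
Qed.

Lemma cone_dist_Vertex v : cone_dist (Vertex x) v = cone_norm v.
Proof.
rewrite -[RHS]ger0_norm ?cone_norm_ge0// -sqrtr_sqr; congr Num.sqrt.
by rewrite /=; ring.
Qed.

Lemma cone_dist_sym v w : cone_dist v w = cone_dist w v.
Proof.
congr Num.sqrt; rewrite [cone_norm v ^+ 2 + _]addrC; congr (_ - 2 * _).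
case: v w => [|xi r] [|eta s] //=.
by rewrite (dir_angle_sym hX) [r%:num * _]mulrC.
Qed.

Lemma sin_half_dir_angle_ge0 xi eta : 0 <= sin (dir_angle xi eta / 2).
Proof.
have /andP[a0 a1] := dir_angle_itv hX xi eta; have := @pi_gt0 R => pi0.
by apply: sin_ge0_pi; apply/andP; split; lra.
Qed.

(** Makes minus the inner product with a fixed vector admissible as a differential. *)
Lemma cone_dot_lipschitz v w w' :
  `|cone_dot v w - cone_dot v w'| <= 2 * cone_norm v * cone_dist w w'.
Proof.
have cd0 : 0 <= cone_dist w w' by exact: sqrtr_ge0.
case: v => [|xi q]; first by rewrite /= subrr normr0 mulr0 mul0r.
have dvertex (u : R) eta : `|u * cos (dir_angle xi eta)| <= `|u|.
  by rewrite normrM ler_piMr// cos_max.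
case: w w' cd0 => [|eta r] [|zeta s] cd0 /=.
- by rewrite subrr normr0 !mulr_ge0.
- rewrite cone_dist_Vertex sub0r normrN.
  apply: (le_trans (dvertex _ _)); rewrite gtr0_norm ?mulr_gt0//.
  by rewrite ler_wpM2r// ler_peMl// ler1n.
- rewrite cone_dist_sym cone_dist_Vertex subr0.
  apply: (le_trans (dvertex _ _)); rewrite gtr0_norm ?mulr_gt0//.
  by rewrite ler_wpM2r// ler_peMl// ler1n.
have := dir_cos_lipschitz xi eta zeta; have := cone_dist_Vec eta zeta r s.
have := sin_half_dir_angle_ge0 eta zeta.
have : `|cos (dir_angle xi eta)| <= 1 by exact: cos_max.
have : `|cos (dir_angle xi zeta)| <= 1 by exact: cos_max.
move: cd0; move: (cone_dist _ _) (cos (dir_angle xi eta)) (cos (dir_angle xi zeta)).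
move: (sin _) => S cd ca cb cd0 cb1 ca1 S0 cdE cab.
have r0 : 0 < r%:num by []. have s0 : 0 < s%:num by [].
move: (r%:num) (s%:num) r0 s0 cdE => {}r {}s r0 s0 cdE.
have q0 : 0 < q%:num by [].
rewrite -!mulrA -mulrBr normrM gtr0_norm// mulrCA ler_pM2l//.
(* With [r <= s] the angular difference is multiplied by the smaller norm, and [r * r <= r * s] lets
   the chord part of the distance dominate it. *)
wlog rs : r s ca cb r0 s0 cdE cab ca1 cb1 / r <= s.
  move=> H; have [rs|/ltW sr] := leP r s; first exact: H.
  rewrite distrC; apply: (H s r) => //; last by rewrite distrC.
  by rewrite cdE; ring.
have rsd : s - r <= cd.
  rewrite -(@ler_pXn2r _ 2)// ?nnegrE ?subr_ge0// cdE.
  have : 0 <= r * s * (2 * S) ^+ 2 by rewrite !mulr_ge0 ?sqr_ge0 ?(ltW r0) ?(ltW s0).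
  lra.
have rSd : r * (2 * S) <= cd.
  rewrite -(@ler_pXn2r _ 2)// ?nnegrE ?mulr_ge0 ?(ltW r0)// cdE exprMn expr2.
  have : r * r * (2 * S) ^+ 2 <= r * s * (2 * S) ^+ 2.
    by rewrite ler_wpM2r ?sqr_ge0// ler_wpM2l// ltW.
  have := sqr_ge0 (r - s); lra.
have -> : r * ca - s * cb = r * (ca - cb) - (s - r) * cb by ring.
apply: (le_trans (ler_normB _ _)); rewrite !normrM (gtr0_norm r0) (ger0_norm (x := s - r)) ?subr_ge0//.
have : r * `|ca - cb| <= r * (2 * S) by rewrite ler_pM2l.
have : (s - r) * `|cb| <= (s - r) * 1 by rewrite ler_wpM2l// subr_ge0.
lra.
Qed.

End cone_geometry.

Lemma lipschitz_rectifiable (R : realType) (X : metricType R) (c : R -> X) (a b L : R) :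
  (forall u v, a <= u <= b -> a <= v <= b -> mdist (c u) (c v) <= L * `|u - v|) ->
  rectifiable_on c a b.
Proof.
move=> cL; split; last first.
  apply: (@le_lt_trans _ _ (L * (b - a))%:E); last exact: ltry.
  apply: curve_length_lipschitz => u v uI vI uv.
  by rewrite (le_trans (cL _ _ uI vI))// ler0_norm ?subr_le0// opprB.
apply/subspace_continuousP => u uI.
have L0 : 0 < `|L| + 1 by rewrite ltr_wpDl.
apply/cvg_ballP => e e0; rewrite near_withinE.
apply/nbhs_ballP; exists (e / (`|L| + 1)) => /=; first by rewrite divr_gt0.
move=> v uv vI; change (ball (c u) e (c v)); rewrite ballEmdist /=.
rewrite /= !in_itv/= in uI vI; rewrite /ball/= ltr_pdivlMr// in uv.
apply: le_lt_trans (cL _ _ uI vI) _; apply: le_lt_trans uv.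
by rewrite mulrC ler_wpM2l// (le_trans (ler_norm L))// lerDl.
Qed.

(** * Tangent vectors of geodesics and differentials *)

Section tangent_vectors.
Context {R : realType} {X : metricType R} (hX : CAT0_space X) {x : X}.
Implicit Types (g h : geodesic_from x) (xi : directions x) (w : tangent_cone x).

Lemma angle_eq0 g h (s : R) : 0 < s -> s <= geod_length g -> s <= geod_length h ->
  g s = h s -> angle g h = 0.
Proof.
move=> s0 sg sh gh; have := @chord_le_mdist _ _ hX x g h s.
rewrite (ltW s0) sg sh gh mdistxx => /(_ isT isT); rewrite pmulr_rle0// => c0.
have {}c0 : chord g h = 0 by apply/eqP; rewrite eq_le c0 chord_ge0.
have := angle_le_chord hX (g := g) (h := h); rewrite c0 ler01 mulr0 => /(_ isT) a0.
by apply/eqP; rewrite eq_le a0 angle_ge0.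
Qed.

Lemma geodesic_from_prefix g (s : R) : 0 < s -> s <= geod_length g ->
  exists g' : geodesic_from x, geod_length g' = s /\ (g' : R -> X) = g.
Proof.
move=> s0 sg; have iso u v : 0 <= u <= s -> 0 <= v <= s -> mdist (g u) (g v) = `|u - v|.
  move=> /andP[u0 us] /andP[v0 vs]; rewrite geod_isometry ?u0 ?v0//=.
    exact: le_trans sg.
  exact: le_trans sg.
by exists (GeodesicFrom s0 (geod_start g) iso).
Qed.

Lemma geod_length_mdist g : geod_length g = mdist x (geod_end g).
Proof. by rewrite geodesic_from_dist// lexx ltW ?geod_length_gt0. Qed.

Lemma angle_prefix g g' (s : R) : 0 < s <= geod_length g -> geod_end g' = g s ->
  angle g' g = 0.
Proof.
move=> /andP[s0 sg] e; have g's : geod_length g' = s.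
  by rewrite geod_length_mdist e geodesic_from_dist ?(ltW s0).
by apply: (@angle_eq0 _ _ s); rewrite ?g's// -e /geod_end g's.
Qed.

Lemma completion_dist_small g h (e : R) : 0 < e -> angle g h < Num.min 4^-1 (e / 9) ->
  (completion_dist (direction g) (direction h) < e%:E)%E.
Proof.
move=> e0 gh; apply: le_lt_trans (completion_dist_direction hX gh _) _.
  by rewrite ge_min lexx.
rewrite lte_fin; have : Num.min 4^-1 (e / 9) <= e / 9 by rewrite ge_min lexx orbT.
lra.
Qed.

Lemma right_tangent_geodesic g (r : {posnum R}) :
  constant_speed_geodesic (fun t => g (r%:num * t)) /\
  right_tangent (fun t => g (r%:num * t)) 0 (Vec (direction g) r).
Proof.
pose b := geod_length g / r%:num; have b0 : 0 < b by rewrite divr_gt0// geod_length_gt0.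
have rI u : 0 <= u <= b -> 0 <= r%:num * u <= geod_length g.
  by move=> /andP[u0 ub]; rewrite mulr_ge0//= mulrC -ler_pdivlMr.
have iso u v : 0 <= u <= b -> 0 <= v <= b ->
    mdist (g (r%:num * u)) (g (r%:num * v)) = r%:num * `|u - v|.
  by move=> uI vI; rewrite geod_isometry ?rI// -mulrBr normrM gtr0_norm.
split; first by exists b, r%:num.
split.
- by rewrite mulr0 geod_start.
- by exists b => //; apply: (lipschitz_rectifiable (L := r%:num)) => u v uI vI; rewrite iso.
- apply: cvg_near_cst; near=> s; have s0 : 0 < s by [].
  have sb : s <= b by near: s; exact: nbhs_right_le.
  rewrite metric_sym geodesic_from_dist ?rI ?(ltW s0)// subr0 mulfK// gt_eqF//.
- move=> e e0; near=> s => g' g's; have s0 : 0 < s by [].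
  have sb : s <= b by near: s; exact: nbhs_right_le.
  apply: completion_dist_small => //; rewrite (angle_prefix _ g's).
    by rewrite lt_min; apply/andP; split; [rewrite invr_gt0|rewrite divr_gt0].
  have : 0 <= s <= b by rewrite (ltW s0).
  by move=> /rI /andP[_ ->]; rewrite mulr_gt0.
Unshelve. all: by end_near. Qed.

(** The vector [xi] is only placed at angle 0 from [direction g]; inner products see no more than
    that. *)
Lemma constant_speed_tangent (c : R -> X) w : constant_speed_geodesic c ->
  right_tangent c 0 w ->
  (w = Vertex x /\ \forall t \near 0^'+, c t = x) \/
  exists xi r g, [/\ w = Vec xi r, dir_angle (direction g) xi = 0 &
    \forall t \near 0^'+, 0 < r%:num * t <= geod_length g /\ c t = g (r%:num * t)].
Proof.
move=> [b [r [b0 r0 ciso]]] [cx _ cnorm cdir].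
have cxE t : 0 <= t <= b -> mdist (c t) x = r * t.
  move=> tI; rewrite -cx ciso ?lexx ?(ltW b0)//.
  by rewrite subr0 ger0_norm//; case/andP: tI.
have wr : cone_norm w = r.
  apply: (cvg_unique _ cnorm) => //; apply: cvg_near_cst; near=> t; have t0 : 0 < t by [].
  have tb : t <= b by near: t; exact: nbhs_right_le.
  by rewrite cxE ?(ltW t0)// subr0 mulfK// gt_eqF.
case: w cnorm cdir wr => [|xi q] cnorm cdir /= wr.
  left; split => //; near=> t; have t0 : 0 < t by [].
  have tb : t <= b by near: t; exact: nbhs_right_le.
  by apply: mdist_positivity; rewrite cxE ?(ltW t0)// -wr mul0r.
right; have q0 : 0 < q%:num by []. have rb0 : 0 < r * b by rewrite -wr mulr_gt0.
have gs0 : c (0 / r) = x by rewrite mul0r.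
have sI s : 0 <= s <= r * b -> 0 <= s / r <= b.
  move=> /andP[s0 sb]; rewrite divr_ge0//= ler_pdivrMr -?wr// wr mulrC//.
have giso s t : 0 <= s <= r * b -> 0 <= t <= r * b ->
    mdist (c (s / r)) (c (t / r)) = `|s - t|.
  move=> s1 t1; rewrite ciso ?sI// -mulrBl normrM -wr [`|(q%:num)^-1|]gtr0_norm ?invr_gt0//.
  by rewrite mulrC divfK// gt_eqF.
have [g [gl gm]] : exists g : geodesic_from x, geod_length g = r * b /\ forall s, g s = c (s / r).
  by exists (GeodesicFrom (geod_map := fun s => c (s / r)) rb0 gs0 giso).
exists xi, q, g; have gE : \forall t \near 0^'+, 0 < q%:num * t <= geod_length g /\ c t = g (q%:num * t).
  near=> t; have t0 : 0 < t by [].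
  have tb : t <= b by near: t; exact: nbhs_right_le.
  by rewrite mulr_gt0//= gl gm -wr ler_pM2l// mulrC mulKf// gt_eqF.
split => //; apply/eqP; rewrite eq_le; have /andP[-> _] := dir_angle_itv hX (direction g) xi.
rewrite andbT; apply/ler_addgt0Pr => e e0; rewrite add0r.
have : \forall t \near (0 : R)^'+, dir_angle (direction g) xi <= e.
  apply: filterS2 gE (cdir _ e0) => t [/andP[t0 tl] ct] cd.
  have [g' [g'l g'E]] := geodesic_from_prefix t0 tl.
  have g'e : geod_end g' = c t by rewrite /geod_end g'l g'E ct.
  have a0 : angle g' g = 0.
    by apply: (@angle_prefix g g' (q%:num * t)); rewrite ?t0// g'e ct.
  have := dir_angle_le_completion_dist hX (cd _ g'e).
  have := dir_angle_triangle hX (direction g) (direction g') xi.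
  rewrite (dir_angle_direction hX) (angle_sym hX) a0 add0r; exact: le_trans.
by move=> /(@filter_ex _ _ _)[].
Unshelve. all: by end_near. Qed.

Lemma differential_direction (G : X -> R) dG h (r : {posnum R}) :
  is_differential G dG ->
  (G (h (r%:num * t)) - G x) / t @[t --> 0^'+] --> dG (Vec (direction h) r).
Proof. by move=> [_ /(_ _ _ _ (right_tangent_geodesic h r).2)]; apply; case: (right_tangent_geodesic h r). Qed.

Lemma two_sin_half_le (a : R) : 0 <= a -> 2 * sin (a / 2) <= a.
Proof.
move=> a0; have a2 : 0 <= a / 2 by rewrite divr_ge0.
have [c _ ->] := sin_mean_value a2.
have : cos c * (a / 2) <= 1 * (a / 2) by rewrite ler_wpM2r// cos_le1.
lra.
Qed.

(** Geodesic directions are dense and [dG] is Lipschitz, so its values at completed directions are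
    reached from directional derivatives along geodesics. *)
Lemma differential_approx (G : X -> R) dG xi (r : {posnum R}) (e : R) :
  is_differential G dG -> 0 < e -> exists2 h, dir_angle (direction h) xi <= e &
    `|dG (Vec (direction h) r) - dG (Vec xi r)| <= e.
Proof.
move=> [[L dGL] _] e0; have M0 : 0 < (`|L| + 1) * r%:num by rewrite mulr_gt0// ltr_wpDl.
have d0 : 0 < Num.min e (e / ((`|L| + 1) * r%:num)) by rewrite lt_min e0 divr_gt0.
have [h hxi] := direction_dense hX xi d0; exists h.
  by rewrite (le_trans hxi)// ge_min lexx.
apply: (le_trans (dGL _ _)).
have cd : cone_dist (Vec (direction h) r) (Vec xi r) <= r%:num * dir_angle (direction h) xi.
  have /andP[a0 _] := dir_angle_itv hX (direction h) xi.
  rewrite -(@ler_pXn2r _ 2)// ?nnegrE ?sqrtr_ge0 ?mulr_ge0//.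
  rewrite cone_dist_Vec subrr expr0n/= add0r -expr2 -exprMn.
  rewrite ler_pXn2r// ?nnegrE ?mulr_ge0// ?sin_half_dir_angle_ge0//.
  by rewrite ler_pM2l// two_sin_half_le.
have cd0 : 0 <= cone_dist (Vec (direction h) r) (Vec xi r) by exact: sqrtr_ge0.
apply: (@le_trans _ _ ((`|L| + 1) * (r%:num * dir_angle (direction h) xi))).
  apply: (@le_trans _ _ ((`|L| + 1) * cone_dist (Vec (direction h) r) (Vec xi r))).
    by rewrite ler_wpM2r// (le_trans (ler_norm L))// lerDl.
  by rewrite ler_wpM2l// ltW// ltr_wpDl.
have : dir_angle (direction h) xi <= e / ((`|L| + 1) * r%:num).
  by rewrite (le_trans hxi)// ge_min lexx orbT.
by rewrite ler_pdivlMr//; lra.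
Qed.

End tangent_vectors.

(** * The gradient of the distance to a convex set *)

Section gradient_of_distance.
Context {R : realType} {X : metricType R} (hX : CAT0_space X) {x : X}.
Context {C : set X} (C0 : C !=set0) (clC : closed C) (cC : geodesically_convex C).
Implicit Types (g h : geodesic_from x) (xi : directions x) (v : tangent_cone x).
Let G := dist_to C.

(** At a minimum of [G] the derivatives along geodesics are nonnegative, whereas a gradient of norm
    [r > 0] has [dG v = - r ^+ 2]; an approximation within [r ^+ 2 / 2] gives the contradiction. *)
Lemma gradient_distance_eq0 v : G x = 0 -> is_downward_gradient G v -> v = Vertex x.
Proof.
move=> Gx [dG [dGP _]]; case: v => // xi r /= dGv; exfalso.
have e0 : 0 < r%:num ^+ 2 / 2 by rewrite divr_gt0// exprn_gt0.
have [h _ hd] := differential_approx hX xi r dGP e0.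
have : 0 <= dG (Vec (direction h) r).
  apply: (cvgr_to_ge (@differential_direction _ _ hX x G dG h r dGP)); near=> t.
  by rewrite Gx subr0 divr_ge0 ?dist_to_ge0.
move: hd; rewrite dGv ler_norml => /andP[_].
have -> : dir_angle xi xi = 0.
  rewrite /dir_angle; apply: cvg_lim => //.
  by apply: cvg_near_cst; apply: nearW => n; rewrite anglexx.
have r0 : 0 < r%:num ^+ 2 by rewrite exprn_gt0.
rewrite cos0 mulr1 -expr2; lra.
Unshelve. all: by end_near. Qed.

Section positive_distance.
Context (g : geodesic_from x) (Cg : C (geod_end g)) (Gg : geod_length g = G x).

(** For the lower bound, [nearest_reshetnyak] accounts for the motion of the nearest point and
    leaves no error. For the upper bound, a detour over [g d], at a fixed small distance from [x],
    converts the angle into a length. *)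
Lemma distance_first_variation h (e : R) : 0 < e ->
  \forall t \near 0^'+, `|G (h t) - G x + t * cos (angle g h)| <= e * t.
Proof.
move=> e0; have e2 : 0 < e / 2 by rewrite divr_gt0.
have [d d0 [dg dh dP]] := angle_limit hX g h e2.
have G0 : 0 < G x by rewrite -Gg geod_length_gt0.
have xg : mdist x (geod_end g) = G x by rewrite -geod_length_mdist.
near=> t; have t0 : 0 < t by [].
have td : t <= d by near: t; exact: nbhs_right_le.
have ted : t <= e * d by near: t; apply: nbhs_right_le; rewrite mulr_gt0.
have hI : 0 <= t <= geod_length h by rewrite (ltW t0) (le_trans td).
rewrite ler_norml; apply/andP; split.
  have := nearest_reshetnyak hX (h t) C0 clC cC Cg xg.
  rewrite geodesic_from_dist// -/G => key.
  have := @angle_comparison _ _ hX x g h (geod_length g) t.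
  rewrite lexx (ltW (geod_length_gt0 g)) hI => /(_ isT isT); rewrite -/(geod_end g) Gg => key2.
  have key3 : 0 <= G x * (G (h t) - G x + t * cos (angle g h)) by lra.
  rewrite pmulr_rge0// in key3; have : 0 <= e * t by rewrite mulr_ge0 ?ltW.
  lra.
have := dP d t; rewrite lexx (ltW d0) (ltW t0) td => /(_ isT isT) dist.
have c1 : cos (angle g h) <= 1 by exact: cos_le1.
have dI : 0 <= d <= geod_length g by rewrite (ltW d0).
have gde : mdist (g d) (geod_end g) = G x - d.
  by rewrite geod_isometry ?dI ?lexx ?(ltW (geod_length_gt0 g))// distrC ger0_norm ?subr_ge0// Gg.
have := dist_to_le (h t) Cg; have := metric_triangle (h t) (g d) (geod_end g).
rewrite gde (metric_sym (h t) (g d)) -/G => tri1 tri2.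
move: dist tri1; move: (mdist (g d) (h t)) (mdist_ge0 (g d) (h t)) (cos (angle g h)) c1.
move=> m m0 c c1 dist tri1.
(* First-order expansion of the third side; the remainder [t ^+ 2 / (2 * d)] is small against [t]
   because [d] is fixed. *)
have key : m <= d - t * (c - e / 2) + t ^+ 2 / (2 * d).
  have p1 : t * (c - e / 2) <= t * 1 by rewrite ler_wpM2l ?(ltW t0)//; lra.
  have p2 : 0 <= t ^+ 2 / (2 * d) by rewrite divr_ge0 ?sqr_ge0 ?mulr_ge0 ?(ltW d0).
  rewrite -(@ler_pXn2r _ 2)// ?nnegrE//; last by lra.
  apply: (le_trans dist); set k := t ^+ 2 / (2 * d) in p2 *.
  have kE : 2 * d * k = t ^+ 2 by rewrite mulrC divfK// mulf_neq0 ?gt_eqF.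
  have := sqr_ge0 (t * (c - e / 2) - k); lra.
have : t ^+ 2 / (2 * d) <= e * t / 2.
  rewrite ler_pdivrMr ?mulr_gt0//.
  have : t * t <= t * (e * d) by rewrite ler_wpM2l ?(ltW t0).
  lra.
lra.
Unshelve. all: by end_near. Qed.

Lemma distance_directional_derivative h (r : {posnum R}) :
  (G (h (r%:num * t)) - G x) / t @[t --> 0^'+] --> - (r%:num * cos (angle g h)).
Proof.
apply/cvgrPdist_le => e e0; have er : 0 < e / r%:num by rewrite divr_gt0.
have /nbhs_ballP[d /= d0 dP] := distance_first_variation h er.
near=> t; have t0 : 0 < t by [].
have td : t < d / r%:num by near: t; apply: nbhs_right_lt; rewrite divr_gt0.
have := dP (r%:num * t); rewrite /ball/= sub0r normrN gtr0_norm ?mulr_gt0//.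
rewrite ltr_pdivlMr// mulrC in td => /(_ td isT) H.
have -> : - (r%:num * cos (angle g h)) - (G (h (r%:num * t)) - G x) / t =
  - ((G (h (r%:num * t)) - G x) / t + r%:num * cos (angle g h)) by ring.
rewrite normrN.
have -> : (G (h (r%:num * t)) - G x) / t + r%:num * cos (angle g h) =
  (G (h (r%:num * t)) - G x + r%:num * t * cos (angle g h)) / t.
  by field; rewrite gt_eqF.
rewrite normrM [`|t^-1|]gtr0_norm ?invr_gt0// ler_pdivrMr//.
apply: (le_trans H); rewrite mulrA divfK ?gt_eqF//.
Unshelve. all: by end_near. Qed.

Lemma differential_distance dG xi (r : {posnum R}) : is_differential G dG ->
  dG (Vec xi r) = - (r%:num * cos (dir_angle (direction g) xi)).
Proof.
move=> dGP; apply/eqP; rewrite -subr_eq0 -normr_eq0 eq_le normr_ge0 andbT.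
apply/ler_addgt0Pr => e e0; rewrite add0r.
have r1 : 0 < r%:num + 1 by rewrite ltr_wpDl.
have d0 : 0 < e / (r%:num + 1) by rewrite divr_gt0.
have [h hxi hd] := differential_approx hX xi r dGP d0.
have dGh : dG (Vec (direction h) r) = - (r%:num * cos (angle g h)).
  exact: (cvg_unique _ (@differential_direction _ _ hX x G dG h r dGP)
    (@distance_directional_derivative h r)).
have /andP[a0 _] := dir_angle_itv hX (direction h) xi.
have := dir_cos_lipschitz hX (direction g) (direction h) xi.
rewrite dir_angle_direction// => cc.
have {}cc := le_trans cc (le_trans (two_sin_half_le a0) hxi).
have : r%:num * `|cos (angle g h) - cos (dir_angle (direction g) xi)| <= r%:num * (e / (r%:num + 1)).
  by rewrite ler_wpM2l.
rewrite -[X in X * `|_|](gtr0_norm (x := r%:num))// -normrM => cc2.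
have eE : e = e / (r%:num + 1) + r%:num * (e / (r%:num + 1)).
  by field; rewrite gt_eqF.
rewrite [leRHS]eE -(subrKA (dG (Vec (direction h) r))); apply: (le_trans (ler_normD _ _)).
rewrite distrC lerD// dGh; apply: le_trans cc2; rewrite -normrN.
by have -> // : - (- (r%:num * cos (angle g h)) - - (r%:num * cos (dir_angle (direction g) xi)))
  = r%:num * (cos (angle g h) - cos (dir_angle (direction g) xi)) by ring.
Qed.

(** Testing against the unit vector along [g] gives [r * cos >= 1], and the equation at [v] gives
    [cos = r]; hence [r = 1] and the angle is 0. *)
Lemma gradient_distance_unique v : is_downward_gradient G v ->
  exists xi r, [/\ v = Vec xi r, r%:num = 1 & dir_angle (direction g) xi = 0].
Proof.
move=> [dG [dGP dGge dGv]].
pose one : {posnum R} := PosNum ltr01.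
have := dGge (Vec (direction g) one); rewrite (differential_distance _ _ dGP).
have one1 : one%:num = 1 by [].
rewrite dir_angle_direction// anglexx cos0 mulr1 one1.
case: v dGge dGv => [|xi r] dGge dGv /=; first by move=> ?; exfalso; lra.
move: dGv; rewrite (differential_distance _ _ dGP) /=.
have -> : dir_angle xi xi = 0.
  rewrite /dir_angle; apply: cvg_lim => //.
  by apply: cvg_near_cst; apply: nearW => n; rewrite anglexx.
rewrite cos0 !mulr1 => /oppr_inj rr; rewrite lerN2 (dir_angle_sym hX) => rc.
have r0 : 0 < r%:num by [].
have cr : cos (dir_angle (direction g) xi) = r%:num.
  by apply: (mulfI (lt0r_neq0 r0)).
have c1 : cos (dir_angle (direction g) xi) <= 1 by exact: cos_le1.
have r1 : r%:num = 1.
  rewrite cr in c1 rc; move: (r%:num) r0 c1 rc => q q0 q1 qq.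
  by apply/eqP; rewrite eq_le q1/=; nra.
exists xi, r; split => //; apply: (@cos_inj R).
- by rewrite in_itv/= dir_angle_itv.
- by rewrite in_itv/= lexx pi_ge0.
- by rewrite cr r1 cos0.
Qed.

(** Minus the inner product with the candidate is a differential by the first variation formula, and
    with it both gradient conditions are trivial. *)
Lemma gradient_distance_direction (r : {posnum R}) : r%:num = 1 ->
  is_downward_gradient G (Vec (direction g) r).
Proof.
move=> r1; exists (fun w => - cone_dot (Vec (direction g) r) w); split => //.
split.
  exists (2 * cone_norm (Vec (direction g) r)) => v w.
  by rewrite -opprD normrN; exact: cone_dot_lipschitz.
move=> c w cs rt; have [[-> cx]|[xi [q [h [-> hxi cE]]]]] := constant_speed_tangent hX cs rt.
  rewrite /= oppr0; apply: cvg_near_cst; near=> t.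
  have -> : c t = x by near: t.
  by rewrite subrr mul0r.
rewrite /= r1 mul1r; have -> : dir_angle (direction g) xi = angle g h.
  rewrite -(dir_angle_direction hX); have := dir_angle_triangle hX (direction g) (direction h) xi.
  have := dir_angle_triangle hX (direction g) xi (direction h).
  rewrite (dir_angle_sym hX xi) hxi !addr0 => h1 h2; apply/eqP; rewrite eq_le h1 h2//.
apply: cvg_trans (@distance_directional_derivative h q); apply: near_eq_cvg.
by apply: filterS cE => t [_ ->].
Unshelve. all: by end_near. Qed.

End positive_distance.

End gradient_of_distance.

(** * Gradient curves satisfy the evolution inequality *)

Lemma near_at_right (R : realType) (t : R) (P : R -> Prop) :
  (\forall s \near t^'+, P s) -> exists2 d, 0 < d & forall k, 0 < k < d -> P (t + k).
Proof.
move=> /nbhs_ballP[d /= d0 dP]; exists d => // k /andP[k0 kd]; apply: dP; last first.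
  by rewrite ltrDl.
by rewrite /ball/= opprD addNKr normrN gtr0_norm.
Qed.

Lemma at_right_near (R : realType) (t d : R) (P : R -> Prop) : 0 < d ->
  (forall k, 0 < k < d -> P (t + k)) -> \forall s \near t^'+, P s.
Proof.
move=> d0 dP; near=> s; rewrite -(subrKC t s); apply: dP; apply/andP; split.
  by rewrite subr_gt0.
by near: s; exact: nbhs_right_ltDr.
Unshelve. all: by end_near. Qed.

(** Continuous induction: the supremum of the times where the bound holds is attained by
    semicontinuity, and a step from it would exceed it. A single step at each time is enough,
    however small. *)
Lemma dini_le (R : realType) (f : R -> R) (a b e : R) : a <= b ->
  (forall t n, a <= t <= b -> 0 < n -> exists2 d, 0 < d &
     forall s, a <= s <= b -> `|s - t| < d -> f t <= f s + n) ->
  (forall t, a <= t < b -> exists k, [/\ 0 < k, t + k <= b & f (t + k) <= f t + e * k]) ->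
  f b <= f a + e * (b - a).
Proof.
move=> ab lsc step.
pose S := [set t | a <= t <= b /\ f t <= f a + e * (t - a)].
have Sa : S a by split; rewrite ?lexx ?ab// subrr mulr0 addr0.
have hS : has_sup S by split; [exists a|exists b => t [/andP[]]].
pose m := sup S; have am : a <= m by apply: ub_le_sup => //; case: hS.
have mb : m <= b by apply: ge_sup; [exists a|move=> t [/andP[]]].
have Sm : S m.
  split; rewrite ?am//; apply/ler_addgt0Pr => n n0.
  have n2 : 0 < n / 2 by rewrite divr_gt0.
  have mI : a <= m <= b by rewrite am.
  have [d d0 dP] := lsc m _ mI n2.
  have e1 : 0 < `|e| + 1 by rewrite ltr_wpDl.
  pose d' := Num.min d (n / 2 / (`|e| + 1)).
  have d'0 : 0 < d' by rewrite lt_min d0 divr_gt0.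
  have [s [sI sf] sm] := sup_adherent d'0 hS.
  have ms : s <= m by apply: ub_le_sup; [case: hS|].
  have d1 : d' <= d by rewrite ge_min lexx.
  have d2 : d' <= n / 2 / (`|e| + 1) by rewrite ge_min lexx orbT.
  have := dP s sI; rewrite ler0_norm ?subr_le0// opprB ltrBlDl -ltrBlDr.
  move=> /(_ (le_lt_trans (lerB (lexx m) d1) sm)) => fm.
  have : (`|e| + 1) * (m - s) <= n / 2.
    rewrite mulrC -ler_pdivlMr//; apply: (le_trans _ d2); rewrite -/m in sm; lra.
  have : - (`|e| * (m - s)) <= e * (m - s).
    by rewrite -mulNr ler_wpM2r ?subr_ge0// lerNl -normrN ler_norm.
  rewrite -/m in sm; lra.
have [bm|mlb] := leP b m.
  by case: Sm => _; have -> // : m = b by apply/eqP; rewrite eq_le mb.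
have [] := step m; first by rewrite am.
move=> k [k0 kb fk]; exfalso; have : S (m + k).
  split; first by rewrite kb andbT (le_trans am)// lerDl ltW.
  by case: Sm => _; lra.
by move=> /(ub_le_sup hS.2); rewrite -/m; lra.
Qed.

(** A defect of order [n ^+ 2] in two lengths yields a deviation of order [n]: the terms without [n]
    cancel, and [4 * n ^+ 2 + n ^+ 4] is left as the coefficient of [k ^+ 2]. *)
Lemma stewart_bound (R : realType) (l k m n a b : R) : 0 <= l <= 1 -> 0 <= k ->
  k = l * m -> n ^+ 2 <= 4^-1 -> a <= ((1 + n ^+ 2) * k) ^+ 2 ->
  b <= (m - (1 - n ^+ 2) * k) ^+ 2 ->
  (1 - l) * a + l * b - l * (1 - l) * m ^+ 2 <= (3 * n * k) ^+ 2.
Proof.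
move=> /andP[l0 l1] k0 kE nn ale ble; have nn0 := sqr_ge0 n.
have a2 : (1 - l) * a <= (1 - l) * ((1 + n ^+ 2) * k) ^+ 2.
  by rewrite ler_wpM2l// subr_ge0.
have b2 : l * b <= l * (m - (1 - n ^+ 2) * k) ^+ 2 by rewrite ler_wpM2l.
have f2 : l * ((1 - n ^+ 2) * k) ^+ 2 <= l * ((1 + n ^+ 2) * k) ^+ 2.
  rewrite ler_wpM2l// ler_pXn2r// ?nnegrE ?mulr_ge0//; try lra.
  by rewrite ler_wpM2r//; lra.
have h2 : n ^+ 2 * (n ^+ 2 * k ^+ 2) <= 4^-1 * (n ^+ 2 * k ^+ 2).
  by rewrite ler_wpM2r// mulr_ge0// sqr_ge0.
have h3 : 0 <= n ^+ 2 * k ^+ 2 by rewrite mulr_ge0// sqr_ge0.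
have c2 : l * (m - (1 - n ^+ 2) * k) ^+ 2 =
    k * m - 2 * (1 - n ^+ 2) * k ^+ 2 + l * ((1 - n ^+ 2) * k) ^+ 2.
  by rewrite [in RHS]expr2 !kE; ring.
have e2 : l * (1 - l) * m ^+ 2 = k * m - k ^+ 2 by rewrite kE; ring.
rewrite e2; rewrite c2 in b2; lra.
Qed.

(** * Gradient curves as pursuit of the nearest point *)

Section pursuit.
Context {R : realType} {X : metricType R} (hX : CAT0_space X).
Implicit Types (p q x z : X) (c : R -> X) (C : set X).

(** What a gradient says in terms of distances and angles alone. The last clause compares [g] with
    geodesics depending on [k], so it does not place [c k] near [g k]. *)
Definition moves_toward C x c : Prop :=
  (dist_to C x = 0 /\ forall e, 0 < e -> exists2 d, 0 < d &
     forall k, 0 < k < d -> mdist x (c k) <= e * k) \/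
  (0 < dist_to C x /\ (forall e, 0 < e -> exists2 d, 0 < d &
     forall k, 0 < k < d -> `|mdist x (c k) - k| <= e * k) /\
   exists g : geodesic_from x, [/\ C (geod_end g), geod_length g = dist_to C x &
     forall e, 0 < e -> exists2 d, 0 < d & forall k, 0 < k < d ->
     forall g' : geodesic_from x, geod_end g' = c k -> angle g' g < e]).

Lemma exists_geodesic_to_nearest C x : C !=set0 -> closed C -> geodesically_convex C ->
  0 < dist_to C x -> exists g : geodesic_from x, C (geod_end g) /\ geod_length g = dist_to C x.
Proof.
move=> C0 clC cC Cx; have [q Cq xq] := nearest_point hX x C0 clC cC.
have xnq : x != q by rewrite -mdist_gt0 xq.
by have [g [gl ge]] := geodesic_from_exists hX xnq; exists g; rewrite gl ge.
Qed.

Lemma gradient_moves_toward C c t (v : tangent_cone (c t)) :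
  C !=set0 -> closed C -> geodesically_convex C ->
  right_tangent c t v -> is_downward_gradient (dist_to C) v ->
  moves_toward C (c t) (fun k => c (t + k)).
Proof.
move=> C0 clC cC [_ _ cnorm cdir] grad.
have speed (e : R) : 0 < e -> exists2 d, 0 < d & forall k, 0 < k < d ->
    `|mdist (c t) (c (t + k)) - cone_norm v * k| <= e * k.
  move=> e0; have /cvgrPdist_le/(_ _ e0)/near_at_right[d d0 dP] := cnorm.
  exists d => // k kd; have := dP _ kd; case/andP: kd => k0 _.
  have -> : t + k - t = k by ring.
  rewrite metric_sym distrC.
  have -> : mdist (c t) (c (t + k)) / k - cone_norm v =
    (mdist (c t) (c (t + k)) - cone_norm v * k) / k by field; rewrite gt_eqF.
  by rewrite normrM [`|k^-1|]gtr0_norm ?invr_gt0// ler_pdivrMr.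
have := dist_to_ge0 (c t) C0; rewrite le_eqVlt => /predU1P[/esym Cx|Cx].
  left; split => // e e0; have [d d0 dP] := speed _ e0; exists d => // k kd.
  have := dP _ kd; rewrite (gradient_distance_eq0 hX C0 Cx grad) /= mul0r subr0.
  exact/le_trans/ler_norm.
right; split => //; have [g [Cg Gg]] := exists_geodesic_to_nearest C0 clC cC Cx.
have [xi [r [vE r1 gxi]]] := gradient_distance_unique hX C0 clC cC Cg Gg grad.
split.
  move=> e e0; have [d d0 dP] := speed _ e0; exists d => // k kd.
  by have := dP _ kd; rewrite vE /= r1 mul1r.
exists g; split => // e e0; have e2 : 0 < e / 2 by rewrite divr_gt0.
move: cdir; rewrite vE => /(_ _ e2)/near_at_right[d d0 dP]; exists d => // k kd g' g'e.
have := dir_angle_le_completion_dist hX (dP _ kd _ g'e).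
rewrite -(dir_angle_direction hX) => le2.
have := dir_angle_triangle hX (direction g') xi (direction g).
rewrite (dir_angle_sym hX xi) gxi addr0 => le3.
by rewrite (le_lt_trans le3)// (le_lt_trans le2)// ltr_pdivrMr// ltr_pMr// ltr1n.
Qed.

(* If [c] approaches [q] at almost unit speed for arbitrarily small times, then
   it stays close to the geodesic [pq], whose direction is therefore close to
   the one of [g]; hence [c] stays close to [g] as well, at the same times. *)
Lemma approach_follows p q (g : geodesic_from p) c (n : R) : 0 < n -> n <= 2^-1 ->
  (exists2 d, 0 < d & forall k, 0 < k < d -> `|mdist p (c k) - k| <= n ^+ 2 * k) ->
  (exists2 d, 0 < d & forall k, 0 < k < d ->
     forall g' : geodesic_from p, geod_end g' = c k -> angle g' g < n) ->
  (forall d, 0 < d -> exists2 k, 0 < k < d &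
     mdist (c k) q < mdist p q - (1 - n ^+ 2) * k) ->
  forall d, 0 < d -> exists2 k, 0 < k < d & mdist (c k) (g k) <= 17 * n * k.
Proof.
move=> n0 n2 [d1 d10 speed] [d2 d20 dir] good d d0.
have nn : n ^+ 2 <= 4^-1.
  have : n ^+ 2 <= 2^-1 ^+ 2 by rewrite ler_pXn2r// ?nnegrE ?invr_ge0// ltW.
  lra.
have nn0 : 0 < n ^+ 2 by rewrite exprn_gt0.
have pq : 0 < mdist p q.
  have [k /andP[k0 _] lt] := good _ ltr01.
  have := mdist_ge0 (c k) q; have : 0 <= (1 - n ^+ 2) * k by rewrite mulr_ge0 ?(ltW k0)//; lra.
  lra.
have [gq [gql gqe]] : exists gq : geodesic_from p, geod_length gq = mdist p q /\ geod_end gq = q.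
  by apply: geodesic_from_exists; rewrite -?mdist_gt0.
have key k : 0 < k < Num.min d1 (mdist p q) ->
    mdist (c k) q < mdist p q - (1 - n ^+ 2) * k -> mdist (gq k) (c k) <= 3 * n * k.
  rewrite lt_min => /andP[k0 /andP[kd1 kpq]] lt.
  have : `|mdist p (c k) - k| <= n ^+ 2 * k by apply: speed; rewrite k0.
  rewrite ler_norml => /andP[_ sp].
  have l01 : 0 <= k / mdist p q <= 1.
    by rewrite divr_ge0 ?(ltW k0) ?(ltW pq)//= ler_pdivrMr// mul1r ltW.
  have gqb : geodesic_between p q gq.
    have := @geodesic_from_between _ _ p gq (geod_length gq).
    rewrite -/(geod_end gq) gqe lexx ltW ?geod_length_gt0//; exact.
  have := stewart hX (c k) gqb l01; rewrite divfK ?gt_eqF// => st.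
  rewrite -(@ler_pXn2r _ 2)// ?nnegrE ?mdist_ge0 ?mulr_ge0 ?(ltW n0) ?(ltW k0)//.
  apply: (le_trans st); set l := k / mdist p q in l01 *.
  have kE : k = l * mdist p q by rewrite divfK ?gt_eqF.
  case/andP: l01 => l0 l1.
  have a2 : mdist p (c k) ^+ 2 <= ((1 + n ^+ 2) * k) ^+ 2.
    by rewrite ler_pXn2r// ?nnegrE ?mdist_ge0 ?mulr_ge0 ?addr_ge0 ?sqr_ge0 ?(ltW k0)//; lra.
  have b2 : mdist q (c k) ^+ 2 <= (mdist p q - (1 - n ^+ 2) * k) ^+ 2.
    rewrite metric_sym ler_pXn2r// ?nnegrE ?mdist_ge0 ?ltW//.
    exact: le_lt_trans (mdist_ge0 _ _) lt.
  by apply: (@stewart_bound _ l k (mdist p q)); rewrite ?l0 ?(ltW k0).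
(* [chord_between] turns the deviation [3 * n * k] into a chord of at most [12 * n] between [gq] and
   the geodesic ending at [c k]; [dir] adds at most [n]. *)
have chord_gq : chord gq g <= 13 * n.
  pose m := Num.min (Num.min d1 (mdist p q)) d2.
  have m0 : 0 < m by rewrite !lt_min d10 pq.
  have [k /andP[k0 km] lt] := good _ m0; move: km; rewrite lt_min => /andP[km kd2].
  have := key k; rewrite k0 km => /(_ isT lt) kk.
  have [kd1 kpq] : k < d1 /\ k < mdist p q by move: km; rewrite lt_min => /andP[].
  have : `|mdist p (c k) - k| <= n ^+ 2 * k by apply: speed; rewrite k0.
  rewrite ler_norml => /andP[sp _].
  have pc : k / 2 <= mdist p (c k).
    have : n ^+ 2 * k <= 4^-1 * k by rewrite ler_wpM2r ?(ltW k0).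
    lra.
  have pck : p != c k by rewrite -mdist_gt0 (lt_le_trans _ pc)// divr_gt0.
  have [g' [g'l g'e]] := geodesic_from_exists hX pck.
  have /(dir k)/(_ g' g'e) ang : 0 < k < d2 by rewrite k0.
  have := @chord_between _ _ hX p gq g' k (geod_length g').
  rewrite lexx (ltW k0) (ltW (geod_length_gt0 g')) gql (ltW kpq) => /(_ isT isT).
  rewrite -/(geod_end g') g'e g'l => cb.
  have mk : k / 2 <= Num.min k (mdist p (c k)) by rewrite le_min pc andbT; lra.
  have : k / 2 * chord gq g' <= Num.min k (mdist p (c k)) * chord gq g'.
    by rewrite ler_wpM2r// chord_ge0.
  move=> le1; have : k * chord gq g' <= k * (12 * n) by lra.
  rewrite ler_pM2l// => le2; have := chord_triangle hX gq g' g.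
  have := chord_le_angle hX g' g; lra.
(* Neither [gq] nor [g] depends on [k], so their chord controls the distance of [gq k] and [g k] at
   the small times given by [good]. The constant is [17 = 3 + 13 + 1]. *)
have [d3 d30 [_ _ d3P]] := chord_limit hX gq g n0.
pose m := Num.min (Num.min d1 (mdist p q)) (Num.min d d3).
have m0 : 0 < m by rewrite !lt_min d10 pq d0.
have [k /andP[k0 km] lt] := good _ m0; move: km.
rewrite lt_min => /andP[km]; rewrite lt_min => /andP[kd kd3].
exists k; rewrite ?k0//; have := key k; rewrite k0 km => /(_ isT lt) kk.
have := d3P k; rewrite (ltW k0) (ltW kd3) => /(_ isT) gg.
have : k * (chord gq g + n) <= k * (14 * n) by rewrite ler_pM2l//; lra.
have := metric_triangle (c k) (gq k) (g k); rewrite (metric_sym (c k) (gq k)); lra.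
Qed.

End pursuit.

Lemma dini_le_lipschitz (R : realType) (f : R -> R) (a b K : R) : a <= b ->
  (forall s t, a <= s <= b -> a <= t <= b -> f t <= f s + K * `|s - t|) ->
  (forall t, a <= t < b -> exists k, [/\ 0 < k, t + k <= b & f (t + k) <= f t]) ->
  f b <= f a.
Proof.
move=> ab fK step; rewrite -[leRHS]addr0 -(mul0r (b - a)); apply: dini_le => //.
  move=> t n tI n0; have K0 : 0 < `|K| + 1 by rewrite ltr_wpDl.
  exists (n / (`|K| + 1)); first by rewrite divr_gt0.
  move=> s sI; rewrite ltr_pdivlMr// => st; rewrite (le_trans (fK _ _ sI tI))// lerD2l.
  apply: le_trans (ltW st); rewrite mulrC ler_wpM2l// (le_trans (ler_norm K))// lerDl//.
by move=> t tI; have [k [k0 kb fk]] := step _ tI; exists k; rewrite mul0r addr0.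
Qed.

Lemma hausdorff_dist_le (R : realType) (X : metricType R) (A B : set X) (r : R) a :
  (hausdorff_dist A B <= r%:E)%E -> A a -> dist_to B a <= r.
Proof.
rewrite /hausdorff_dist ge_max => /andP[le_r _] Aa.
rewrite -lee_fin (le_trans _ le_r)//; apply: ereal_sup_ubound; exact: imageP.
Qed.

(** Over [n] equal steps the errors add up to [C * (b - a) ^+ 2 / n], which tends to 0. *)
Lemma quadratic_le (R : realType) (f : R -> R) (a b C : R) : a <= b ->
  (forall u v, a <= u <= v -> v <= b -> f v <= f u + C * (v - u) ^+ 2) -> f b <= f a.
Proof.
move=> ab fC; have chain n w : 0 <= w -> a + n%:R * w <= b -> f (a + n%:R * w) <= f a + n%:R * (C * w ^+ 2).
  move=> w0; elim: n => [|n IH] nb; first by rewrite !mul0r !addr0.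
  have step : n.+1%:R * w = n%:R * w + w by rewrite -natr1; ring.
  have nb' : a + n%:R * w <= b by apply: le_trans nb; rewrite lerD2l ler_wpM2r// ler_nat.
  have := fC (a + n%:R * w) (a + n.+1%:R * w); rewrite lerDl mulr_ge0// lerD2l step lerDl w0.
  rewrite -step nb => /(_ isT isT); have -> : a + n.+1%:R * w - (a + n%:R * w) = w by rewrite step; ring.
  have := IH nb'; rewrite -natr1; lra.
apply/ler_addgt0Pr => e e0; pose D := `|C| * (b - a) ^+ 2 + 1.
have D0 : 0 < D by rewrite ltr_wpDl// mulr_ge0// sqr_ge0.
have [n nD] : exists n : nat, D / e < n.+1%:R.
  exists (Num.truncn (D / e)); have /truncn_itv/andP[_ //] : 0 <= D / e by rewrite divr_ge0// ltW.
have n0 : 0 < (n.+1%:R : R) by rewrite ltr0n.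
have := chain n.+1 ((b - a) / n.+1%:R); rewrite divr_ge0 ?subr_ge0 ?(ltW n0)//.
rewrite [_ * (_ / _)]mulrC divfK ?gt_eqF// subrKC lexx => /(_ isT isT) /le_trans; apply.
rewrite lerD2l; have -> : n.+1%:R * (C * ((b - a) / n.+1%:R) ^+ 2) = C * (b - a) ^+ 2 / n.+1%:R.
  by field; rewrite gt_eqF// (lt_trans _ n0).
rewrite ler_pdivrMr//; rewrite ltr_pdivrMr// in nD.
have : C * (b - a) ^+ 2 <= `|C| * (b - a) ^+ 2 by rewrite ler_wpM2r ?sqr_ge0// ler_norm.
by rewrite mulrC in nD; move: nD; rewrite /D; lra.
Qed.

(** * Evolution inequalities for the moving sets *)

Section moving_sets.
Context {R : realType} {X : metricType R} (hX : CAT0_space X) {Y : R -> set X}.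
Context (Y_nonempty : forall t, 0 <= t -> Y t !=set0).
Context (Y_closed : forall t, 0 <= t -> closed (Y t)).
Context (Y_convex : forall t, 0 <= t -> geodesically_convex (Y t)).
Context (Y_lip : forall t t', 0 <= t -> 0 <= t' ->
  (hausdorff_dist (Y t) (Y t') <= `|t - t'|%:E)%E).
Implicit Types (p q z : X) (s : R -> X).
Let F t p := dist_to (Y t) p.

(* [lra] and [ring] fail when a section variable has been cleared. *)
Local Ltac drop_local := clear - hX Y_nonempty Y_closed Y_convex Y_lip F.

Lemma moving_dist_ge0 t p : 0 <= t -> 0 <= F t p.
Proof. by move=> t0; apply: dist_to_ge0; exact: Y_nonempty. Qed.

Lemma moving_dist_time t t' p : 0 <= t -> 0 <= t' -> F t p <= F t' p + `|t - t'|.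
Proof.
move=> t0 t'0; have [q Yq pq] := nearest_point hX p (Y_nonempty t'0) (Y_closed t'0) (Y_convex t'0).
have := hausdorff_dist_le (Y_lip t'0 t0) Yq; rewrite distrC /F -pq => le1.
have := dist_to_lipschitz p q (Y_nonempty t0); lra.
Qed.

Lemma moving_dist_lipschitz t t' p q : 0 <= t -> 0 <= t' ->
  F t p <= F t' q + `|t - t'| + mdist p q.
Proof.
move=> t0 t'0; apply: (le_trans (dist_to_lipschitz p q (Y_nonempty t0))).
by rewrite lerD2r moving_dist_time.
Qed.

Lemma sqr_mdist_lipschitz p q z (Z d : R) : mdist p z <= Z -> mdist q z <= Z ->
  mdist p q <= d -> mdist p z ^+ 2 <= mdist q z ^+ 2 + 2 * Z * d.
Proof.
move=> pZ qZ pq; have tri := metric_triangle p q z.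
have p0 := mdist_ge0 p z; have q0 := mdist_ge0 q z; have pq0 := mdist_ge0 p q.
have h1 : mdist p z ^+ 2 - mdist q z ^+ 2 = (mdist p z - mdist q z) * (mdist p z + mdist q z).
  by ring.
have h2 : (mdist p z - mdist q z) * (mdist p z + mdist q z) <= d * (2 * Z).
  apply: (@le_trans _ _ (d * (mdist p z + mdist q z))).
    by rewrite ler_wpM2r ?addr_ge0//; lra.
  by rewrite ler_wpM2l; lra.
lra.
Qed.

(** The threshold [d] may depend on [z], so [z] has to stay fixed while [b] tends to [a]. *)
Definition dini_evi s a := forall z e, 0 < e -> exists2 d, 0 < d &
  forall b, a < b < a + d ->
    mdist (s b) z ^+ 2 <= mdist (s a) z ^+ 2 + 2 * (b - a) * (F a z - F a (s a) + e).

Lemma still_dini_evi s a : 0 <= a -> F a (s a) = 0 ->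
  moves_toward (Y a) (s a) (fun k => s (a + k)) -> dini_evi s a.
Proof.
move=> a0 Fa [[_ slow]|[]]; last by rewrite -/(F _ _) Fa ltxx.
move=> z e e0; pose Z := mdist (s a) z + 1.
have Z0 : 0 < Z by rewrite ltr_wpDl ?mdist_ge0.
have n0 : 0 < Num.min 1 (e / Z) by rewrite lt_min ltr01 divr_gt0.
have [d d0 dP] := slow _ n0; exists (Num.min d 1); first by rewrite lt_min d0 ltr01.
move=> b; rewrite -ltrBlDl lt_min => /andP[ab /andP[bd b1]].
have := dP (b - a); rewrite subr_gt0 ab bd => /(_ isT); rewrite subrKC => sab.
have k0 : 0 < b - a by rewrite subr_gt0.
have m1 : Num.min 1 (e / Z) * (b - a) <= 1.
  by rewrite -[leRHS]mulr1 ler_pM ?(ltW n0) ?(ltW k0) ?(ltW b1)// ge_min lexx.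
have sabs : mdist (s b) (s a) <= Num.min 1 (e / Z) * (b - a) by rewrite metric_sym.
have zb : mdist (s b) z <= Z by have := metric_triangle (s b) (s a) z; rewrite /Z; lra.
have za : mdist (s a) z <= Z by rewrite lerDl.
apply: (le_trans (sqr_mdist_lipschitz zb za sabs)); rewrite lerD2l Fa subr0.
have : Z * Num.min 1 (e / Z) <= e.
  by rewrite mulrC -ler_pdivlMr// ge_min lexx orbT.
move=> h1; have : Z * Num.min 1 (e / Z) * (b - a) <= e * (b - a) by rewrite ler_pM2r.
have : 0 <= (b - a) * F a z by rewrite mulr_ge0 ?moving_dist_ge0 ?(ltW k0).
lra.
Qed.

(** At a time when [c k] is near [g k], the one-step inequality for [g k] carries over. The
    deviation [17 * n * k] costs at most [k * (e / 2)] in squared distance, and the term [k ^+ 2] as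
    much again. *)
Lemma gradient_step_evi t p c z (Z n e : R) : 0 <= t -> 0 < F t p ->
  (exists g : geodesic_from p, [/\ Y t (geod_end g), geod_length g = F t p &
    forall d, 0 < d -> exists2 k, 0 < k < d & mdist (c k) (g k) <= 17 * n * k]) ->
  mdist p z <= Z -> 0 < n -> 17 * n <= 1 -> 17 * n * (2 * Z + 3) <= e / 2 -> 0 < e ->
  forall d, 0 < d -> exists2 k, 0 < k < d &
    mdist (c k) z ^+ 2 <= mdist p z ^+ 2 + 2 * k * (F t z - F t p + e / 2).
Proof.
move=> t0 Fp [g [Yg gl close]] pZ n0 n1 nZ e0 d d0.
have m0 : 0 < Num.min (Num.min d 1) (Num.min (F t p) (e / 2)).
  by rewrite !lt_min d0 ltr01 Fp divr_gt0.
have [k /andP[k0 km] ck] := close _ m0; move: km; rewrite !lt_min.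
move=> /andP[/andP[kd k1] /andP[kF ke]]; exists k; first by rewrite k0.
have gb : geodesic_between p (geod_end g) g.
  by apply: geodesic_from_between; rewrite lexx ltW ?geod_length_gt0.
have pg : mdist p (geod_end g) = dist_to (Y t) p by rewrite -geod_length_mdist.
have := toward_nearest_step hX z (Y_nonempty t0) (Y_closed t0) (Y_convex t0) Yg pg gb (ltW k0).
rewrite -/(F _ _) (min_idPl (ltW kF)) => step.
have gI : 0 <= k <= geod_length g by rewrite gl (ltW k0) (ltW kF).
have gz : mdist (g k) z <= Z + 1.
  have := metric_triangle (g k) p z; rewrite (metric_sym (g k) p) geodesic_from_dist//; lra.
have ck1 : mdist (c k) (g k) <= 1.
  by apply: (le_trans ck); rewrite -[leRHS]mulr1 ler_pM ?mulr_ge0 ?(ltW n0) ?(ltW k0) ?(ltW k1).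
have h : mdist (c k) z ^+ 2 <= mdist (g k) z ^+ 2 + 17 * n * k * (2 * Z + 3).
  have tri := metric_triangle (c k) (g k) z.
  have cz : mdist (c k) z ^+ 2 <= (mdist (c k) (g k) + mdist (g k) z) ^+ 2.
    by rewrite ler_pXn2r// nnegrE ?addr_ge0 ?mdist_ge0.
  apply: (le_trans cz); have q0 := mdist_ge0 (c k) (g k); have r0 := mdist_ge0 (g k) z.
  have : mdist (c k) (g k) * (mdist (c k) (g k) + 2 * mdist (g k) z) <= 17 * n * k * (2 * Z + 3).
    by apply: ler_pM => //; [rewrite addr_ge0// mulr_ge0|lra].
  lra.
have : k * (17 * n * (2 * Z + 3)) <= k * (e / 2) by rewrite ler_pM2l.
have : k * k <= k * (e / 2) by rewrite ler_pM2l// ltW.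
lra.
Qed.

Lemma gradient_dini_evi s a (r L : R) : 0 <= a -> 0 < r -> 0 <= L ->
  (forall u v, a <= u <= a + r -> a <= v <= a + r -> mdist (s u) (s v) <= L * `|u - v|) ->
  (forall t, a <= t < a + r -> moves_toward (Y t) (s t) (fun k => s (t + k))) ->
  dini_evi s a.
Proof.
move=> a0 r0 L0 sL toward.
have aI : a <= a < a + r by rewrite lexx ltrDl.
have [Fa|Fa0] := eqVneq (F a (s a)) 0; first exact: still_dini_evi Fa (toward _ aI).
have {}Fa0 : 0 < F a (s a) by rewrite lt_neqAle eq_sym Fa0 moving_dist_ge0.
move=> z e e0; pose Z := mdist (s a) z + 1; pose A := F a z - F a (s a).
have Z0 : 0 < 2 * Z + 3 by have := mdist_ge0 (s a) z; rewrite /Z; lra.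
pose n := Num.min (17^-1) (e / 4 / (17 * (2 * Z + 3))).
have n0 : 0 < n by rewrite lt_min invr_gt0/= ltr0n/= !divr_gt0// mulr_gt0.
have n17 : n <= 17^-1 by rewrite ge_min lexx.
have nZ : 17 * n * (2 * Z + 3) <= e / 2 / 2.
  have : n <= e / 4 / (17 * (2 * Z + 3)) by rewrite ge_min lexx orbT.
  by rewrite ler_pdivlMr ?mulr_gt0//; lra.
have n20 : 0 < n ^+ 2 by rewrite exprn_gt0.
(* When the approach to [s b] is slower than [1 - n ^+ 2], the penalty grows at rate at least
   [K * n ^+ 2], which pays for the Lipschitz growth of the squared distance and for the linear term
   of [M]. *)
pose K := (2 * Z * L + 2 * `|A| + e) / n ^+ 2.
have K1 : 0 < 2 * Z * L + 2 * `|A| + e.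
  have := mdist_ge0 (s a) z; have := normr_ge0 A => ? ?.
  have : 0 <= 2 * Z * L by rewrite !mulr_ge0// addr_ge0.
  lra.
have K0 : 0 < K by rewrite divr_gt0.
have Kn : K * n ^+ 2 = 2 * Z * L + 2 * `|A| + e by rewrite divfK// gt_eqF.
(* The accumulated penalty will be at most [2 * K * e2 * (b - a)], which is then
   [e / 2 * (b - a)]. *)
pose e2 := e / 4 / K; have e20 : 0 < e2 by rewrite !divr_gt0.
have Ke2 : K * e2 = e / 4 by rewrite mulrC divfK// gt_eqF.
have speed t : a <= t < a + r -> 0 < F t (s t) -> forall n, 0 < n -> exists2 d, 0 < d &
    forall k, 0 < k < d -> `|mdist (s t) (s (t + k)) - k| <= n * k.
  move=> tI Ft; case: (toward t tI) => [[]|[_ []]]//.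
  by rewrite -/(F _ _) => F0; rewrite F0 ltxx in Ft.
have [d1 d10 d1P] := speed _ aI Fa0 _ e20.
have L2 : 0 < L + 2 by rewrite ltr_wpDl.
(* Before [a + d] the curve keeps a positive distance to the moving set, and [F t z - F t (s t)]
   exceeds its value [A] at [a] by at most [e / 8]. *)
pose d := Num.min (Num.min r d1) (Num.min (F a (s a)) (Num.min 1 (e / 8)) / (L + 2)).
have m0 : 0 < Num.min (F a (s a)) (Num.min 1 (e / 8)) by rewrite !lt_min Fa0 ltr01 divr_gt0.
have d0 : 0 < d by rewrite !lt_min r0 d10 divr_gt0.
exists d => // b /andP[ab]; rewrite -ltrBlDl !lt_min => /andP[/andP[br bd1]].
rewrite ltr_pdivlMr// !lt_min => /andP[bF /andP[b1 be]].
have k0 : 0 < b - a by rewrite subr_gt0.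
have bI u : a <= u <= b -> a <= u <= a + r by move=> /andP[-> ub]/=; move: ub br; drop_local; lra.
have sL' u v : a <= u <= b -> a <= v <= b -> mdist (s u) (s v) <= L * `|u - v|.
  by move=> uI vI; rewrite sL ?bI.
have near_a t : a <= t <= b -> [/\ 0 <= t - a, L * (t - a) <= L * (b - a) & mdist (s t) (s a) <= L * (t - a)].
  move=> tI; case/andP: (tI) => at_ tb; split; first by rewrite subr_ge0.
    by rewrite ler_wpM2l// lerB.
  by have := sL' _ a tI; rewrite lexx (ltW ab) ger0_norm ?subr_ge0//; exact.
have sZ t : a <= t <= b -> mdist (s t) z <= Z.
  move=> /near_a[ta Lt sta]; have := metric_triangle (s t) (s a) z; rewrite /Z.
  by move: Lt sta b1 k0; drop_local; lra.
have Ft t : a <= t <= b -> 0 < F t (s t) /\ F t z - F t (s t) <= A + e / 8.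
  move=> tI; have [ta Lt sta] := near_a _ tI; have t0 : 0 <= t by rewrite -(subrK a t) addr_ge0.
  have := moving_dist_lipschitz (s a) (s t) a0 t0; rewrite ler0_norm; last by move: ta; drop_local; lra.
  rewrite (metric_sym (s a)); have := moving_dist_time z t0 a0; rewrite ger0_norm// => h1 h2.
  have tb : t - a <= b - a by case/andP: tI => _; drop_local; lra.
  by move: Lt sta h1 h2 tb bF be k0; drop_local; split; rewrite /A; lra.
(* [s] moves toward [s b] at speed at most 1 + e2, and covers its distance to [s b]
   at average speed at least 1 - e2.  Where it does so at speed below 1 - n^2, the
   penalty [K (phi t + (1 + e2) (t - a))] grows fast enough to make [M] decrease;
   elsewhere [approach_follows] applies and gives the estimate at [t]. *)
pose phi t := mdist (s t) (s b).
pose M t := mdist (s t) z ^+ 2 - 2 * (A + e / 2) * (t - a) - K * (phi t + (1 + e2) * (t - a)).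
have absA : - A <= `|A| by rewrite -normrN ler_norm.
have ML : M b <= M a.
  have phiL u v : a <= u <= b -> a <= v <= b -> phi u <= phi v + mdist (s u) (s v).
    by move=> _ _; rewrite addrC; exact: metric_triangle.
  apply: (@dini_le_lipschitz _ M a b (2 * Z * L + 2 * `|A + e / 2| + K * (L + (1 + e2)))).
  - exact: ltW.
  - move=> u v uI vI; rewrite /M.
    have := sqr_mdist_lipschitz (sZ _ vI) (sZ _ uI) (sL' _ _ vI uI).
    have := phiL _ _ uI vI; have := sL' _ _ uI vI; rewrite (distrC v u) => h1 h2 h3.
    have h4 : K * (phi u - phi v + (1 + e2) * (u - v)) <= K * (L * `|u - v| + (1 + e2) * `|u - v|).
      rewrite ler_pM2l//; have : (1 + e2) * (u - v) <= (1 + e2) * `|u - v|.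
        by rewrite ler_wpM2l ?ler_norm// addr_ge0// ltW.
      by move: h1 h2; drop_local; lra.
    have h5 : (A + e / 2) * (u - v) <= `|A + e / 2| * `|u - v|.
      by rewrite -normrM ler_norm.
    by move: h3 h4 h5; drop_local; lra.
  move=> t /andP[at_ tb].
  have tI : a <= t <= b by rewrite at_ ltW.
  have tr : a <= t < a + r by rewrite at_ (lt_trans tb)//; move: br; drop_local; lra.
  have t0 : 0 <= t by exact: le_trans at_.
  have [Ft0 FtA] := Ft _ tI.
  have Mk k : 0 < k -> t + k <= b -> M (t + k) - M t =
      mdist (s (t + k)) z ^+ 2 - mdist (s t) z ^+ 2 - 2 * (A + e / 2) * k
      - K * (phi (t + k) - phi t + (1 + e2) * k) by move=> _ _; rewrite /M; drop_local; ring.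
  have tkI k : 0 < k -> t + k <= b -> a <= t + k <= b.
    by move=> kp ->; rewrite andbT (le_trans at_)// lerDl ltW.
  have [[d3 d30 bad]|good] := pselect (exists2 d3, 0 < d3 & forall k, 0 < k < d3 ->
      phi t - (1 - n ^+ 2) * k <= phi (t + k)).
    pose k := Num.min (d3 / 2) (b - t).
    have kp : 0 < k by rewrite lt_min divr_gt0// subr_gt0.
    have kb : t + k <= b by rewrite -lerBrDl ge_min lexx orbT.
    have kd : k < d3 by rewrite gt_min ltr_pdivrMr// ltr_pMr// ltr1n.
    exists k; split => //; rewrite -subr_le0 Mk//.
    have := bad k; rewrite kp kd => /(_ isT) phik.
    have := sqr_mdist_lipschitz (sZ _ (tkI _ kp kb)) (sZ _ tI) (sL' _ _ (tkI _ kp kb) tI).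
    have -> : t + k - t = k by drop_local; ring.
    rewrite gtr0_norm// => Dk.
    have h1 : K * (n ^+ 2 * k) <= K * (phi (t + k) - phi t + (1 + e2) * k).
      rewrite ler_pM2l//; have : 0 <= e2 * k by rewrite mulr_ge0 ?(ltW e20) ?(ltW kp).
      by move: phik; drop_local; lra.
    have h2 : K * (n ^+ 2 * k) = (2 * Z * L + 2 * `|A| + e) * k by rewrite mulrA Kn.
    have h3 : - A * k <= `|A| * k by rewrite ler_pM2r.
    have h4 : 0 <= e * k by rewrite mulr_ge0 ?(ltW e0) ?(ltW kp).
    by move: Dk h1 h2 h3 h4; drop_local; lra.
  have [d4 d40 d4P] := speed _ tr Ft0 _ e20.
  have [g [Yg gl dir]] : exists g : geodesic_from (s t), [/\ Y t (geod_end g),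
      geod_length g = dist_to (Y t) (s t) & forall e, 0 < e -> exists2 d, 0 < d &
      forall k, 0 < k < d -> forall g' : geodesic_from (s t),
      geod_end g' = s (t + k) -> angle g' g < e].
    case: (toward t tr) => [[]|[_ []]]//.
    by rewrite -/(F _ _) => F0; rewrite F0 ltxx in Ft0.
  have follow : forall d, 0 < d -> exists2 k, 0 < k < d & mdist (s (t + k)) (g k) <= 17 * n * k.
    apply: (@approach_follows _ _ hX (s t) (s b) g (fun k => s (t + k)) n n0).
    - by move: n17; drop_local; lra.
    - exact: speed.
    - exact: dir.
    - move=> d' d'0; apply: contrapT => H; apply: good; exists d' => // k kd.
      by rewrite leNgt; apply/negP => lt; apply: H; exists k.
  have dm0 : 0 < Num.min d4 (b - t) by rewrite lt_min d40 subr_gt0.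
  have n1 : 17 * n <= 1 by move: n17; drop_local; lra.
  have e20' : 0 < e / 2 by rewrite divr_gt0.
  have [] := gradient_step_evi t0 Ft0 (ex_intro _ g (And3 Yg gl follow)) (sZ _ tI) n0 n1 nZ e20' dm0.
  move=> k /andP[kp]; rewrite lt_min => /andP[kd4 kbt] Dk; exists k.
  have kb : t + k <= b by rewrite -lerBrDl ltW.
  split => //; rewrite -subr_le0 Mk//.
  have := d4P k; rewrite kp kd4 => /(_ isT); rewrite ler_norml => /andP[_ spk].
  have phik := phiL _ _ tI (tkI _ kp kb).
  have h1 : 0 <= K * (phi (t + k) - phi t + (1 + e2) * k).
    by rewrite mulr_ge0 ?(ltW K0)//; move: spk phik; drop_local; lra.
  have h2 : k * (F t z - F t (s t)) <= k * (A + e / 8) by rewrite ler_pM2l.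
  have h3 : 0 <= e * k by rewrite mulr_ge0 ?(ltW e0) ?(ltW kp).
  by move: Dk h1 h2 h3; drop_local; lra.
(* At the ends [phi b = 0] and, by the speed at [a], [phi a >= (1 - e2) * (b - a)]; this bounds the
   accumulated penalty. *)
have := d1P (b - a); rewrite k0 bd1 subrKC => /(_ isT); rewrite ler_norml => /andP[spa _].
have h1 : K * (phi b - phi a + (1 + e2) * (b - a)) <= K * (2 * e2 * (b - a)).
  by rewrite ler_pM2l// /phi mdistxx; move: spa; drop_local; lra.
have h2 : K * (2 * e2 * (b - a)) = e / 2 * (b - a).
  have -> : K * (2 * e2 * (b - a)) = 2 * (K * e2) * (b - a).
    by drop_local; ring.
  by rewrite Ke2; drop_local; lra.
have h3 : 0 <= e * (b - a) by rewrite mulr_ge0 ?(ltW e0) ?(ltW k0).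
by move: ML h1 h2 h3; rewrite /M subrr -/A; drop_local; lra.
Qed.

(** * The limit of the Euler schemes *)

Lemma euler_step t p h : 0 <= t -> 0 <= h -> exists p', mdist p p' <= h /\
  forall z, mdist p' z ^+ 2 <= mdist p z ^+ 2 + 2 * h * (F t z - F t p) + h ^+ 2.
Proof.
move=> t0 h0; have [q Yq pq] := nearest_point hX p (Y_nonempty t0) (Y_closed t0) (Y_convex t0).
case: (hX) => _ /(_ p q)[g gpq] _; exists (g (Num.min h (F t p))); split; last first.
  by move=> z; apply: (toward_nearest_step hX z (Y_nonempty t0) (Y_closed t0) (Y_convex t0) Yq).
rewrite (geodesic_between_startdist gpq); first by rewrite ge_min lexx.
by rewrite le_min h0 moving_dist_ge0//= pq ge_min lexx orbT.
Qed.

(** Only the length of a step and its evolution inequality are kept. Step [k] uses the set at its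
    initial time [k%:R * h]. *)
Definition euler_scheme p0 h (u : nat -> X) : Prop := u 0%N = p0 /\ forall k,
  mdist (u k) (u k.+1) <= h /\ forall z, mdist (u k.+1) z ^+ 2 <=
    mdist (u k) z ^+ 2 + 2 * h * (F (k%:R * h) z - F (k%:R * h) (u k)) + h ^+ 2.

Lemma euler_scheme_exists p0 h : 0 <= h -> exists u, euler_scheme p0 h u.
Proof.
move=> h0; have [step stepP] : {step : nat * X -> X & forall kp,
    mdist kp.2 (step kp) <= h /\ forall z, mdist (step kp) z ^+ 2 <=
    mdist kp.2 z ^+ 2 + 2 * h * (F (kp.1%:R * h) z - F (kp.1%:R * h) kp.2) + h ^+ 2}.
  apply: (@choice _ _ (fun kp p' => mdist kp.2 p' <= h /\ forall z, mdist p' z ^+ 2 <=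
    mdist kp.2 z ^+ 2 + 2 * h * (F (kp.1%:R * h) z - F (kp.1%:R * h) kp.2) + h ^+ 2)).
  by move=> [k p] /=; apply: euler_step => //; rewrite mulr_ge0.
exists (fix u k := if k is k'.+1 then step (k', u k') else p0); split => // k.
exact: (stepP (k, _)).
Qed.

Section euler_estimates.
Context {p0 : X} {h : R} {u : nat -> X} (h0 : 0 <= h) (uP : euler_scheme p0 h u).

Lemma euler_lipschitz i j : mdist (u i) (u (i + j)) <= j%:R * h.
Proof.
elim: j => [|j IH]; first by rewrite addn0 mdistxx mul0r.
have [_ /(_ (i + j)%N)[st _]] := uP; rewrite addnS -natr1 mulrDl mul1r.
by rewrite (le_trans (metric_triangle _ (u (i + j)) _))// lerD.
Qed.

(** In summing the steps, [F] is brought back to the initial time and position: two shifts in time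
    and one displacement cost [j%:R * h] each, whence the factor 3. *)
Lemma euler_evi i j z : mdist (u (i + j)) z ^+ 2 <= mdist (u i) z ^+ 2 +
  2 * (j%:R * h) * (F (i%:R * h) z - F (i%:R * h) (u i)) + 3 * (j%:R * h) ^+ 2.
Proof.
elim: j => [|j IH]; first by rewrite addn0 mul0r mulr0 mul0r expr0n mulr0 !addr0.
have [_ /(_ (i + j)%N)[_ /(_ z) st]] := uP; rewrite addnS.
apply: (le_trans st); have ih0 : 0 <= i%:R * h by rewrite mulr_ge0.
have ij0 : 0 <= (i + j)%:R * h by rewrite mulr_ge0.
have jh0 : 0 <= j%:R * h by rewrite mulr_ge0.
have ijE : (i + j)%:R * h - i%:R * h = j%:R * h by rewrite natrD; ring.
have := moving_dist_time z ij0 ih0; rewrite ijE ger0_norm// => Fz.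
have := moving_dist_lipschitz (u i) (u (i + j)) ih0 ij0.
rewrite distrC ijE ger0_norm// => Fu; have ul := euler_lipschitz i j.
have FF : F ((i + j)%:R * h) z - F ((i + j)%:R * h) (u (i + j)) <=
  F (i%:R * h) z - F (i%:R * h) (u i) + 3 * (j%:R * h) by lra.
have {}FF : 2 * h * (F ((i + j)%:R * h) z - F ((i + j)%:R * h) (u (i + j))) <=
    2 * h * (F (i%:R * h) z - F (i%:R * h) (u i) + 3 * (j%:R * h)).
  by rewrite ler_wpM2l// mulr_ge0.
have jE : j.+1%:R * h = j%:R * h + h by rewrite -natr1; ring.
rewrite jE; have := sqr_ge0 h; move: FF IH; clear - h0 hX Y_nonempty Y_closed Y_convex Y_lip F uP.
by lra.
Qed.

End euler_estimates.

(** Insert the coarse point [u k] into the inequality of [K] fine steps, and the new fine point into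
    that of one coarse step. The values of [F] at [u k] cancel, and the errors [3 + 1 + 2] times
    [h ^+ 2] give the constant 6. *)
Lemma euler_refinement p0 h h' (u u' : nat -> X) (K : nat) : 0 <= h -> 0 <= h' ->
  K%:R * h' = h -> euler_scheme p0 h u -> euler_scheme p0 h' u' ->
  forall k, mdist (u' (K * k)%N) (u k) ^+ 2 <= 6 * (k%:R * h) * h.
Proof.
move=> h0 h'0 Kh uP u'P; elim => [|k IH].
  by rewrite muln0 (proj1 uP) (proj1 u'P) mdistxx mul0r mulr0 mul0r expr0n.
have [_ /(_ k)[_ st]] := uP.
have tE : (K * k)%:R * h' = k%:R * h by rewrite natrM -Kh; ring.
have t0 : 0 <= k%:R * h by rewrite mulr_ge0.
have := euler_evi h'0 u'P (K * k) K (u k); rewrite Kh tE -mulnSr => e1.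
have := euler_lipschitz u'P (K * k) K; rewrite Kh -mulnSr => l1.
have e2 := st (u' (K * k.+1)%N); rewrite (metric_sym (u k)) (metric_sym (u k.+1)) in e2.
have := dist_to_lipschitz (u' (K * k.+1)%N) (u' (K * k)%N) (Y_nonempty t0).
rewrite metric_sym -/(F _ _) -/(F _ _) => Fl.
have {}Fl : h * (F (k%:R * h) (u' (K * k.+1)%N) - F (k%:R * h) (u' (K * k)%N)) <= h * h.
  by rewrite ler_wpM2l//; lra.
have kE : k.+1%:R * h = k%:R * h + h by rewrite -natr1; ring.
rewrite kE; move: IH e1 e2 Fl.
clear - h0 hX Y_nonempty Y_closed Y_convex Y_lip F; lra.
Qed.

Lemma cvg_le0 (f g : nat -> R) l : (forall n, `|f n - l| <= g n) ->
  g n @[n --> \oo] --> 0 -> f n @[n --> \oo] --> l.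
Proof.
move=> fg /cvgrPdist_lt g0; apply/cvgrPdist_lt => e e0.
apply: filterS (g0 _ e0) => n; rewrite sub0r normrN distrC => /(le_lt_trans (ler_norm _)).
exact: le_lt_trans.
Qed.

Lemma cvg_mdistl (u : nat -> X) x z : u n @[n --> \oo] --> x ->
  mdist (u n) z @[n --> \oo] --> mdist x z.
Proof.
move=> /cvg_mdist; apply: cvg_le0 => n.
have := metric_triangle (u n) x z; have := metric_triangle x (u n) z.
by rewrite (metric_sym (u n) x) ler_norml => ? ?; apply/andP; split; lra.
Qed.

(** Dyadic steps make every finer grid a refinement of the coarser ones, and a distance of order
    [sqrt (t * h)] makes the schemes Cauchy at each time [t]. *)
Lemma flow_exists p0 : exists s, [/\ s 0 = p0,
  forall t t', 0 <= t -> 0 <= t' -> mdist (s t) (s t') <= `|t - t'| &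
  forall a b z, 0 <= a <= b -> mdist (s b) z ^+ 2 <=
    mdist (s a) z ^+ 2 + 2 * (b - a) * (F a z - F a (s a)) + 3 * (b - a) ^+ 2].
Proof.
pose h n : R := 2^-1 ^+ n; have h0 n : 0 < h n by rewrite exprn_gt0// invr_gt0.
have cvgh : h n @[n --> \oo] --> 0.
  by apply: cvg_expr; rewrite gtr0_norm ?invr_gt0// invf_lt1// ltr1n.
have [u uP] : {u : nat -> nat -> X & forall n, euler_scheme p0 (h n) (u n)}.
  apply: (@choice _ _ (fun n v => euler_scheme p0 (h n) v)) => n.
  by apply: euler_scheme_exists; exact: ltW.
pose N n (t : R) := Num.truncn (t / h n).
have NP n t : 0 <= t -> (N n t)%:R * h n <= t < (N n t)%:R * h n + h n.
  move=> t0; have th0 : 0 <= t / h n by rewrite divr_ge0// ltW.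
  have /andP[l1 l2] := truncn_itv th0; rewrite -ler_pdivlMr// l1/=.
  by rewrite -[X in _ + X]mul1r -mulrDl natr1 -ltr_pdivrMr.
have Nh n i t : i%:R * h n <= t -> (i <= N n t)%N.
  move=> it; have t0 : 0 <= t by apply: le_trans it; rewrite mulr_ge0 ?(ltW (h0 _)).
  by rewrite /N truncn_ge_nat ?divr_ge0 ?(ltW (h0 _))// ler_pdivlMr.
pose U n t := u n (N n t).
have Ulip n t t' : 0 <= t -> t <= t' -> mdist (U n t) (U n t') <= t' - t + h n.
  move=> t0 tt'; have t'0 := le_trans t0 tt'.
  have /andP[a1 a2] := NP n _ t0; have /andP[b1 b2] := NP n _ t'0.
  have le : (N n t <= N n t')%N by apply: Nh; exact: le_trans tt'.
  have := euler_lipschitz (uP n) (N n t) (N n t' - N n t).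
  by rewrite subnKC// natrB// mulrBl => /le_trans; apply; lra.
have UC t : 0 <= t -> exists x : X, U n t @[n --> \oo] --> x.
  move=> t0; apply: (cauchy_seq_limit hX) => e e0.
  (* The first bound absorbs the rounding of [t] to the grid; the second makes the root of
     [6 * t * h M] at most [e / 4]. *)
  have d0 : 0 < Num.min (e / 4) ((e / 4) ^+ 2 / (6 * t + 1)).
    by rewrite lt_min !divr_gt0 ?exprn_gt0 ?divr_gt0// ltr_wpDl// mulr_ge0.
  have /cvgrPdist_lt/(_ _ d0)[M _ MP] := cvgh.
  have hM : h M < Num.min (e / 4) ((e / 4) ^+ 2 / (6 * t + 1)).
    by have := MP M (leqnn _); rewrite /= sub0r normrN gtr0_norm.
  move: hM; rewrite lt_min => /andP[hM1]; rewrite ltr_pdivlMr ?ltr_wpDl ?mulr_ge0// => hM2.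
  have key n : (M <= n)%N -> mdist (U n t) (U M t) <= e / 2.
    move=> Mn; pose K := (2 ^ (n - M))%N.
    have Kh : K%:R * h n = h M.
      have nE : n = ((n - M) + M)%N by rewrite subnK.
      rewrite /h /K natrX {2}nE exprD mulrA -exprMn divff ?pnatr_eq0//.
      by rewrite expr1n mul1r.
    have /andP[a1 a2] := NP n _ t0; have /andP[b1 b2] := NP M _ t0.
    have KN : (K * N M t)%:R * h n = (N M t)%:R * h M by rewrite natrM -Kh; ring.
    have KN' : (K * N M t <= N n t)%N by apply: Nh; rewrite KN.
    have := euler_lipschitz (uP n) (K * N M t) (N n t - K * N M t).
    rewrite subnKC// natrB// mulrBl KN => l1.
    have := euler_refinement (ltW (h0 M)) (ltW (h0 n)) Kh (uP M) (uP n) (N M t) => l2.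
    have l3 : mdist (u n (K * N M t)%N) (u M (N M t)) <= e / 4.
      rewrite -(@ler_pXn2r _ 2)// ?nnegrE ?mdist_ge0 ?divr_ge0 ?(ltW e0)//.
      apply: (le_trans l2); apply: le_trans (ltW hM2).
      have : (N M t)%:R * h M * h M <= t * h M by rewrite ler_pM2r.
      have := ltW (h0 M); move: (h M) (_%:R * _) => hm nm; lra.
    have := metric_triangle (U n t) (u n (K * N M t)%N) (U M t).
    rewrite (metric_sym (U n t) (u n (K * N M t)%N)) /U; move: l1 l3 a1 b2 hM1.
    by drop_local; lra.
  exists M => m n Mm Mn; have := key _ Mm; have := key _ Mn.
  by have := metric_triangle (U m t) (U M t) (U n t); rewrite (metric_sym (U M t)); lra.
have [s sP] : {s : R -> X & forall t, 0 <= t -> U n t @[n --> \oo] --> s t}.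
  apply: (@choice _ _ (fun t x => 0 <= t -> U n t @[n --> \oo] --> x)) => t; have [/UC[x xP]|t0] := leP 0 t; first by exists x.
  by exists p0.
exists s; split.
- have U0 n : U n 0 = p0 by rewrite /U /N mul0r truncn0; exact: (proj1 (uP n)).
  have c := @cvg_mdistl _ _ p0 (sP 0 (lexx _)).
  have Up0 : (fun n => mdist (U n 0) p0) = (fun=> 0) by apply/funext => n; rewrite U0 mdistxx.
  rewrite Up0 in c; apply: mdist_positivity.
  exact: (cvg_unique _ c (cvg_cst (0 : R))).
- have lip t t' : 0 <= t -> t <= t' -> mdist (s t) (s t') <= t' - t.
    move=> t0 tt'; have t'0 := le_trans t0 tt'.
    have c1 : mdist (U n t) (s t') - mdist (s t') (U n t') @[n --> \oo] --> mdist (s t) (s t') - 0.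
      by apply: cvgB; [apply: cvg_mdistl; exact: sP|apply/cvg_mdist; exact: sP].
    have c2 : t' - t + h n @[n --> \oo] --> t' - t + 0 by apply: cvgD => //; exact: cvg_cst.
    rewrite -[leLHS]subr0 -[leRHS]addr0; apply: (ler_cvg_to c1 c2).
    apply: nearW => n; have := Ulip n _ _ t0 tt'.
    by have := metric_triangle (U n t) (U n t') (s t'); rewrite (metric_sym (s t')); lra.
  move=> t t' t0 t'0; have [tt'|/ltW t't] := leP t t'.
    by rewrite ler0_norm ?subr_le0// opprB lip.
  by rewrite ger0_norm ?subr_ge0// metric_sym lip.
move=> a b z /andP[a0 ab]; have b0 := le_trans a0 ab.
pose J n := ((N n b - N n a)%N)%:R * h n; pose I n := (N n a)%:R * h n.
have NN n : (N n a <= N n b)%N.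
  by apply: Nh; apply: le_trans ab; case/andP: (NP n a a0).
have I0 n : 0 <= I n by rewrite mulr_ge0// ltW.
have cJ : J n @[n --> \oo] --> b - a.
  apply: cvg_le0 cvgh => n; rewrite /J natrB// mulrBl.
  have /andP[a1 a2] := NP n _ a0; have /andP[b1 b2] := NP n _ b0.
  by rewrite ler_norml; apply/andP; split; lra.
have Ia n : `|I n - a| <= h n.
  by have /andP[a1 a2] := NP n _ a0; rewrite ler_norml /I; apply/andP; split; lra.
have cFz : F (I n) z @[n --> \oo] --> F a z.
  apply: cvg_le0 cvgh => n; have := moving_dist_time z (I0 n) a0.
  have := moving_dist_time z a0 (I0 n); have := Ia n; rewrite (distrC a (I n)).
  by move=> h1 h2 h3; rewrite ler_norml; apply/andP; split; lra.
have cFs : F (I n) (U n a) @[n --> \oo] --> F a (s a).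
  have c0 : h n + mdist (s a) (U n a) @[n --> \oo] --> (0 : R) + 0.
    by apply: cvgD => //; apply/cvg_mdist; exact: sP.
  rewrite addr0 in c0; apply: cvg_le0 c0 => n.
  have := moving_dist_lipschitz (U n a) (s a) (I0 n) a0.
  have := moving_dist_lipschitz (s a) (U n a) a0 (I0 n); have := Ia n.
  rewrite (distrC a (I n)) (metric_sym (U n a)) => h1 h2 h3.
  by rewrite ler_norml; apply/andP; split; lra.
have cb := @cvg_mdistl _ _ z (sP b b0); have ca := @cvg_mdistl _ _ z (sP a a0).
have c1 : mdist (U n b) z * mdist (U n b) z @[n --> \oo] --> mdist (s b) z * mdist (s b) z.
  exact: cvgM.
have c2 : mdist (U n a) z * mdist (U n a) z + 2 * J n * (F (I n) z - F (I n) (U n a)) + 3 * (J n * J n)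
    @[n --> \oo] --> mdist (s a) z * mdist (s a) z + 2 * (b - a) * (F a z - F a (s a)) +
    3 * ((b - a) * (b - a)).
  apply: cvgD; [apply: cvgD; [exact: cvgM|apply: cvgM; last exact: cvgB]|].
    by apply: cvgM => //; exact: cvg_cst.
  by apply: cvgM; [exact: cvg_cst|exact: cvgM].
rewrite !expr2; apply: (ler_cvg_to c1 c2); apply: nearW => n; rewrite -!expr2.
have := euler_evi (ltW (h0 n)) (uP n) (N n a) (N n b - N n a) z.
by rewrite subnKC.
Qed.

(** The point [w] of the old set nearest to [y'] is almost nearest to [p], and the obtuse angle at
    [y] bounds its distance from [y]. The resulting bound is only of order [1/2] in time. *)
Lemma moving_nearest_close a t p y y' : 0 <= a <= t -> Y a y -> mdist p y = F a p ->
  Y t y' -> mdist p y' = F t p ->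
  mdist y y' <= t - a + Num.sqrt (4 * F a p * (t - a) + 4 * (t - a) ^+ 2).
Proof.
move=> /andP[a0 at_] Yy py Yy' py'; have t0 := le_trans a0 at_.
have ta : 0 <= t - a by rewrite subr_ge0.
have [w Yw y'w] := nearest_point hX y' (Y_nonempty a0) (Y_closed a0) (Y_convex a0).
have := hausdorff_dist_le (Y_lip t0 a0) Yy'; rewrite -y'w ger0_norm// => wt.
have := moving_dist_time p t0 a0; rewrite ger0_norm// => Ft.
have Fa := moving_dist_ge0 p a0.
have ob := nearest_obtuse hX (Y_convex a0) Yy py Yw.
have pw : mdist p w <= F a p + 2 * (t - a).
  have := metric_triangle p y' w; rewrite py'; lra.
have pw2 : mdist p w ^+ 2 <= (F a p + 2 * (t - a)) ^+ 2.
  by rewrite ler_pXn2r// nnegrE ?mdist_ge0 ?addr_ge0 ?mulr_ge0.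
have s0 : 0 <= 4 * F a p * (t - a) + 4 * (t - a) ^+ 2.
  by rewrite addr_ge0 ?mulr_ge0 ?sqr_ge0.
have yw : mdist y w <= Num.sqrt (4 * F a p * (t - a) + 4 * (t - a) ^+ 2).
  rewrite -(@ler_pXn2r _ 2)// ?nnegrE ?mdist_ge0 ?sqrtr_ge0// sqr_sqrtr//.
  rewrite -/(F a p) in ob; move: ob pw2; drop_local; lra.
have := metric_triangle y w y'; rewrite (metric_sym w y'); lra.
Qed.

(** The Lipschitz bound in time would lose a multiple of [t - a], which can be as large as [h].
    Reshetnyak's inequality at the fixed time [t] loses only [h] times the displacement of the
    nearest point, which tends to 0. *)
Lemma moving_dist_along_geodesic a p (g : geodesic_from p) (e : R) :
  0 <= a -> Y a (geod_end g) -> geod_length g = F a p -> 0 < e ->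
  exists2 d, 0 < d & forall h t, 0 < h < d -> a <= t <= a + h ->
    F t (g h) - F t p <= (e - 1) * h.
Proof.
move=> a0 Yg gl e0; have Fa : 0 < F a p by rewrite -gl geod_length_gt0.
(* [f] bounds the square root in [moving_nearest_close]. It is proportional to [F a p] so that
   [h * f] is absorbed after division by [F t p], which is at least [F a p / 2]. *)
pose f := Num.min 2^-1 (e / 16) * F a p.
have f0 : 0 < f by rewrite mulr_gt0// lt_min invr_gt0/= ltr0n divr_gt0.
have f1 : f <= 2^-1 * F a p by rewrite ler_pM2r// ge_min lexx.
have f2 : f <= e / 16 * F a p by rewrite ler_pM2r// ge_min lexx orbT.
have q0 : 0 < f ^+ 2 / (8 * F a p) by rewrite divr_gt0 ?exprn_gt0// mulr_gt0.
exists (Num.min f (f ^+ 2 / (8 * F a p))); first by rewrite lt_min f0.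
move=> h t /andP[h0]; rewrite lt_min => /andP[hf]; rewrite ltr_pdivlMr ?mulr_gt0// => hf2.
move=> /andP[at_ th]; have t0 := le_trans a0 at_.
have ta : 0 <= t - a by rewrite subr_ge0.
have tah : t - a <= h by lra.
have [y' Yy' py'] := nearest_point hX p (Y_nonempty t0) (Y_closed t0) (Y_convex t0).
have pg : mdist p (geod_end g) = F a p by rewrite -geod_length_mdist.
have := moving_nearest_close (introT andP (conj a0 at_)) Yg pg Yy' py'.
set r := mdist _ _ => rE.
have hFa : h < F a p by lra.
have sq : Num.sqrt (4 * F a p * (t - a) + 4 * (t - a) ^+ 2) <= f.
  rewrite -[leRHS](ger0_norm (ltW f0)) -sqrtr_sqr ler_wsqrtr//.
  have m1 : F a p * (t - a) <= F a p * h by rewrite ler_pM2l.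
  have m2 : (t - a) * (t - a) <= F a p * h.
    by rewrite ler_pM//; move: tah hFa; drop_local; lra.
  by move: m1 m2 hf2; drop_local; lra.
have rh : r <= h + f by lra.
have gI : 0 <= h <= geod_length g by rewrite gl !ltW.
have gd := geodesic_from_dist gI.
have ge : mdist (g h) (geod_end g) = F a p - h.
  by rewrite geod_isometry ?gI ?lexx ?(ltW (geod_length_gt0 g))// distrC ger0_norm ?subr_ge0 gl// ltW.
have := quadrilateral hX (g h) p y' (geod_end g).
rewrite (metric_sym (g h) p) gd (metric_sym y') -/r pg ge py' -/(F t p) => quad.
have Fz : F t (g h) <= mdist (g h) y' by exact: dist_to_le.
have Ft0 := moving_dist_ge0 p t0; have Fz0 := moving_dist_ge0 (g h) t0.
have Fz2 : F t (g h) ^+ 2 <= mdist (g h) y' ^+ 2 by rewrite ler_pXn2r// nnegrE mdist_ge0.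
have := moving_dist_time p t0 a0; have := moving_dist_time p a0 t0.
rewrite (distrC a) ger0_norm// => F1 F2.
have Ft : F a p / 2 <= F t p by lra.
have Ftp : 0 < F t p by lra.
have hr : h * r <= h * (h + f) by rewrite ler_pM2l.
have hF : h * F t p <= h * (F a p + h) by rewrite ler_pM2l//; lra.
have hF' : h * (F a p - h) <= h * F t p by rewrite ler_pM2l//; lra.
have he : e * h * (F a p / 2) <= e * h * F t p by rewrite ler_pM2l ?mulr_gt0.
have hh : h * h <= h * f by rewrite ler_pM2l// ltW.
have hf3 : h * f <= h * (e / 16 * F a p) by rewrite ler_pM2l.
have sqd := sqr_ge0 (F t (g h) - F t p).
rewrite -(ler_pM2l Ftp); move: quad Fz2 hr hF hF' he hh hf3 sqd.
by drop_local; lra.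
Qed.

(** * The limit curve has the right tangent, and it is unique *)

Section flow_tangent.
Context {s : R -> X}.
Context (s_lip : forall t t', 0 <= t -> 0 <= t' -> mdist (s t) (s t') <= `|t - t'|).
Context (s_evi : forall a b z, 0 <= a <= b -> mdist (s b) z ^+ 2 <=
    mdist (s a) z ^+ 2 + 2 * (b - a) * (F a z - F a (s a)) + 3 * (b - a) ^+ 2).

Local Ltac drop_flow_local := clear - hX Y_nonempty Y_closed Y_convex Y_lip F s_lip s_evi.

(** Aim at the fixed point [z = g h]. The squared distance, initially [h ^+ 2], decreases at rate
    [2 * ((1 - e ^+ 2 / 2) * h - (u - a))]; over a time [h] this leaves [e ^+ 2 * h ^+ 2]. *)
Lemma flow_follows_geodesic a (g : geodesic_from (s a)) (e : R) : 0 <= a ->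
  Y a (geod_end g) -> geod_length g = F a (s a) -> 0 < e ->
  exists2 d, 0 < d & [/\ d <= geod_length g &
    forall h, 0 < h < d -> mdist (s (a + h)) (g h) <= e * h].
Proof.
move=> a0 Yg gl e0; have e2 : 0 < e ^+ 2 / 2 by rewrite divr_gt0// exprn_gt0.
have [d d0 dP] := moving_dist_along_geodesic a0 Yg gl e2.
exists (Num.min d (geod_length g)); first by rewrite lt_min d0 geod_length_gt0.
rewrite ge_min lexx orbT; split => // h /andP[h0]; rewrite lt_min => /andP[hd hg].
(* The subtracted terms integrate the bound on the rate, so each step leaves only a quadratic error,
   which [quadratic_le] removes. *)
pose z := g h; pose E t := mdist (s t) z ^+ 2 - 2 * ((e ^+ 2 / 2 - 1) * h) * (t - a) - (t - a) ^+ 2.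
have : E (a + h) <= E a.
  apply: (@quadratic_le _ E a (a + h) 3); first by rewrite lerDl ltW.
  move=> u t /andP[au ut] tah; rewrite /E.
  have u0 := le_trans a0 au; have := s_evi z (introT andP (conj u0 ut)).
  have := dP h u; rewrite h0 hd au (le_trans ut)// => /(_ isT isT); rewrite -/z => F1.
  have := dist_to_lipschitz (s a) (s u) (Y_nonempty u0); rewrite -/(F _ _) -/(F _ _) => F2.
  have := s_lip a0 u0; rewrite ler0_norm ?subr_le0// opprB => F3.
  have tu : 0 <= t - u by rewrite subr_ge0.
  have : (t - u) * (F u z - F u (s u)) <= (t - u) * ((e ^+ 2 / 2 - 1) * h + (u - a)).
    by rewrite ler_wpM2l//; lra.
  by drop_flow_local; have := sqr_ge0 (t - u); lra.
have gI : 0 <= h <= geod_length g by rewrite !ltW.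
have haE : a + h - a = h by ring.
rewrite /E subrr haE {2}/z geodesic_from_dist// => le1.
rewrite -(@ler_pXn2r _ 2)// ?nnegrE ?mdist_ge0 ?mulr_ge0 ?(ltW e0) ?(ltW h0)//.
by rewrite -/z; lra.
Qed.

Lemma flow_right_tangent a (g : geodesic_from (s a)) (r : {posnum R}) : 0 <= a ->
  Y a (geod_end g) -> geod_length g = F a (s a) -> r%:num = 1 ->
  right_tangent s a (Vec (direction g) r).
Proof.
move=> a0 Yg gl r1; split => //.
- exists (a + 1); first by rewrite ltrDl.
  apply: (lipschitz_rectifiable (L := 1)) => u v /andP[au _] /andP[av _].
  by rewrite mul1r s_lip// (le_trans a0).
- rewrite /= r1; apply/cvgrPdist_le => e e0.
  have [d d0 [dg dP]] := flow_follows_geodesic a0 Yg gl e0.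
  apply: (at_right_near d0) => k kd; have := dP _ kd; case/andP: (kd) => k0 kd1 sg.
  have gk : mdist (s a) (g k) = k.
    by rewrite geodesic_from_dist// (ltW k0) (le_trans (ltW kd1)).
  have -> : a + k - a = k by ring.
  have -> : 1 - mdist (s (a + k)) (s a) / k = (k - mdist (s (a + k)) (s a)) / k.
    by field; rewrite gt_eqF.
  rewrite normrM [`|k^-1|]gtr0_norm ?invr_gt0// ler_pdivrMr//.
  have := metric_triangle (s a) (s (a + k)) (g k); have := metric_triangle (s (a + k)) (g k) (s a).
  rewrite (metric_sym (g k)) (metric_sym (s a) (s (a + k))) gk => t1 t2.
  by rewrite ler_norml; apply/andP; split; lra.
(* A deviation [f * k] gives a chord of at most [4 * f] and an angle of at most [8 * f], half of the
   tolerance in [completion_dist_small]. *)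
move=> e e0; pose f := Num.min 4^-1 (e / 9) / 16.
have m0 : 0 < Num.min 4^-1 (e / 9) by rewrite lt_min; apply/andP; split; [rewrite invr_gt0|rewrite divr_gt0].
have f0 : 0 < f by rewrite divr_gt0.
have f4 : f <= 4^-1 / 16 by rewrite ler_pM2r ?invr_gt0// ge_min lexx.
have [d d0 [dg dP]] := flow_follows_geodesic a0 Yg gl f0.
apply: (at_right_near d0) => k kd g' g'e; have := dP _ kd; case/andP: (kd) => k0 kd1 sg.
apply: (completion_dist_small hX) => //.
have kI : 0 <= k <= geod_length g by rewrite (ltW k0) (le_trans (ltW kd1)).
have gk := geodesic_from_dist kI.
have g'l : geod_length g' = mdist (s a) (s (a + k)) by rewrite geod_length_mdist g'e.
have := @chord_between _ _ hX (s a) g' g (geod_length g') k.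
rewrite lexx (ltW (geod_length_gt0 g')) kI => /(_ isT isT); rewrite -/(geod_end g') g'e g'l.
have tri := metric_triangle (s a) (s (a + k)) (g k); rewrite gk in tri.
have fk : f * k <= 4^-1 / 16 * k by rewrite ler_pM2r.
have mk : k / 2 <= Num.min (mdist (s a) (s (a + k))) k.
  by rewrite le_min; apply/andP; split; lra.
have : k / 2 * chord g' g <= Num.min (mdist (s a) (s (a + k))) k * chord g' g.
  by rewrite ler_wpM2r// chord_ge0.
move=> h1 h2; have : k * chord g' g <= k * (4 * f) by lra.
rewrite ler_pM2l// => h3; have : chord g' g <= 1 by lra.
move=> /(angle_le_chord hX) h4; apply: (le_lt_trans h4); rewrite /f in h3 f0; lra.
Qed.

(** The infinitesimal inequality of [s'] is used with [z = s t], and the inequality of [s] with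
    [z = s' (t + k)]. In the sum [F t (s t)] cancels, and the change of [F t] along [s'] is of order
    [k], hence contributes only order [k ^+ 2]. *)
Lemma flow_unique s' b : s 0 = s' 0 -> 0 <= b ->
  locally_lipschitz_on [set t | 0 <= t <= b] s' ->
  (forall t, 0 <= t < b -> moves_toward (Y t) (s' t) (fun k => s' (t + k))) ->
  s' b = s b.
Proof.
move=> s0 b0 lip toward; pose E t := mdist (s t) (s' t) ^+ 2.
have Eb : forall e, 0 < e -> E b <= e * b.
  move=> e e0; have -> : e * b = E 0 + e * (b - 0).
    by rewrite /E s0 mdistxx expr0n/= add0r subr0.
  apply: dini_le => //.
    move=> t n tI n0; have [d [L [d0 dL]]] := lip t tI.
    have L0 : 0 < `|L| + 1 by rewrite ltr_wpDl.
    pose Z := mdist (s t) (s' t) + (`|L| + 1).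
    have Z0 : 0 < Z by rewrite ltr_wpDl ?mdist_ge0.
    have m0 : 0 < 2 * Z * (`|L| + 1) by rewrite !mulr_gt0.
    exists (Num.min (Num.min d 1) (n / (2 * Z * (`|L| + 1)))).
      by rewrite !lt_min d0 ltr01 divr_gt0.
    move=> u uI; rewrite !lt_min => /andP[/andP[ud u1]]; rewrite ltr_pdivlMr// => un.
    have := dL t u tI uI; rewrite subrr normr0 d0 ud => /(_ isT isT) l1.
    have t0 : 0 <= t by case/andP: tI. have u0 : 0 <= u by case/andP: uI.
    have l2 := s_lip t0 u0; rewrite (distrC t) in l1 l2.
    have l3 : L * `|u - t| <= `|L| * `|u - t| by rewrite ler_wpM2r// ler_norm.
    have p0 : 0 <= `|u - t| by [].
    have l4 : `|L| * `|u - t| <= `|L| * 1 by rewrite ler_wpM2l// ltW.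
    have tri1 := metric_triangle (s t) (s u) (s' t); have tri2 := metric_triangle (s u) (s' u) (s' t).
    have tri3 := metric_triangle (s u) (s t) (s' u); have tri4 := metric_triangle (s t) (s' t) (s' u).
    rewrite (metric_sym (s' u)) in tri2; rewrite (metric_sym (s u) (s t)) in tri3.
    have diff : mdist (s t) (s' t) - mdist (s u) (s' u) <= (`|L| + 1) * `|u - t|.
      by move: l1 l2 l3 tri1 tri2; drop_flow_local; lra.
    have sum : mdist (s t) (s' t) + mdist (s u) (s' u) <= 2 * Z.
      by rewrite /Z; move: (normr_ge0 L) l1 l2 l3 l4 u1 tri3 tri4; drop_flow_local; lra.
    have := mdist_ge0 (s t) (s' t); have := mdist_ge0 (s u) (s' u) => d1 d2.
    rewrite /E -lerBlDl subr_sqr; apply: (le_trans _ (ltW un)).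
    apply: (@le_trans _ _ ((`|L| + 1) * `|u - t| * (mdist (s t) (s' t) + mdist (s u) (s' u)))).
      by rewrite ler_wpM2r// addr_ge0.
    have : (`|L| + 1) * `|u - t| * (mdist (s t) (s' t) + mdist (s u) (s' u)) <=
      (`|L| + 1) * `|u - t| * (2 * Z) by rewrite ler_wpM2l// mulr_ge0// ltW.
    by move=> /le_trans; apply; drop_flow_local; lra.
  move=> t /andP[t0 tb]; have tI : 0 <= t <= b by rewrite t0 ltW.
  have [d [L [d0 dL]]] := lip t tI.
  have L0 : 0 < `|L| + 1 by rewrite ltr_wpDl.
  have [r [r0 rd rb]] : exists r, [/\ 0 < r, r <= d / 2 & r <= b - t].
    exists (Num.min (d / 2) (b - t)); rewrite !ge_min !lexx orbT; split => //.
    by rewrite lt_min divr_gt0// subr_gt0.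
  have s'L u v : t <= u <= t + r -> t <= v <= t + r -> mdist (s' u) (s' v) <= (`|L| + 1) * `|u - v|.
    move=> /andP[tu ur] /andP[tv vr].
    have uI : 0 <= u <= b by rewrite (le_trans t0)//=; move: ur rb; drop_flow_local; lra.
    have vI : 0 <= v <= b by rewrite (le_trans t0)//=; move: vr rb; drop_flow_local; lra.
    apply: le_trans (dL u v uI vI _ _) _.
    - by rewrite ger0_norm ?subr_ge0//; move: ur rd d0; drop_flow_local; lra.
    - by rewrite ger0_norm ?subr_ge0//; move: vr rd d0; drop_flow_local; lra.
    by rewrite ler_wpM2r// (le_trans (ler_norm L))// lerDl.
  have tw u : t <= u < t + r -> moves_toward (Y u) (s' u) (fun k => s' (u + k)).
    by move=> /andP[tu ur]; apply: toward; rewrite (le_trans t0)//=; move: ur rb; drop_flow_local; lra.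
  have e4 : 0 < e / 4 by rewrite divr_gt0.
  have [d1 d10 d1P] := gradient_dini_evi t0 r0 (ltW L0) s'L tw (s t) e4.
  have M0 : 0 < 2 * (`|L| + 1) + 3 by rewrite ltr_wpDl// mulr_ge0// ltW.
  pose k := Num.min (Num.min r (d1 / 2)) (e / 2 / (2 * (`|L| + 1) + 3)).
  have k0 : 0 < k by rewrite !lt_min r0 !divr_gt0.
  have kr : k <= r by rewrite !ge_min lexx.
  have kd1 : k <= d1 / 2 by rewrite !ge_min lexx orbT.
  have ke : k * (2 * (`|L| + 1) + 3) <= e / 2 by rewrite -ler_pdivlMr// ge_min lexx orbT.
  exists k; split => //; first by move: kr rb; drop_flow_local; lra.
  have tk : t <= t + k <= t + r by rewrite lerDl (ltW k0) lerD2l.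
  have tt : t <= t <= t + r by rewrite lexx lerDl ltW.
  have := d1P (t + k); rewrite ltrDl k0 ltrD2l (le_lt_trans kd1) => [/(_ isT)|]; last first.
    by rewrite ltr_pdivrMr// ltr_pMr// ltr1n.
  have tkE : t + k - t = k by ring.
  rewrite tkE => v1; have := s_evi (s' (t + k)) (introT andP (conj t0 (proj1 (andP tk)))).
  rewrite tkE => v2; have := s'L _ _ tk tt; rewrite tkE (gtr0_norm k0) => v3.
  have := dist_to_lipschitz (s' (t + k)) (s' t) (Y_nonempty t0); rewrite -/(F _ _) -/(F _ _) => v4.
  rewrite (metric_sym (s' _) (s t)) (metric_sym (s' t) (s t)) in v1.
  have v5 : k * (F t (s' (t + k)) - F t (s' t)) <= k * ((`|L| + 1) * k).
    by rewrite ler_pM2l//; move: v3 v4; drop_flow_local; lra.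
  have v6 : k * (k * (2 * (`|L| + 1) + 3)) <= k * (e / 2) by rewrite ler_pM2l.
  rewrite /E; move: v1 v2 v5 v6; drop_flow_local; lra.
symmetry; apply: mdist_positivity; apply/eqP; rewrite -sqrf_eq0 eq_le sqr_ge0 andbT.
apply/ler_addgt0Pr => n n0; rewrite add0r; have b1 : 0 < b + 1 by rewrite ltr_wpDl.
apply: le_trans (Eb _ (divr_gt0 n0 b1)) _; rewrite mulrAC ler_pdivrMr// ler_pM2l// lerDl//.
Qed.

End flow_tangent.

End moving_sets.

Theorem theorem37 (R : realType) (X : metricType R) (hX : CAT0_space X)
    (Y : R -> set X)
    (Y_nonempty : forall t, 0 <= t -> Y t !=set0)
    (Y_closed : forall t, 0 <= t -> closed (Y t))
    (Y_convex : forall t, 0 <= t -> geodesically_convex (Y t))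
    (Y_lip : forall t t', 0 <= t -> 0 <= t' ->
       (hausdorff_dist (Y t) (Y t') <= `|t - t'|%:E)%E)
    (x0 : X) :
  let F := fun t p => dist_to (Y t) p in
  exists (T : \bar R) (sigma : R -> X),
    [/\ gradient_curve F T sigma, sigma 0 = x0, runs_until_meeting Y T sigma
      & forall (T' : \bar R) (sigma' : R -> X),
          gradient_curve F T' sigma' -> sigma' 0 = x0 ->
          (forall t, time_domain T t -> time_domain T' t ->
             sigma' t = sigma t) /\
          (runs_until_meeting Y T' sigma' -> T' = T)].
Proof.
move=> F.
have [s [s0 s_lip s_evi]] := flow_exists hX Y_nonempty Y_closed Y_convex Y_lip x0.
pose f t := F t (s t).
have f_lip t t' : 0 <= t -> 0 <= t' -> f t <= f t' + 2 * `|t - t'|.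
  move=> t0 t'0.
  have := moving_dist_lipschitz hX Y_nonempty Y_closed Y_convex Y_lip (s t) (s t') t0 t'0.
  have := s_lip _ _ t0 t'0; rewrite -/(F _ _) -/(F _ _) -/(f t) -/(f t'); lra.
have f_ge0 t : 0 <= t -> 0 <= f t by move=> t0; apply: dist_to_ge0; exact: Y_nonempty.
(* The curve [s] exists for all times, also past the meeting; [T] is the first zero of the Lipschitz
   function [f], or infinite when there is none. *)
have runs : exists T, (0 <= T)%E /\ runs_until_meeting Y T s.
  have [[t [t0 ft0]]|none] := pselect (exists t, 0 <= t /\ f t = 0); last first.
    exists +oo%E; split => //; right; split => // t t0.
    rewrite lt_neqAle f_ge0// andbT eq_sym; apply/eqP => ft0.
    by apply: none; exists t.
  pose S := [set t | 0 <= t /\ f t = 0]; pose t1 := inf S.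
  have S_lb : has_lbound S by exists 0 => u [].
  have hS : has_inf S by split => //; exists t.
  have t10 : 0 <= t1 by apply: lb_le_inf => [|u []//]; exists t.
  exists t1%:E; split; first by rewrite lee_fin.
  left; exists t1; split => //.
    apply/eqP; rewrite eq_le f_ge0// andbT; apply/ler_addgt0Pr => e e0; rewrite add0r.
    have e2 : 0 < e / 2 by rewrite divr_gt0.
    have [u [u0 fu] ut1] := inf_adherent e2 hS.
    have t1u : t1 <= u by apply: ge_inf.
    apply: (le_trans (f_lip _ _ t10 u0)); rewrite fu ler0_norm ?subr_le0//.
    by rewrite -/t1 in ut1; lra.
  move=> u /andP[u0 ut1]; rewrite lt_neqAle f_ge0// andbT eq_sym; apply/eqP => fu.
  by have := ge_inf S_lb (conj u0 fu : S u); rewrite -/t1 leNgt ut1.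
have [T [T0 sT]] := runs; exists T, s.
(* [T'] is not compared with [T]: a gradient curve agrees with [s] on its whole domain, so its
   meeting time is a zero of [f] and must be the first one. *)
have unique T' s' : gradient_curve F T' s' -> s' 0 = x0 ->
    forall t, time_domain T' t -> s' t = s t.
  move=> [T'0 lip grad] s'0 b [b0 bT'].
  have sub : [set t | 0 <= t <= b] `<=` time_domain T'.
    by move=> t /= /andP[t0 tb]; split => //; apply: le_trans bT'; rewrite lee_fin.
  apply: (flow_unique hX Y_nonempty Y_closed Y_convex Y_lip s_lip s_evi) => //.
  - by rewrite s0 s'0.
  - move=> t tI; have [e [L [e0 eL]]] := lip t (sub _ tI); exists e, L; split => //.
    by move=> u v uI vI; apply: eL; exact: sub.
  move=> t /andP[t0 tb]; have tT' : (t%:E < T')%E by apply: lt_le_trans bT'; rewrite lte_fin.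
  have [v [tv gv]] := grad t t0 tT'.
  exact: (gradient_moves_toward hX (Y_nonempty _ t0) (Y_closed _ t0) (Y_convex _ t0) tv gv).
split => //.
- split => //.
    move=> t [t0 _]; exists 1, 1; split => // u v [u0 _] [v0 _] _ _.
    by rewrite mul1r s_lip.
  move=> t t0 tT; have ft0 : 0 < F t (s t).
    case: sT => [[t1 [_ T1 _ pos]]|[_ pos]]; last exact: pos.
    by apply: pos; rewrite t0 -lte_fin -T1.
  have [g [Yg gl]] := exists_geodesic_to_nearest hX (Y_nonempty _ t0) (Y_closed _ t0) (Y_convex _ t0) ft0.
  exists (Vec (direction g) (PosNum ltr01)); split.
    exact: (flow_right_tangent hX Y_nonempty Y_closed Y_convex Y_lip s_lip s_evi t0 Yg gl).
  exact: (gradient_distance_direction hX (Y_nonempty _ t0) (Y_closed _ t0) (Y_convex _ t0) Yg gl).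
move=> T' s' gs' s'0; have eq_s := unique _ _ gs' s'0; split.
  by move=> t _; exact: eq_s.
case: sT => [[t1 [t10 -> ft1 pos]]|[-> pos]].
  case=> [[t2 [t20 T2 ft2 pos2]]|[T2 pos2]]; last first.
    by have := pos2 t1 t10; rewrite eq_s ?ft1 ?ltxx//; split; rewrite // T2 leey.
  rewrite T2; congr EFin; have eq2 t : 0 <= t -> t <= t2 -> s' t = s t.
    by move=> t0 tt2; apply: eq_s; split; rewrite // T2 lee_fin.
  have [lt12|lt21|//] := ltgtP t2 t1.
    by have := pos t2; rewrite t20 lt12 -eq2// ft2 ltxx => /(_ isT).
  by have := pos2 t1; rewrite t10 lt21 (eq2 _ t10 (ltW lt21)) ft1 ltxx => /(_ isT).
case=> [[t2 [t20 T2 ft2 pos2]]|[-> //]].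
have tt2 : time_domain T' t2 by split; rewrite // T2.
by have := pos t2 t20; rewrite -(eq_s t2 tt2) ft2 ltxx.
Qed.
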